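(* u-$\#$APSP on directed unweighted $n$-vertex graphs can be solved in $\tilde{O}(n^3)$ time in the word-RAM model with $O(\log n)$-bit words (by a combinatorial algorithm).
   Context: u-$\#$APSP: given a directed unweighted graph $G=(V,E)$, compute for every pair $u,v\in V$ the exact number $C[u,v]$ of shortest paths from $u$ to $v$ (these numbers may have $\Theta(n)$ bits). $\tilde{O}$ hides polylogarithmic factors. *)

(* Defs.v *)
From mathcomp Require Import all_boot.

Set Implicit Arguments.
Unset Strict Implicit.
Unset Printing Implicit Defensive.

(** * Word RAM

    A machine with word size [w] computes on words, i.e. naturals below
    [2 ^ w].  It has registers and a random-access memory addressed by words;
    a program is a finite list of instructions (so it uses finitely many
    registers), and every instruction takes unit time. *)

Definition reg := nat.

Inductive binop :=
  | WAdd | WSub | WMul | WDiv | WMod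
  | WAnd | WOr | WXor | WShl | WShr
  | WLt | WEq.

Inductive instr :=
  | Const of reg & nat                 (* r := k                  *)
  | Op of binop & reg & reg & reg      (* r := s op t             *)
  | Read of reg & reg                  (* r := ram[s]             *)
  | Write of reg & reg                 (* ram[r] := s             *)
  | Jump of nat                        (* goto l                  *)
  | JumpZ of reg & nat                 (* if r = 0 then goto l    *)
  | Halt.

Definition program := seq instr.

Record state := State { pc : nat; regs : reg -> nat; ram : nat -> nat }.

(** Arithmetic is modulo [2 ^ w]; [WSub] therefore wraps around instead of being
    truncated at zero.  Division by zero yields quotient [0] and remainder [x]. *)
Definition eval_op (w : nat) (o : binop) (x y : nat) : nat :=
  (match o with
   | WAdd => x + y
   | WSub => x + 2 ^ w - y
   | WMul => x * y
   | WDiv => x %/ y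
   | WMod => x %% y
   | WAnd => Nat.land x y
   | WOr  => Nat.lor x y
   | WXor => Nat.lxor x y
   | WShl => x * 2 ^ y
   | WShr => x %/ 2 ^ y
   | WLt  => x < y
   | WEq  => x == y
   end) %% 2 ^ w.

(** Running off the end of the program halts. *)
Definition fetch (P : program) (s : state) : instr := nth Halt P (pc s).

Definition halted (P : program) (s : state) : bool :=
  if fetch P s is Halt then true else false.

(** A halted state is a fixed point of [step]; hence
    [halted P (iter t (step w P) s)] says that the run from [s] halts within
    [t] steps, and [iter t (step w P) s] is then its final state. *)
Definition step (w : nat) (P : program) (s : state) : state :=
  let: State p f m := s in
  match fetch P s with
  | Const r k    => State p.+1 [eta f with r |-> k %% 2 ^ w] m
  | Op o r s1 s2 => State p.+1 [eta f with r |-> eval_op w o (f s1) (f s2)] m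
  | Read r a     => State p.+1 [eta f with r |-> m (f a)] m
  | Write a r    => State p.+1 f [eta m with f a |-> f r]
  | Jump l       => State l f m
  | JumpZ r l    => State (if f r == 0 then l else p.+1) f m
  | Halt         => s
  end.

(** The natural number written in base [2 ^ w], least significant word first,
    in the [L] memory cells starting at address [a]. *)
Definition multiword (w : nat) (m : nat -> nat) (a L : nat) : nat :=
  \sum_(i < L) m (a + i) * 2 ^ (w * i).

(** * Shortest paths in a directed graph [E] on the vertices [0, ..., n - 1] *)

(** [p] lists the vertices following [u], so the path [u :: p] has [size p]
    edges; the empty [p] is the path of length [0] from [u] to [u]. *)
Definition path_from_to n (E : rel 'I_n) (u v : 'I_n) (p : seq 'I_n) : Prop :=
  path E u p /\ last u p = v.

Definition shortest_path n (E : rel 'I_n) (u v : 'I_n) (p : seq 'I_n) : Prop :=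
  path_from_to E u v p /\
  forall q, path_from_to E u v q -> size p <= size q.

(** There are exactly [N] shortest paths from [u] to [v] (so [N = 0] when [v] is
    not reachable from [u]). *)
Definition num_shortest_paths n (E : rel 'I_n) (u v : 'I_n) (N : nat) : Prop :=
  exists s : seq (seq 'I_n),
    [/\ uniq s, forall p, p \in s <-> shortest_path E u v p & size s = N].

(** * The problem u-#APSP on a word RAM *)

(** Register [0] holds [n]; cells [0, ..., n * n - 1] hold the adjacency matrix
    in row-major order; all other registers and cells are zero. *)
Definition init n (E : rel 'I_n) : state :=
  State 0 [eta (fun _ => 0) with 0 |-> n]
    (fun a => [exists u : 'I_n, exists v : 'I_n, (a == u * n + v) && E u v]).

(** Upon halting, register [0] holds an address [b] and register [1] a length
    [L]; the exact values [C[u, v]] are stored in row-major order from address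
    [b] on, each of them occupying [L] words. *)
Definition solves_in w (P : program) (t : nat) n (E : rel 'I_n) : Prop :=
  let s := iter t (step w P) (init E) in
  let b := regs s 0 in
  let L := regs s 1 in
  [/\ halted P s,
      b + n * n * L <= 2 ^ w
    & forall u v : 'I_n,
        num_shortest_paths E u v (multiword w (ram s) (b + (u * n + v) * L) L)].

(** [T = O~(g)]. *)
Definition soft_O (T g : nat -> nat) : Prop :=
  exists C k n0 : nat, forall n, n0 <= n -> T n <= C * (g n * trunc_log 2 n ^ k).

(** [O(log n)] bits: [c] times the length of the binary expansion of [n].  For
    [1 < c] all input values are words and all input cells are addressable. *)
Definition word_size (c n : nat) : nat := c * (trunc_log 2 n).+1.

(* Main.v *)
From mathcomp Require Import all_boot all_algebra qpoly zify ring.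
Require Import Defs.

Set Implicit Arguments.
Unset Strict Implicit.
Unset Printing Implicit Defensive.

(** * A structured language and its compiler *)

(** Write C[u,v] for the number of shortest paths and let dist(u,v) = d with 1 < d < n. For any 0 <
    t < d each shortest path from u to v passes through exactly one vertex x at distance t from u,
    so C[u,v] is the sum of C[u,x] * C[x,v] over the x with dist(u,x) = t and dist(x,v) = d - t
    ([cnt_split]). The layers at distances 1, ..., d - 1 from u are disjoint, so the smallest has at
    most n / (d - 1) vertices ([small_layer]). A count at distance d is at most n^d, hence has O(d
    log n) bits. If such numbers are multiplied in quasi-linear time, a pair costs about (n / d) * d
    = n up to logarithms, and all pairs about n^3. Pairs are treated by increasing distance, so the
    factors are always available. Distances come from repeated min-plus squaring, layer sizes from n
    passes over the distance matrix.

    Quasi-linear multiplication is Nussbaumer's transform. Counts are kept as digits in base B = 2^h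
    > n, that is, as polynomials, multiplied modulo x^N + 1 with coefficients modulo W = 2^w, where
    N = 2^k. With N = l * m and y = x^l, a polynomial becomes one of degree below l in x over the
    ring where y^m = -1. The product has degree below 2l in x, so it may be computed modulo x^(2l) -
    1, and in that ring y is itself a root of unity of order 2m: the butterflies of the FFT need
    only additions, subtractions and rotations of blocks ([ok2_merge], [ok1_fold]). The leaves are
    again products modulo y^m + 1, with m about the square root of N. After lam, about log k, levels
    the blocks have length 2. Every level doubles the array, and all nodes of one depth are handled
    by one linear pass.

    As 2 is not invertible modulo W, the inverse butterflies do not halve. The outcome is 2^(k - 1 +
    lam) times the convolution modulo W ([levels_conv]); it is below W, hence exact ([acc_exact]),
    and a shift removes the power of two. The transform is linear, so the products of all midpoints
    are summed in the transformed domain; each pair needs only one inverse transform and one carry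
    propagation ([zc_value], [pair_spec]).

    The algorithm is written in a small language of expressions, arrays and counted loops, with a
    static overflow check. Its compiler to the word RAM is proved correct with exact running time
    ([exec_ccode]), so all invariants and costs are established at the level of the language. The
    scales are V = B^16, which bounds all registers, array lengths and indices, and W = V^8 =
    B^128. *)

Inductive bop := Add | Mul | Sub | Div | Mod | Lt | Eq | Shr | RAdd | RSub | RMul | RShl.

Inductive expr :=
  | Num of nat
  | Var of nat
  | Rd of nat & expr
  | Bin of bop & expr & expr
  | Ite of expr & expr & expr.

Inductive cmd :=
  | Skip
  | Asg of nat & expr
  | Sto of nat & expr & expr
  | Seq of cmd & cmd
  | If of expr & cmd & cmd
  | For of nat & nat & expr & cmd.

Record st := St { rg : nat -> nat; ar : nat -> nat -> nat }.

Definition setr (s : st) r v := St [eta rg s with r |-> v] (ar s).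
Definition seta (s : st) a i v :=
  St (rg s) (fun b j => if (b == a) && (j == i) then v else ar s b j).

(** Program variables are the registers below 40; register 40 permanently holds [V], and the
    registers from 41 on form the evaluation stack of expressions. *)
Notation NV := 40.
Notation vreg := 40.
Notation tmp := 41.
Notation NA := 16.

(** These arrays hold numbers below [V] (edges, distances, layer sizes, twiddle exponents, digits);
    the others hold full words. *)
Definition idxarr (a : nat) := a < 5.

Definition code_at (P : program) p (cs : seq instr) :=
  forall i, i < size cs -> nth Halt P (p + i) = nth Halt cs i.

Lemma code_cat P p c1 c2 : code_at P p (c1 ++ c2) <-> code_at P p c1 /\ code_at P (p + size c1) c2.
Proof.
split.
  move=> H; split=> i Hi.
    by rewrite H ?nth_cat ?Hi // size_cat; lia.
  have := H (size c1 + i); rewrite size_cat ltn_add2l Hi nth_cat ltnNge leq_addr /= addKn addnA.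
  exact.
case=> H1 H2 i; rewrite size_cat nth_cat; case: (ltnP i (size c1)) => [Hi _|Hi H]; first exact: H1.
have -> : p + i = p + size c1 + (i - size c1) by lia.
by apply: H2; lia.
Qed.

Lemma code_cons P p i c : code_at P p (i :: c) <-> nth Halt P p = i /\ code_at P (p + 1) c.
Proof.
rewrite -[i :: c]cat1s code_cat /=; split; case=> H1 H2; split=> //.
  by have := H1 0 isT; rewrite addn0.
by case=> // _; rewrite addn0.
Qed.

Section Lang.
Variables (V w : nat).

(** The operations with prefix R wrap around modulo [2 ^ w]. The others are those of the natural
    numbers; the degree check below keeps their results within a word. *)
Definition evb (o : bop) (x y : nat) : nat :=
  match o with
  | Add => x + y | Mul => x * y | Sub => x - y
  | Div => x %/ y | Mod => x %% y | Lt => x < y | Eq => x == y | Shr => x %/ 2 ^ y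
  | RAdd => (x + y) %% 2 ^ w | RSub => (x + 2 ^ w - y) %% 2 ^ w
  | RMul => (x * y) %% 2 ^ w | RShl => (x * 2 ^ y) %% 2 ^ w
  end.

Fixpoint ev (e : expr) (s : st) : nat :=
  match e with
  | Num k => k
  | Var r => rg s r
  | Rd a e => ar s a (ev e s %% V)
  | Bin o e1 e2 => evb o (ev e1 s) (ev e2 s)
  | Ite e e1 e2 => if ev e s == 0 then ev e2 s else ev e1 s
  end.

Definition stv a v := if idxarr a then v %% V else v.

Fixpoint loop (f : st -> st) (r : nat) (n : nat) (s : st) : st :=
  if n is n'.+1 then f (setr (loop f r n' s) r n') else s.

(** Registers and indices are reduced modulo [V] at every assignment, so that well-formed commands
    preserve the bounds [inv] without side conditions; the specifications below show where the
    reduction changes nothing. *)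
Fixpoint run (c : cmd) (s : st) : st :=
  match c with
  | Skip => s
  | Asg r e => setr s r (ev e s %% V)
  | Sto a e1 e2 => seta s a (ev e1 s %% V) (stv a (ev e2 s))
  | Seq c1 c2 => run c2 (run c1 s)
  | If e c1 c2 => if ev e s == 0 then run c2 s else run c1 s
  | For r rb e c =>
      let n := ev e s %% V in
      setr (loop (run c) r n (setr s rb n)) r n
  end.

(** Truncated subtraction is branch-free: the wrapped difference is multiplied by the negation of
    the flag telling that it would be negative. *)
Definition bcode (o : bop) (d : nat) : seq instr :=
  match o with
  | Add | RAdd => [:: Op WAdd d d d.+1] | Mul | RMul => [:: Op WMul d d d.+1]
  | Sub => [:: Op WLt d.+2 d d.+1; Op WSub d d d.+1; Const d.+3 0;
               Op WEq d.+2 d.+2 d.+3; Op WMul d d d.+2]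
  | Div => [:: Op WDiv d d d.+1] | Mod => [:: Op WMod d d d.+1]
  | Lt => [:: Op WLt d d d.+1] | Eq => [:: Op WEq d d d.+1]
  | Shr => [:: Op WShr d d d.+1] | RSub => [:: Op WSub d d d.+1] | RShl => [:: Op WShl d d d.+1]
  end.

Definition acode a d : seq instr :=
  [:: Op WMod d d vreg; Const d.+1 a; Op WMul d.+1 d.+1 vreg; Op WAdd d d.+1 d].

(** A conditional expression evaluates both branches and selects by multiplying with 0 or 1, so the
    running time [esz] of an expression does not depend on the state. *)
Fixpoint ecode (e : expr) (d : nat) : seq instr :=
  match e with
  | Num k => [:: Const d k]
  | Var r => [:: Op WOr d r r]
  | Rd a e => ecode e d ++ acode a d ++ [:: Read d d]
  | Bin o e1 e2 => ecode e1 d ++ ecode e2 d.+1 ++ bcode o d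
  | Ite e e1 e2 => ecode e d ++ ecode e1 d.+1 ++ ecode e2 d.+2 ++
      [:: Const d.+3 0; Op WEq d d d.+3; Op WMul d.+2 d.+2 d; Op WEq d d d.+3;
          Op WMul d.+1 d.+1 d; Op WAdd d d.+1 d.+2]
  end.

Fixpoint esz (e : expr) : nat :=
  match e with
  | Num k => 1
  | Var r => 1
  | Rd a e => esz e + 5
  | Bin o e1 e2 => esz e1 + esz e2 + (if o is Sub then 5 else 1)
  | Ite e e1 e2 => esz e + esz e1 + esz e2 + 6
  end.

Lemma size_ecode e d : size (ecode e d) = esz e.
Proof.
elim: e d => //= [a e IH|o e1 IH1 e2 IH2|e IH e1 IH1 e2 IH2] d.
- by rewrite !size_cat IH.
- by rewrite !size_cat IH1 IH2 addnA; case: o.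
- by rewrite !size_cat IH IH1 IH2 !addnA.
Qed.

Definition scode a e1 e2 : seq instr :=
  ecode e1 tmp ++ acode a tmp ++ ecode e2 tmp.+1 ++
  (if idxarr a then [:: Op WMod tmp.+1 tmp.+1 vreg] else [::]) ++ [:: Write tmp tmp.+1].

Fixpoint csz (c : cmd) : nat :=
  match c with
  | Skip => 0
  | Asg r e => (esz e).+1
  | Sto a e1 e2 => esz e1 + 4 + esz e2 + idxarr a + 1
  | Seq c1 c2 => csz c1 + csz c2
  | If e c1 c2 => esz e + 1 + csz c1 + 1 + csz c2
  | For r rb e c => esz e + 4 + csz c + 3
  end.

Fixpoint ccode (c : cmd) (p : nat) : seq instr :=
  match c with
  | Skip => [::]
  | Asg r e => ecode e tmp ++ [:: Op WMod r tmp vreg]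
  | Sto a e1 e2 => scode a e1 e2
  | Seq c1 c2 => ccode c1 p ++ ccode c2 (p + csz c1)
  | If e c1 c2 =>
      let q := p + esz e + 1 + csz c1 + 1 in
      ecode e tmp ++ [:: JumpZ tmp q] ++ ccode c1 (p + esz e + 1)
        ++ [:: Jump (q + csz c2)] ++ ccode c2 q
  | For r rb e c =>
      let q := p + esz e + 4 + csz c + 3 in
      ecode e tmp ++ [:: Op WMod rb tmp vreg; Const r 0; Op WLt tmp r rb; JumpZ tmp q]
       ++ ccode c (p + esz e + 4) ++
       [:: Const tmp 1; Op WAdd r r tmp; Jump (p + esz e + 2)]
  end.

Lemma size_ccode c p : size (ccode c p) = csz c.
Proof.
elim: c p => //= [r e|a e1 e2|c1 IH1 c2 IH2|e c1 IH1 c2 IH2|r rb e c IH] p.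
- by rewrite size_cat size_ecode addn1.
- by rewrite !size_cat !size_ecode; case: idxarr => /=; lia.
- by rewrite size_cat IH1 IH2.
- by rewrite !size_cat size_ecode /= !size_cat /= IH1 IH2; lia.
- by rewrite !size_cat size_ecode /= !size_cat /= IH; lia.
Qed.

(** Exact running time of the compiled code. A loop iteration pays 5 for test, increment and jump
    back; the 4 are the two initialisations and the failing last test. *)
Fixpoint cost (c : cmd) (s : st) : nat :=
  match c with
  | Skip => 0
  | Asg r e => (esz e).+1
  | Sto a e1 e2 => esz e1 + 4 + esz e2 + idxarr a + 1
  | Seq c1 c2 => cost c1 s + cost c2 (run c1 s)
  | If e c1 c2 => esz e + 1 + if ev e s == 0 then cost c2 s else cost c1 s + 1
  | For r rb e c =>
      let n := ev e s %% V in
      esz e + 4 + \sum_(i < n) (cost c (setr (loop (run c) r i (setr s rb n)) r i) + 5)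
  end.

Fixpoint wr (c : cmd) : seq nat :=
  match c with
  | Asg r _ => [:: r]
  | Seq c1 c2 => wr c1 ++ wr c2
  | If _ c1 c2 => wr c1 ++ wr c2
  | For r rb _ c => [:: r, rb & wr c]
  | _ => [::]
  end.

Fixpoint wa (c : cmd) : seq nat :=
  match c with
  | Sto a _ _ => [:: a]
  | Seq c1 c2 => wa c1 ++ wa c2
  | If _ c1 c2 => wa c1 ++ wa c2
  | For _ _ _ c => wa c
  | _ => [::]
  end.

Lemma loop_inv (P : nat -> st -> Prop) f r n s :
  P 0 s -> (forall i s', i < n -> P i s' -> P i.+1 (f (setr s' r i))) -> P n (loop f r n s).
Proof.
elim: n => //= n IH H0 HS.
by apply: (HS) => //; apply: IH => // i s' Hi; apply: (HS); apply: ltnW.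
Qed.

Lemma run_rg c s r : r \notin wr c -> rg (run c s) r = rg s r.
Proof.
elim: c s => //= [r' e|c1 IH1 c2 IH2|e c1 IH1 c2 IH2|r' rb e c IH] s.
- by rewrite inE => /negbTE ->.
- by rewrite mem_cat negb_or => /andP[H1 H2]; rewrite IH2 ?IH1.
- by rewrite mem_cat negb_or => /andP[H1 H2]; case: eqP => _; rewrite ?IH2 ?IH1.
- rewrite !inE !negb_or => /and3P[/negbTE H1 /negbTE H2 H3]; rewrite H1.
  apply: (@loop_inv (fun _ s' => rg s' r = rg s r)) => [|i s' _ <-] /=; first by rewrite H2.
  by rewrite IH //= H1.
Qed.

Lemma run_ar c s a : a \notin wa c -> ar (run c s) a = ar s a.
Proof.
elim: c s => //= [b e1 e2|c1 IH1 c2 IH2|e c1 IH1 c2 IH2|r' rb e c IH] s.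
- by rewrite inE => /negbTE ->.
- by rewrite mem_cat negb_or => /andP[H1 H2]; rewrite IH2 ?IH1.
- by rewrite mem_cat negb_or => /andP[H1 H2]; case: eqP => _; rewrite ?IH2 ?IH1.
- move=> H.
  apply: (@loop_inv (fun _ s' => ar s' a = ar s a)) => [|i s' _ <-] //=.
  by rewrite IH.
Qed.

(** Static overflow check: an expression of degree [d] has value below [V ^ d],
    and [2 ^ w = V ^ 8]. *)
Fixpoint deg (e : expr) : nat :=
  match e with
  | Num _ | Var _ => 1
  | Rd a _ => if idxarr a then 1 else 8
  | Bin o e1 e2 =>
    match o with
    | Add => (maxn (deg e1) (deg e2)).+1
    | Mul => deg e1 + deg e2
    | Sub | Div | Mod | Shr => deg e1
    | Lt | Eq => 1
    | _ => 8
    end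
  | Ite _ e1 e2 => maxn (deg e1) (deg e2)
  end.

Fixpoint wfe (e : expr) : bool :=
  (deg e <= 8) &&
  match e with
  | Num k => k < 256
  | Var r => r < NV
  | Rd a e => (a < NA) && wfe e
  | Bin o e1 e2 => wfe e1 && wfe e2
  | Ite e e1 e2 => [&& wfe e, wfe e1 & wfe e2]
  end.

Fixpoint wfc (c : cmd) : bool :=
  match c with
  | Skip => true
  | Asg r e => (r < NV) && wfe e
  | Sto a e1 e2 => [&& a < NA, wfe e1 & wfe e2]
  | Seq c1 c2 => wfc c1 && wfc c2
  | If e c1 c2 => [&& wfe e, wfc c1 & wfc c2]
  | For r rb e c => [&& r < NV, rb < NV, r != rb, r \notin wr c, rb \notin wr c, wfe e & wfc c]
  end.

Hypothesis V256 : 256 <= V.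
Hypothesis W_V : 2 ^ w = V ^ 8.

Definition inv (s : st) : Prop :=
  [/\ forall r, rg s r < V,
      forall a i, idxarr a -> ar s a i < V
    & forall a i, ar s a i < 2 ^ w].

(** A sum costs one degree because two numbers below [M] add up to less than [2 * M <= V * M]; a
    product adds degrees. *)
Lemma ev_deg e s : inv s -> wfe e -> ev e s < V ^ deg e.
Proof.
move=> [Hr Hi Ha].
have V1 : 1 < V by lia.
have W0 : 0 < 2 ^ w by rewrite expn_gt0.
elim: e => [k|r|a e IH|o e1 IH1 e2 IH2|e IH e1 IH1 e2 IH2].
- by move=> /= ?; rewrite expn1; lia.
- by move=> _ /=; rewrite expn1.
- rewrite /= => _; case: ifP => Ea; first by rewrite expn1 Hi.
  by rewrite -W_V.
- move=> /= /and3P[D /IH1 {}IH1 /IH2 {}IH2].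
  case: o D => /= D; rewrite -?W_V ?ltn_mod //.
  + rewrite expnS.
    have := leq_pexp2l (ltnW V1) (leq_maxl (deg e1) (deg e2)).
    have := leq_pexp2l (ltnW V1) (leq_maxr (deg e1) (deg e2)).
    set M := V ^ maxn _ _ => A1 A2.
    have : 2 * M <= V * M by rewrite leq_mul2r V1 orbT.
    lia.
  + by rewrite expnD; apply: ltn_mul.
  + by apply: leq_ltn_trans IH1; rewrite leq_subr.
  + by apply: leq_ltn_trans IH1; rewrite leq_div.
  + by apply: leq_ltn_trans IH1; rewrite leq_mod.
  + by rewrite expn1; apply: leq_ltn_trans (leq_b1 _) V1.
  + by rewrite expn1; apply: leq_ltn_trans (leq_b1 _) V1.
  + by apply: leq_ltn_trans IH1; rewrite leq_div.
- move=> /= /and4P[D _ /IH1 {}IH1 /IH2 {}IH2].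
  case: ifP => _; [apply: (leq_trans IH2) | apply: (leq_trans IH1)];
  by rewrite leq_pexp2l ?leq_maxl ?leq_maxr // ltnW.
Qed.

Lemma wfe_deg e : wfe e -> deg e <= 8.
Proof. by case: e => [?|?|??|???|???] /andP[]. Qed.

Lemma ev_lt e s : inv s -> wfe e -> ev e s < 2 ^ w.
Proof.
move=> Hi He; rewrite W_V; apply: leq_trans (ev_deg Hi He) _.
by rewrite leq_pexp2l ?wfe_deg //; lia.
Qed.

Lemma inv_setr s r v : inv s -> v < V -> inv (setr s r v).
Proof. by case=> H1 H2 H3 Hv; split => //= r'; case: eqP. Qed.

Lemma V_gt0 : 0 < V. Proof. lia. Qed.
Lemma V_ltW : V < 2 ^ w.
Proof. by rewrite W_V -[X in X < _]expn1 ltn_exp2l //; lia. Qed.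
Lemma mod_ltV x : x %% V < V. Proof. by rewrite ltn_mod V_gt0. Qed.

Lemma inv_run c s : inv s -> wfc c -> inv (run c s).
Proof.
elim: c s => //= [r e|a e1 e2|c1 IH1 c2 IH2|e c1 IH1 c2 IH2|r rb e c IH] s Hs.
- by move=> _; apply: inv_setr => //; apply: mod_ltV.
- case/and3P=> Ha H1 H2; have E2 := ev_lt Hs H2; case: Hs => Hr Hi Hw; split=> //= b i.
  + move=> Hb; case: eqP => [e|_] /=; last exact: Hi.
    case: eqP => _; last by apply: Hi.
    by rewrite /stv -e Hb mod_ltV.
  + case: eqP => _ //=; case: eqP => _ //; rewrite /stv; case: ifP => // _.
    by apply: leq_trans (mod_ltV _) (ltnW V_ltW).
- by case/andP=> H1 H2; apply: IH2 => //; apply: IH1.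
- by case/and3P=> _ H1 H2; case: ifP => _; [apply: IH2 | apply: IH1].
- case/and5P=> _ _ _ _ /and3P[_ _ Hc]; apply: inv_setr; last exact: mod_ltV.
  apply: (@loop_inv (fun _ => inv)) => [|i s' Hi Is].
    by apply: inv_setr => //; apply: mod_ltV.
  apply: IH => //; apply: inv_setr => //.
  by apply: ltn_trans Hi (mod_ltV _).
Qed.

(** * Correctness of the compiler *)

(** Array [a] occupies the addresses from [a * V] on; scratch registers above [vreg] are
    unconstrained. *)
Definition rel_st (f : nat -> nat) (m : nat -> nat) (s : st) : Prop :=
  [/\ forall r, r < NV -> f r = rg s r, f vreg = V
    & forall a i, a < NA -> i < V -> m (a * V + i) = ar s a i].

Definition agree d (f f' : nat -> nat) := forall r, r < d -> f' r = f r.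

Lemma upd_ne (f : nat -> nat) r d v : r != d -> [eta f with d |-> v] r = f r.
Proof. by move=> /= /negbTE ->. Qed.

Lemma agree_trans d d' f g h : d <= d' -> agree d f g -> agree d' g h -> agree d f h.
Proof. by move=> Hd H1 H2 r Hr; rewrite H2 ?H1 //; lia. Qed.

Lemma rel_agree d f f' m s : tmp <= d -> agree d f f' -> rel_st f m s -> rel_st f' m s.
Proof.
move=> Hd Hf [H1 H2 H3]; split=> //.
- by move=> r Hr; rewrite Hf ?H1 //; lia.
- by rewrite Hf.
Qed.

Section Exec.
Variable P : program.
Notation stp := (step w P).
Notation go t s := (iter t stp s).

Lemma goD t1 t2 s : go (t1 + t2) s = go t2 (go t1 s).
Proof. by rewrite addnC iterD. Qed.

(** [runs t p f m p' f' m']: after [t] steps the machine goes from one state to the other. *)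
Definition runs t p f m p' f' m' := go t (State p f m) = State p' f' m'.

Lemma stp_Const p f m r k : nth Halt P p = Const r k ->
  runs 1 p f m (p + 1) [eta f with r |-> k %% 2 ^ w] m.
Proof. by rewrite /runs /= /fetch /= addn1 => ->. Qed.
Lemma stp_Op p f m o r a b : nth Halt P p = Op o r a b ->
  runs 1 p f m (p + 1) [eta f with r |-> eval_op w o (f a) (f b)] m.
Proof. by rewrite /runs /= /fetch /= addn1 => ->. Qed.
Lemma stp_Read p f m r a : nth Halt P p = Read r a ->
  runs 1 p f m (p + 1) [eta f with r |-> m (f a)] m.
Proof. by rewrite /runs /= /fetch /= addn1 => ->. Qed.
Lemma stp_Write p f m r a : nth Halt P p = Write a r ->
  runs 1 p f m (p + 1) f [eta m with f a |-> f r].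
Proof. by rewrite /runs /= /fetch /= addn1 => ->. Qed.
Lemma stp_Jump p f m l : nth Halt P p = Jump l -> runs 1 p f m l f m.
Proof. by rewrite /runs /= /fetch /= => ->. Qed.
Lemma stp_JumpZ p f m r l : nth Halt P p = JumpZ r l ->
  runs 1 p f m (if f r == 0 then l else p + 1) f m.
Proof. by rewrite /runs /= /fetch /= addn1 => ->. Qed.


Lemma runs_trans t1 t2 p f m p1 f1 m1 p2 f2 m2 :
  runs t1 p f m p1 f1 m1 -> runs t2 p1 f1 m1 p2 f2 m2 -> runs (t1 + t2) p f m p2 f2 m2.
Proof. by rewrite /runs goD => -> ->. Qed.

(** Symbolic execution of straight-line code: the resulting register file is obtained by computation
    instead of one step lemma per instruction. *)
Fixpoint xs (cs : seq instr) (f : nat -> nat) : nat -> nat :=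
  match cs with
  | Const r k :: cs => xs cs [eta f with r |-> k %% 2 ^ w]
  | Op o r a b :: cs => xs cs [eta f with r |-> eval_op w o (f a) (f b)]
  | _ => f
  end.

Definition straight (i : instr) :=
  match i with Const _ _ | Op _ _ _ _ => true | _ => false end.

Lemma runs_xs cs p f m : all straight cs -> code_at P p cs ->
  runs (size cs) p f m (p + size cs) (xs cs f) m.
Proof.
elim: cs p f => [|i cs IH] p f /=; first by rewrite addn0.
case/andP; case: i => // [r k|o r a b] _ Hs /code_cons[H Hc];
rewrite -add1n addnA; apply: runs_trans; try (apply: IH => //).
- exact: stp_Const.
- exact: stp_Op.
Qed.

Lemma dS d : ((d.+1 == d) = false) * ((d.+2 == d) = false) * ((d.+3 == d) = false)
  * ((d == d.+1) = false) * ((d == d.+2) = false) * ((d == d.+3) = false).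
Proof. by do !split; apply/eqP; lia. Qed.

Lemma xs_agree cs d f : all (fun i => match i with Const r _ | Op _ r _ _ => d <= r | _ => true end) cs ->
  agree d f (xs cs f).
Proof.
elim: cs f => //= i cs IH f /andP[Hi Hc]; case: i Hi => // [r k|o r a b] Hr;
apply: agree_trans (IH _ Hc) => // r' Hr' /=; case: eqP => // E; lia.
Qed.

Lemma exec_bcode o p f m d : code_at P p (bcode o d) ->
  f d < 2 ^ w -> f d.+1 < 2 ^ w -> evb o (f d) (f d.+1) < 2 ^ w ->
  exists f', [/\ runs (size (bcode o d)) p f m (p + size (bcode o d)) f' m,
    f' d = evb o (f d) (f d.+1) & agree d f f'].
Proof.
move=> Hc Hx Hy Hr; exists (xs (bcode o d) f); split.
- by apply: runs_xs => //; case: (o).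
- have W2 : 1 < 2 ^ w by have := V_ltW; lia.
  case: o Hr {Hc} => /= Hr; rewrite /= ?eqSS ?eqxx ?dS //= ?eqSS ?eqxx ?dS /= /eval_op ?modn_mod ?(modn_small Hr) //.
  case: (ltnP (f d) (f d.+1)) => Hd.
    rewrite !(modn_small W2) mod0n /= mod0n muln0 mod0n; lia.
  rewrite mod0n eqxx (modn_small W2) muln1 modn_mod addnC -addnBA // modnDl modn_small //.
- by apply: xs_agree; case: (o); rewrite /= ?leqnn /= ?leqW.
Qed.

Lemma acode_addr a d f m s : tmp <= d -> a < NA -> rel_st f m s ->
  xs (acode a d) f d = a * V + f d %% V.
Proof.
(* All 16 arrays fit in the address space, since [256 * V <= V ^ 2 <= 2 ^ w]. *)
have VW := V_ltW; have V4 : 16 * V + V < 2 ^ w.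
  rewrite W_V; have : 256 * V <= V ^ 2 by rewrite expnS expn1 leq_mul2r V256 orbT.
  have : V ^ 2 <= V ^ 8 by rewrite leq_pexp2l // V_gt0.
  by have := V_gt0; lia.
move=> Hd Ha [_ Hv _]; have M := mod_ltV (f d); have Av : a * V < 16 * V by rewrite ltn_mul2r V_gt0.
have -> : xs (acode a d) f d = eval_op w WAdd (eval_op w WMul (a %% 2 ^ w) (f vreg)) (eval_op w WMod (f d) (f vreg)).
  have E1 : (vreg == d) = false by apply/eqP; lia.
  have E2 : (vreg == d.+1) = false by apply/eqP; lia.
  by rewrite /= ?E1 ?E2 ?eqxx ?dS /= ?E1 ?E2 ?eqxx ?dS.
have A1 : a < 2 ^ w by lia.
have A2 : a * V < 2 ^ w by lia.
have A3 : f d %% V < 2 ^ w by lia.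
have A4 : a * V + f d %% V < 2 ^ w by lia.
by rewrite /eval_op Hv (modn_small A1) (modn_small A2) (modn_small A3) modn_small.
Qed.

(** Stack discipline: evaluation at level [d] writes only registers from [d] on, so operands already
    computed below survive. *)
Lemma exec_ecode e p f m s d : code_at P p (ecode e d) -> tmp <= d -> inv s -> wfe e ->
  rel_st f m s ->
  exists f', [/\ runs (esz e) p f m (p + esz e) f' m, f' d = ev e s & agree d f f'].
Proof.
have W2 : 1 < 2 ^ w by have := V_ltW; lia.
move=> Hc Hd Hs; elim: e p f d Hc Hd => [k|r|a e IH|o e1 IH1 e2 IH2|e IH e1 IH1 e2 IH2] p f d Hc Hd He HR.
- exists (xs (ecode (Num k) d) f); split.
  + exact: (@runs_xs (ecode (Num k) d)).
  + by rewrite /= eqxx modn_small //; apply: (ev_lt Hs He).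
  + by move=> r Hr /=; rewrite (ltn_eqF Hr).
- exists (xs (ecode (Var r) d) f); split.
  + exact: (@runs_xs (ecode (Var r) d)).
  + have Er : f r = rg s r by case: HR => H _ _; apply: H; case/andP: He.
    by rewrite /= eqxx /eval_op /= PeanoNat.Nat.lor_diag Er modn_small //; apply: (ev_lt Hs He).
  + by move=> r' Hr /=; rewrite (ltn_eqF Hr).
- have /andP[_ /andP[Ha He']] := He.
  move: Hc; rewrite /= code_cat size_ecode -/(ecode _ _) => -[C1 C2].
  have [f1 [R1 E1 A1]] := IH _ _ _ C1 Hd He' HR.
  set cs := acode a d in C2; move: C2; rewrite (code_cat _ _ cs) => -[C2 /code_cons[C3 _]].
  have HR1 := rel_agree Hd A1 HR.
  have Ev : f1 vreg = V by case: HR1.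
  have R2 := runs_xs f1 m (isT : all straight cs) C2.
  exists [eta xs cs f1 with d |-> ar s a (ev e s %% V)]; split; first last.
  + have Ax : agree d f1 (xs cs f1) by apply: xs_agree; rewrite /= leqnn leqnSn.
    move=> r Hr; rewrite upd_ne; first by rewrite Ax ?A1.
    by rewrite neq_ltn Hr.
  + by rewrite /= eqxx.
  have -> : esz e + 5 = esz e + 4 + 1 by lia.
  apply: runs_trans; first by apply: runs_trans R1 R2.
  have := stp_Read (xs cs f1) m C3.
  by rewrite (acode_addr Hd Ha HR1) E1; case: HR => _ _ ->; rewrite ?mod_ltV // !addnA.
- have /andP[_ /andP[H1 H2]] := He.
  move: Hc; rewrite /= !code_cat !size_ecode => -[C1 [C2 C3]].
  have [f1 [R1 E1 A1]] := IH1 _ _ _ C1 Hd H1 HR.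
  have HR1 := rel_agree Hd A1 HR.
  have [f2 [R2 E2 A2]] := IH2 _ _ _ C2 (leqW Hd) H2 HR1.
  have E1' : f2 d = ev e1 s by rewrite A2.
  have [|||f3 [R3 E3 A3]] := @exec_bcode o _ f2 m d C3.
  + by rewrite E1'; apply: ev_lt.
  + by rewrite E2; apply: ev_lt.
  + by rewrite E1' E2; apply: (ev_lt Hs He).
  exists f3; split.
  + have -> : (if o is Sub then 5 else 1) = size (bcode o d) by case: (o).
    by rewrite !addnA; apply: runs_trans R3; apply: runs_trans R1 R2.
  + by rewrite E3 E1' E2.
  + apply: agree_trans A3 => //; apply: agree_trans A1 _ => //.
- have /andP[_ /and3P[H0 H1 H2]] := He.
  move: Hc; rewrite /= !code_cat !size_ecode => -[C1 [C2 [C3 C4]]].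
  have [f1 [R1 E1 A1]] := IH _ _ _ C1 Hd H0 HR.
  have HR1 := rel_agree Hd A1 HR.
  have [f2 [R2 E2 A2]] := IH1 _ _ _ C2 (leqW Hd) H1 HR1.
  have HR2 := rel_agree (leqW Hd) A2 HR1.
  have [f3 [R3 E3 A3]] := IH2 _ _ _ C3 (leqW (leqW Hd)) H2 HR2.
  set cs := [:: _; _; _; _; _; _] in C4.
  have R4 := runs_xs f3 m (isT : all straight cs) C4.
  have E1' : f3 d = ev e s by rewrite A3 // A2.
  have E2' : f3 d.+1 = ev e1 s by rewrite A3.
  have L1 := ev_lt Hs H1; have L2 := ev_lt Hs H2.
  exists (xs cs f3); split.
  + have -> : 6 = size cs by [].
    by rewrite !addnA; apply: runs_trans R4; apply: runs_trans R3; apply: runs_trans R1 R2.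
  + rewrite /= ?eqSS ?eqxx ?dS /= ?eqSS ?eqxx ?dS /= /eval_op E1' E2' E3.
    rewrite ?mod0n; case: (ev e s == 0) => /=;
    by rewrite ?(modn_small W2) ?mod0n /= ?(modn_small W2) ?muln0 ?muln1 ?mod0n ?add0n ?addn0
      ?modn_mod ?(modn_small L1) ?(modn_small L2).
  + apply: agree_trans (xs_agree _ _ (d := d)); rewrite //= ?leqnn ?leqW //.
    apply: agree_trans A1 _ => //.
    by move=> r Hr; rewrite A3 ?A2 //; apply: ltnW; rewrite // ltnW.
Qed.

Lemma rel_setr f m s r v : r < NV -> rel_st f m s -> rel_st [eta f with r |-> v] m (setr s r v).
Proof.
move=> Hr [H1 H2 H3]; split=> //=.
- by move=> r' Hr'; case: eqP => // _; apply: H1.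
- by have -> : (vreg == r) = false by apply/eqP; lia.
Qed.

(** The simulation theorem: compiled code halts at its end after exactly [cost c s] steps, in a
    machine state representing [run c s]. *)
Lemma exec_ccode c p f m s : code_at P p (ccode c p) -> wfc c -> inv s -> rel_st f m s ->
  exists f' m', runs (cost c s) p f m (p + csz c) f' m' /\ rel_st f' m' (run c s).
Proof.
have V2 : 1 < V by have := V256; lia.
have W2 : 1 < 2 ^ w by have := V_ltW; lia.
elim: c p f m s => [|r e|a e1 e2|c1 IH1 c2 IH2|e c1 IH1 c2 IH2|r rb e c IH] p f m s Hc Hw Hs HR.
- by exists f, m; rewrite addn0.
- have /andP[Hr He] := Hw; move: Hc; rewrite /= code_cat code_cons size_ecode => -[C1 [C2 _]].
  have [f1 [R1 E1 A1]] := exec_ecode C1 isT Hs He HR.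
  have HR1 := rel_agree (isT : tmp <= tmp) A1 HR.
  eexists; exists m; split.
    by rewrite -addn1 addnA; apply: runs_trans R1 _; apply: stp_Op C2.
  have -> : eval_op w WMod (f1 tmp) (f1 vreg) = ev e s %% V.
    by case: HR1 => _ -> _; rewrite E1 /eval_op modn_small // (leq_trans (mod_ltV _)) // ltnW // V_ltW.
  exact: rel_setr.
- have /and3P[Ha H1 H2] := Hw; move: Hc; rewrite /= /scode 4!code_cat !size_ecode.
  move=> [C1 [C2 [C3 [C4 /code_cons[C5 _]]]]].
  have [f1 [R1 E1 A1]] := exec_ecode C1 isT Hs H1 HR.
  have HR1 := rel_agree (isT : tmp <= tmp) A1 HR.
  set cs := acode a tmp in C2 C3 C4 C5.
  have R2 := runs_xs f1 m (isT : all straight cs) C2.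
  have Ad : xs cs f1 tmp = a * V + ev e1 s %% V by rewrite (acode_addr (isT : tmp <= tmp) Ha HR1) E1.
  have HR2 : rel_st (xs cs f1) m s.
    by apply: (rel_agree (isT : tmp <= tmp)) HR1; apply: xs_agree.
  have [f3 [R3 E3 A3]] := exec_ecode C3 (isT : tmp <= tmp.+1) Hs H2 HR2.
  have HR3 := rel_agree (isT : tmp <= tmp.+1) A3 HR2.
  set ds := (if _ then _ else _) in C4 C5.
  have R4 : runs (idxarr a) (p + esz e1 + size cs + esz e2) f3 m
       (p + esz e1 + size cs + esz e2 + idxarr a) (xs ds f3) m.
    have S4 : all straight ds by rewrite /ds; case: idxarr.
    by have := runs_xs f3 m S4 C4; rewrite /ds; case: (idxarr a).
  have E4 : xs ds f3 tmp.+1 = stv a (ev e2 s).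
    rewrite /ds /stv; case: (idxarr a) => //=.
    by case: HR3 => _ -> _; rewrite E3 /eval_op modn_small // (leq_trans (mod_ltV _)) // ltnW // V_ltW.
  have A4 : agree tmp.+1 f3 (xs ds f3) by apply: xs_agree; rewrite /ds; case: idxarr.
  have E5 : xs ds f3 tmp = a * V + ev e1 s %% V by rewrite A4 // A3.
  have S5 : size ds = idxarr a by rewrite /ds; case: idxarr.
  exists (xs ds f3); exists [eta m with a * V + ev e1 s %% V |-> stv a (ev e2 s)]; split.
    have R5 := stp_Write (xs ds f3) m C5; rewrite E4 E5 S5 in R5.
    rewrite !addnA; apply: runs_trans R5.
    by apply: runs_trans R4; apply: runs_trans R3; apply: runs_trans R1 R2.
  have [B1 B2 B3] := rel_agree (isT : tmp <= tmp.+1) A4 HR3.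
  split=> // b i Hb Hi /=; have M := mod_ltV (ev e1 s).
  case: (b =P a) => [->|Nb] /=.
    by rewrite eqn_add2l; case: eqP => // _; apply: B3.
  case: eqP => [E|_]; last exact: B3.
  (* Equal addresses have equal quotients by [V], so different arrays never overlap. *)
  case: Nb; have := congr1 (fun x => x %/ V) E.
  by rewrite /= !divnMDl ?V_gt0 // !divn_small // !addn0.
- have /andP[H1 H2] := Hw; move: Hc; rewrite /= code_cat size_ccode => -[C1 C2].
  have [f1 [m1 [R1 HR1]]] := IH1 _ _ _ _ C1 H1 Hs HR.
  have [f2 [m2 [R2 HR2]]] := IH2 _ _ _ _ C2 H2 (inv_run Hs H1) HR1.
  by exists f2, m2; split=> //; rewrite addnA; apply: runs_trans R1 R2.
- have /and3P[H0 H1 H2] := Hw; move: Hc.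
  rewrite /= code_cat code_cons code_cat code_cons size_ecode size_ccode => -[C1 [C2 [C3 [C4 C5]]]].
  have [f1 [R1 E1 A1]] := exec_ecode C1 isT Hs H0 HR.
  have HR1 := rel_agree (isT : tmp <= tmp) A1 HR.
  have R2 := stp_JumpZ f1 m C2; rewrite E1 in R2.
  case: ifP R2 => E R2.
    have [|f2 [m2 [R3 HR3]]] := IH2 (p + esz e + 1 + csz c1 + 1) _ _ _ _ H2 Hs HR1.
      exact: C5.
    exists f2, m2; split=> //; rewrite addnA in R3 *.
    by rewrite !addnA; apply: runs_trans R3; apply: runs_trans R1 R2.
  have [f2 [m2 [R3 HR3]]] := IH1 _ _ _ _ C3 H1 Hs HR1.
  exists f2, m2; split=> //; have R4 := stp_Jump f2 m2 C4.
  rewrite addnA; apply: runs_trans; last by rewrite !addnA; exact: R4.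
  by apply: runs_trans R3; apply: runs_trans R1 R2.
- have /and5P[Hr Hrb Hn Hrc /and3P[Hrbc He Hwc]] := Hw; move: Hc.
  rewrite /= code_cat 4!code_cons code_cat 3!code_cons size_ecode size_ccode.
  move=> -[C1 [C2 [C3 [C4 [C5 [C6 [C7 [C8 [C9 _]]]]]]]]].
  have [f1 [R1 E1 A1]] := exec_ecode C1 isT Hs He HR.
  have HR1 := rel_agree (isT : tmp <= tmp) A1 HR.
  set n := ev e s %% V; have nV : n < V by apply: mod_ltV.
  pose s0 := setr s rb n; pose L i := loop (run c) r i s0.
  have HL i : i <= n -> inv (L i) /\ rg (L i) rb = n.
    move=> Hi; apply: (@loop_inv (fun _ s' => inv s' /\ rg s' rb = n)) => [|j s' Hj [I1 I2]].
      by split; [apply: inv_setr | rewrite /= eqxx].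
    split; first by apply: inv_run => //; apply: inv_setr => //; lia.
    by rewrite run_rg //= eq_sym (negbTE Hn).
  pose q := p + esz e + 2.
  pose K i := \sum_(j < i) (cost c (setr (L j) r j) + 5).
  (* After [i] iterations the machine stands at the loop test [q] with counter [i]; [esz e + 2] is
     the set-up time and [K i] the time of the iterations. *)
  have main i : i <= n -> exists f' m', runs (esz e + 2 + K i) p f m q f' m' /\ rel_st f' m' (setr (L i) r i).
    elim: i => [_|i IHi Hi].
      have R2 := stp_Op f1 m C2.
      have R3 := stp_Const [eta f1 with rb |-> eval_op w WMod (f1 tmp) (f1 vreg)] m C3.
      rewrite mod0n in R3.
      eexists; exists m; split.
        rewrite /K big_ord0 addn0 -[2]/(1 + 1) addnA; apply: runs_trans.
          by apply: runs_trans R1 R2.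
        have -> : q = p + esz e + 1 + 1 by rewrite /q; lia.
        exact: R3.
      apply: rel_setr => //.
      have -> : eval_op w WMod (f1 tmp) (f1 vreg) = n.
        by case: HR1 => _ -> _; rewrite E1 /eval_op modn_small // (leq_trans (mod_ltV _)) // ltnW // V_ltW.
      exact: rel_setr.
    have [f2 [m2 [R2 HR2]]] := IHi (ltnW Hi); have [I1 I2] := HL i (ltnW Hi).
    have Er : f2 r = i by case: HR2 => H _ _; rewrite H //= eqxx.
    have Eb : f2 rb = n by case: HR2 => H _ _; rewrite H //= eq_sym (negbTE Hn).
    have R3 := stp_Op f2 m2 C4.
    have R4 := stp_JumpZ [eta f2 with tmp |-> eval_op w WLt (f2 r) (f2 rb)] m2 C5.
    have Et : eval_op w WLt i n = 1 by rewrite /eval_op Hi modn_small.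
    rewrite Er Eb Et /= in R3 R4.
    have HR3 : rel_st [eta f2 with tmp |-> 1] m2 (setr (L i) r i).
      by apply: (rel_agree (isT : tmp <= tmp)) HR2 => x /= Hx; rewrite (ltn_eqF Hx).
    have I3 : inv (setr (L i) r i) by apply: inv_setr => //; lia.
    have P4 : p + esz e + 1 + 1 + 1 + 1 = p + esz e + 4 by lia.
    rewrite P4 in C6 C7 C8 C9 R4.
    have [f4 [m4 [R5 HR5]]] := IH _ _ _ _ C6 Hwc I3 HR3.
    have Er4 : f4 r = i by case: HR5 => H _ _; rewrite H // run_rg //= eqxx.
    have R6 := stp_Const f4 m4 C7.
    have R7 := stp_Op [eta f4 with tmp |-> 1 %% 2 ^ w] m4 C8.
    have R8 := stp_Jump [eta [eta f4 with tmp |-> 1 %% 2 ^ w] with r |->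
       eval_op w WAdd ([eta f4 with tmp |-> 1 %% 2 ^ w] r) ([eta f4 with tmp |-> 1 %% 2 ^ w] tmp)] m4 C9.
    eexists; exists m4; split.
      have -> : esz e + 2 + K i.+1 = esz e + 2 + K i + 1 + 1 + cost c (setr (L i) r i) + 1 + 1 + 1.
        by rewrite /K big_ord_recr /=; lia.
      apply: runs_trans R8; apply: runs_trans R7; apply: runs_trans R6.
      have E : q = p + esz e + 1 + 1 by rewrite /q; lia.
      apply: runs_trans R5.
      by apply: runs_trans R4; apply: runs_trans R3; rewrite -E.
    have -> : eval_op w WAdd ([eta f4 with tmp |-> 1 %% 2 ^ w] r) ([eta f4 with tmp |-> 1 %% 2 ^ w] tmp) = i.+1.
      rewrite /= (ltn_eqF (leqW Hr)) Er4 /eval_op (modn_small W2) addn1 modn_small //.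
      by have := V_ltW; lia.
    apply: rel_setr => //.
    by apply: (rel_agree (isT : tmp <= tmp)) HR5 => x /= Hx; rewrite (ltn_eqF Hx).
  have [f2 [m2 [R2 HR2]]] := main n (leqnn n).
  have [I1 I2] := HL n (leqnn n).
  have Er : f2 r = n by case: HR2 => H _ _; rewrite H //= eqxx.
  have Eb : f2 rb = n by case: HR2 => H _ _; rewrite H //= eq_sym (negbTE Hn).
  have R3 := stp_Op f2 m2 C4.
  have R4 := stp_JumpZ [eta f2 with tmp |-> eval_op w WLt (f2 r) (f2 rb)] m2 C5.
  have Et : eval_op w WLt n n = 0 by rewrite /eval_op ltnn mod0n.
  rewrite Er Eb Et /= in R3 R4.
  exists [eta f2 with tmp |-> 0], m2; split; last first.
    by apply: (rel_agree (isT : tmp <= tmp)) HR2 => x /= Hx; rewrite (ltn_eqF Hx).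
  have -> : esz e + 4 + K n = esz e + 2 + K n + 1 + 1 by lia.
  rewrite !addnA; apply: runs_trans R4; apply: runs_trans R3.
  by have <- : q = p + esz e + 1 + 1 by rewrite /q; lia.
Qed.

End Exec.
End Lang.

(** * Products modulo x ^ N + 1 *)

Section Algebra.
Import GRing.Theory.
Local Open Scope ring_scope.

Section Eval.
Variable T : comNzRingType.

Definition pev n (f : nat -> nat) (x : T) : T := \sum_(i < n) (f i)%:R * x ^+ i.

(** An array of [L] blocks of length [m], read as a polynomial in [x] whose coefficients are
    polynomials in [y]. *)
Definition pev2 L m (f : nat -> nat) (x y : T) : T :=
  \sum_(i < L) pev m (fun j => f (i * m + j)%N) y * x ^+ i.

Lemma eq_pev n f g x : (forall i, (i < n)%N -> f i = g i) -> pev n f x = pev n g x.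
Proof. by move=> H; apply: eq_bigr => i _; rewrite H. Qed.

Lemma eq_pev2 L m f g x y : (forall i, (i < L * m)%N -> f i = g i) -> pev2 L m f x y = pev2 L m g x y.
Proof.
move=> H; apply: eq_bigr => i _; congr (_ * _); apply: eq_pev => j Hj; apply: H.
have Hi := ltn_ord i; apply: (@leq_trans (i.+1 * m)); first by rewrite mulSn addnC ltn_add2r.
by rewrite leq_mul2r Hi orbT.
Qed.

End Eval.

Definition addW W (a b : nat) := ((a + b) %% W)%N.
Definition subW W (a b : nat) := ((a + W - b %% W) %% W)%N.
Definition mulW W (a b : nat) := ((a * b) %% W)%N.

Section Cast.
Variables (T : comNzRingType) (W : nat).
Hypothesis W0 : W%:R = 0 :> T.
Lemma natrW a : (a %% W)%:R = a%:R :> T.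
Proof. by rewrite [in RHS](divn_eq a W) natrD natrM W0 mulr0 add0r. Qed.
Lemma natr_addW a b : (addW W a b)%:R = a%:R + b%:R :> T.
Proof. by rewrite natrW natrD. Qed.
Lemma natr_mulW a b : (mulW W a b)%:R = a%:R * b%:R :> T.
Proof. by rewrite natrW natrM. Qed.
Lemma natr_subW a b : (0 < W)%N -> (subW W a b)%:R = a%:R - b%:R :> T.
Proof.
move=> W1; rewrite natrW natrB ?natrD ?W0 ?addr0 ?natrW //.
by rewrite (leq_trans (ltnW (ltn_pmod b W1))) // leq_addl.
Qed.
End Cast.

(* The parameter [e] plays the role of a multiple of the product of the other
   factors of the modulus: it lets identities modulo an ideal be stated as plain
   equalities in an arbitrary commutative ring. *)
Definition ok1 W N c (ks : seq nat) (X Y : nat -> nat -> nat) z :=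
  forall T : comNzRingType, W%:R = 0 :> T -> forall e x : T, e * x ^+ N = - e ->
  e * pev N z x = c%:R * \sum_(k <- ks) e * pev N (X k) x * pev N (Y k) x.

(** A node of the transform tree: up to the factor [c], [z] is the sum of products modulo
    [y ^ m + 1] and [x ^ L - y ^ r], with coefficients modulo [W]. *)
Definition ok2 W L m r c (ks : seq nat) (X Y : nat -> nat -> nat) z :=
  forall T : comNzRingType, W%:R = 0 :> T -> forall e x y : T,
  e * y ^+ m = - e -> e * x ^+ L = e * y ^+ r ->
  e * pev2 L m z x y = c%:R * \sum_(k <- ks) e * pev2 L m (X k) x y * pev2 L m (Y k) x y.

(** Rotation of a block of length [m]: multiplication by [y ^ t] modulo [y ^ m + 1]. *)
Definition rotW W m t (g : nat -> nat) (j : nat) : nat :=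
  if (t <= j)%N then g (j - t)%N else subW W 0 (g (j + m - t)%N).

(** The top [t] coefficients leave the block and come back at the bottom with opposite sign, because
    [y ^ m] acts as [-1]. *)
Lemma pev_rot (T : comNzRingType) W m t g (e y : T) : (0 < W)%N -> W%:R = 0 :> T ->
  e * y ^+ m = - e -> (t <= m)%N ->
  e * pev m (rotW W m t g) y = e * y ^+ t * pev m g y.
Proof.
move=> W1 W0 Hy tm.
have EN f : pev m f y = \sum_(0 <= i < m) (f i)%:R * y ^+ i by rewrite big_mkord.
rewrite !EN (big_cat_nat (leq0n t) tm) /= [in RHS](big_cat_nat (leq0n (m - t)) (leq_subr _ _)) /=.
rewrite !mulrDr addrC; congr (_ + _).
  rewrite -{1}[t]add0n big_addn !mulr_sumr; apply: eq_bigr => i _.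
  by rewrite /rotW leq_addl addnK exprD; ring.
have -> : \sum_(m - t <= i < m) (g i)%:R * y ^+ i = \sum_(0 <= i < t) (g (i + (m - t))%N)%:R * y ^+ (i + (m - t)).
  by rewrite -{1}[(m - t)%N]add0n big_addn subKn.
rewrite !big_mkord !mulr_sumr; apply: eq_bigr => i _; have Hi := ltn_ord i.
rewrite /rotW leqNgt Hi /= natr_subW // sub0r -addnBA //.
have -> : e * y ^+ t * ((g (i + (m - t))%N)%:R * y ^+ (i + (m - t))) =
          (e * y ^+ m) * ((g (i + (m - t))%N)%:R * y ^+ i).
  have -> : y ^+ m = y ^+ t * y ^+ (m - t) by rewrite -exprD subnKC.
  by rewrite exprD; ring.
by rewrite Hy; ring.
Qed.

(** The two halves of a node, [x ^ 2L - y ^ 2t = (x ^ L - y ^ t)(x ^ L + y ^ t)]. *)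
Definition child W L m t (b : bool) (f : nat -> nat) (p : nat) : nat :=
  let r := rotW W m t (fun j => f (L * m + p %/ m * m + j)%N) (p %% m) in
  if b then subW W (f p) r else addW W (f p) r.

(** Inverse butterfly without halving: low half [z0 + z1], high half [y ^ (-t)] times [z0 - z1],
    where [y ^ (-t)] is [- y ^ (m - t)]. *)
Definition merge W L m t (z0 z1 : nat -> nat) (p : nat) : nat :=
  if (p < L * m)%N then addW W (z0 p) (z1 p) else
  let q := (p - L * m)%N in
  subW W 0 (rotW W m (m - t) (fun j => subW W (z0 (q %/ m * m + j)%N) (z1 (q %/ m * m + j)%N)) (q %% m)).

Lemma divmodE m i j : (j < m)%N -> ((i * m + j) %/ m = i)%N * ((i * m + j) %% m = j)%N.
Proof.
by move=> H; rewrite divnMDl ?divn_small // ?addn0 ?modnMDl ?modn_small //; lia.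
Qed.

Section Butterfly.
Variables (W L m t : nat).
Hypotheses (W0 : (0 < W)%N) (tm : (t < m)%N).

Lemma pev2_child (T : comNzRingType) b f (e x y : T) : W%:R = 0 :> T -> e * y ^+ m = - e ->
  e * pev2 L m (child W L m t b f) x y =
  e * (pev2 L m f x y + (-1) ^+ b * y ^+ t * pev2 L m (fun p => f (L * m + p)%N) x y).
Proof.
move=> T0 Hy; rewrite /pev2 mulrDr !mulr_sumr -big_split; apply: eq_bigr => i _ /=.
pose row := fun j : nat => f (L * m + i * m + j)%N.
have E := @pev_rot T W m t row e y W0 T0 Hy (ltnW tm).
transitivity ((e * pev m (fun j => f (i * m + j)%N) y + (-1) ^+ b * (e * pev m (rotW W m t row) y)) * x ^+ i).
  rewrite mulrA; congr (_ * _); rewrite mulrCA -mulrDr; congr (_ * _).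
  rewrite /pev mulr_sumr -big_split; apply: eq_bigr => j _ /=.
  rewrite mulrA -mulrDl; congr (_ * _).
  rewrite /child !divmodE //; case: b; last by rewrite natr_addW // expr0 mul1r.
  by rewrite natr_subW // ?expr1 ?mulN1r.
rewrite E; have -> : pev m (fun j => f (L * m + (i * m + j))%N) y = pev m row y.
  by apply: eq_pev => j _; rewrite /row addnA.
by ring.
Qed.

Lemma pev2_double (T : comNzRingType) f (x y : T) :
  pev2 (2 * L) m f x y = pev2 L m f x y + x ^+ L * pev2 L m (fun p => f (L * m + p)%N) x y.
Proof.
have EN n g : pev2 n m g x y = \sum_(0 <= i < n) pev m (fun j => g (i * m + j)%N) y * x ^+ i.
  by rewrite big_mkord.
rewrite !EN (@big_cat_nat _ _ _ L) //=; last by rewrite mul2n -addnn leq_addr.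
congr (_ + _); rewrite -{1}[L]add0n big_addn mul2n -addnn addnK mulr_sumr; apply: eq_bigr => i _.
rewrite exprD; have -> : pev m (fun j => f ((i + L) * m + j)%N) y = pev m (fun j => f (L * m + (i * m + j))%N) y.
  by apply: eq_pev => j _; rewrite mulnDl addnA [(i * m + L * m)%N]addnC.
by ring.
Qed.

Lemma pev2_merge (T : comNzRingType) z0 z1 (e x y : T) : W%:R = 0 :> T -> e * y ^+ m = - e ->
  e * pev2 (2 * L) m (merge W L m t z0 z1) x y =
  e * (pev2 L m z0 x y + pev2 L m z1 x y - x ^+ L * y ^+ (m - t) * (pev2 L m z0 x y - pev2 L m z1 x y)).
Proof.
move=> T0 Hy; rewrite pev2_double [LHS]mulrDr [RHS]mulrDr; congr (_ + _).
  congr (_ * _); rewrite /pev2 -big_split; apply: eq_bigr => i _ /=.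
  rewrite -mulrDl; congr (_ * _); rewrite /pev -big_split; apply: eq_bigr => j _ /=.
  rewrite -mulrDl; congr (_ * _); rewrite /merge.
  have -> : (i * m + j < L * m)%N.
    apply: (@leq_trans (i.+1 * m)); first by rewrite mulSn addnC ltn_add2r.
    by rewrite leq_mul2r ltn_ord orbT.
  by rewrite natr_addW.
have -> : pev2 L m z0 x y - pev2 L m z1 x y = pev2 L m (fun p => subW W (z0 p) (z1 p)) x y.
  rewrite /pev2 -sumrB; apply: eq_bigr => i _; rewrite -mulrBl; congr (_ * _).
  rewrite /pev -sumrB; apply: eq_bigr => j _; rewrite -mulrBl; congr (_ * _).
  by rewrite natr_subW.
rewrite mulrN -mulrA mulrCA [in RHS]mulrCA -mulrN; congr (_ * _).
rewrite /pev2 !mulr_sumr -sumrN; apply: eq_bigr => i _.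
pose row := fun j : nat => subW W (z0 (i * m + j)%N) (z1 (i * m + j)%N).
have E := @pev_rot T W m (m - t) row e y W0 T0 Hy (leq_subr _ _).
transitivity (- (e * pev m (rotW W m (m - t) row) y) * x ^+ i); last by rewrite E; ring.
rewrite mulrA -mulrN; congr (_ * _); congr (_ * _).
rewrite /pev -sumrN; apply: eq_bigr => j _; rewrite /merge ltnNge leq_addr addKn /=.
by rewrite !divmodE // natr_subW // sub0r mulNr.
Qed.

(** Chinese remaindering without dividing by 2. With [u = y ^ t] and its inverse [v], the
    multipliers [e * (1 + x ^ L * v)] and [e * (1 - x ^ L * v)] are annihilated by [x ^ L - u] and
    [x ^ L + u] and add up to [2 * e]. The children's identities, taken at these multipliers,
    therefore add up to twice the identity of the parent. *)
Lemma ok2_merge c ks X Y z0 z1 :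
  ok2 W L m t c ks (fun k => child W L m t false (X k)) (fun k => child W L m t false (Y k)) z0 ->
  ok2 W L m (t + m) c ks (fun k => child W L m t true (X k)) (fun k => child W L m t true (Y k)) z1 ->
  ok2 W (2 * L) m (2 * t) (2 * c) ks X Y (merge W L m t z0 z1).
Proof.
move=> H0 H1 T T0 e x y Hy Hx.
pose u := y ^+ t; pose v := - y ^+ (m - t).
have uv : e * (u * v) = e.
  by rewrite /u /v mulrN -exprD subnKC ?mulrN ?Hy ?opprK //; apply: ltnW.
have Hx' : e * (x ^+ L * x ^+ L) = e * (u * u) by rewrite -!exprD !addnn -!mul2n Hx.
pose e0 := e * (1 + x ^+ L * v); pose e1 := e * (1 - x ^+ L * v).
have Q0 : e0 * x ^+ L = e0 * u.
  transitivity (e * x ^+ L + e * (x ^+ L * x ^+ L) * v); first by rewrite /e0; ring.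
  rewrite Hx'; transitivity (e * u + (e * (u * v)) * x ^+ L); last by rewrite /e0; ring.
  by transitivity (e * x ^+ L + (e * (u * v)) * u); [ring | rewrite uv; ring].
have Q1 : e1 * x ^+ L = - (e1 * u).
  transitivity (e * x ^+ L - e * (x ^+ L * x ^+ L) * v); first by rewrite /e1; ring.
  rewrite Hx'; transitivity (- (e * u) + (e * (u * v)) * x ^+ L); last by rewrite /e1; ring.
  by transitivity (e * x ^+ L - (e * (u * v)) * u); [ring | rewrite uv; ring].
have R0 : e0 * y ^+ m = - e0 by transitivity (e * y ^+ m * (1 + x ^+ L * v)); rewrite /e0; [ring | rewrite Hy; ring].
have R1 : e1 * y ^+ m = - e1 by transitivity (e * y ^+ m * (1 - x ^+ L * v)); rewrite /e1; [ring | rewrite Hy; ring].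
have Q1' : e1 * x ^+ L = e1 * y ^+ (t + m).
  rewrite exprD -/u Q1; transitivity ((e1 * y ^+ m) * u); [rewrite R1; ring | ring].
have C0 f : e0 * pev2 L m (child W L m t false f) x y = e0 * pev2 (2 * L) m f x y.
  rewrite pev2_child // pev2_double expr0 mul1r -/u !mulrDr; congr (_ + _).
  by rewrite !mulrA Q0.
have C1 f : e1 * pev2 L m (child W L m t true f) x y = e1 * pev2 (2 * L) m f x y.
  rewrite pev2_child // pev2_double expr1 mulN1r -/u !mulrDr; congr (_ + _).
  by rewrite !mulrA Q1 mulrN.
have {}H0 := H0 T T0 e0 x y R0 Q0; have {}H1 := H1 T T0 e1 x y R1 Q1'.
rewrite pev2_merge //.
set Z0 := pev2 L m z0 x y in H0 *; set Z1 := pev2 L m z1 x y in H1 *.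
transitivity (e0 * Z0 + e1 * Z1); first by rewrite /e0 /e1 /v; ring.
rewrite H0 H1 -mulrDr -big_split natrM -mulrA mulrCA; congr (_ * _).
rewrite mulr_sumr; apply: eq_bigr => k _ /=.
rewrite C0 C1; set A := pev2 _ _ (X k) _ _; set B := pev2 _ _ (Y k) _ _.
transitivity (A * (e0 * pev2 L m (child W L m t false (Y k)) x y)
   + A * (e1 * pev2 L m (child W L m t true (Y k)) x y)); first by ring.
rewrite C0 C1 -/B /e0 /e1; ring.
Qed.
End Butterfly.

(** * Nussbaumer's passage from one variable to two, and back *)

Lemma sum_prod (T : nmodType) (F : nat -> T) l m :
  \sum_(k < m * l) F k = \sum_(i < l) \sum_(j < m) F (j * l + i)%N.
Proof.
rewrite exchange_big -(big_mkord xpredT F) /=.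
elim: m => [|m IH]; first by rewrite mul0n big_ord0 big_nil.
rewrite big_ord_recr /= -IH (@big_cat_nat _ _ _ (m * l)) //=; last by rewrite leq_mul2r leqnSn orbT.
congr (_ + _); rewrite -{1}[(m * l)%N]add0n big_addn mulSn addnK big_mkord.
by apply: eq_bigr => i _; rewrite addnC.
Qed.

(** A transposition: coefficient [j * l + i] becomes slot [j] of block [i], so that setting
    [y = x ^ l] recovers [f]. The zero blocks from [l] on make room for products of degree below
    [2 * l] in [x]. *)
Definition unfoldW l m (f : nat -> nat) (p : nat) : nat :=
  if (p %/ m < l)%N then f (p %% m * l + p %/ m)%N else 0%N.

(** Substitutes [y = x ^ l] back: block [i + l] carries [x ^ (i + l) = x ^ i * y], so it is added to
    block [i] after a rotation by one. *)
Definition foldW W l m (z : nat -> nat) (p : nat) : nat :=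
  addW W (z (p %% l * m + p %/ l)%N) (rotW W m 1 (fun j => z ((p %% l + l) * m + j)%N) (p %/ l)).

Section Lift.
Variable T : comNzRingType.
Implicit Types p q : {poly T}.

Lemma cyclic_poly_eq n p q : (0 < n)%N -> (size p <= n)%N -> (size q <= n)%N ->
  in_qpoly ('X^n - 1) p = in_qpoly ('X^n - 1) q -> p = q.
Proof.
move=> n0 Hp Hq H.
have S : size ('X^n - 1 : {poly T}) = n.+1 by rewrite size_XnsubC.
have M : mk_monic ('X^n - 1 : {poly T}) = 'X^n - 1.
  by rewrite /mk_monic S ltnS n0 monicXnsubC.
rewrite -(@in_qpoly_small _ ('X^n - 1) p) ?H ?in_qpoly_small //; by rewrite M S ltnS.
Qed.

Lemma size_sum_leq (I : Type) (r : seq I) (F : I -> {poly T}) n :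
  (forall i, (size (F i) <= n)%N) -> (size (\sum_(i <- r) F i)%R <= n)%N.
Proof.
move=> H; elim/big_ind: _ => [|p q Hp Hq|i _] //; first by rewrite size_poly0.
by apply: leq_trans (size_polyD _ _) _; rewrite geq_max Hp Hq.
Qed.

Lemma size_Cmul_leq (a : T) p : (size (a%:P * p)%R <= size p)%N.
Proof. by rewrite mul_polyC size_scale_leq. Qed.

Lemma in_qpoly_mod n : (0 < n)%N -> in_qpoly ('X^n - 1 : {poly T}) 'X^n = 1.
Proof.
move=> n0; rewrite -[X in in_qpoly _ X](subrK 1) rmorphD rmorph1 -[RHS]add0r; congr (_ + _).
apply: val_inj => /=.
have M : mk_monic ('X^n - 1 : {poly T}) = 'X^n - 1.
  by rewrite /mk_monic size_XnsubC // ltnS n0 monicXnsubC.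
by rewrite M Pdiv.RingMonic.rmodpp // monicXnsubC.
Qed.
End Lift.

Lemma pev2_poly (T : comNzRingType) (h : {poly T}) L m f (y : T) :
  pev2 L m f (in_qpoly h 'X) (in_qpoly h y%:P) =
  in_qpoly h (\poly_(i < L) pev m (fun j => f (i * m + j)%N) y).
Proof.
rewrite poly_def rmorph_sum; apply: eq_bigr => i _ /=.
rewrite -mul_polyC rmorphM rmorphXn /=; congr (_ * _).
rewrite /pev rmorph_sum rmorph_sum; apply: eq_bigr => j _ /=.
by rewrite !rmorphM !rmorphXn /= !rmorph_nat.
Qed.

(** The hypothesis is used in [T[X] / (X ^ (2 * l) - 1)], with [X] for [x] and the constant [x ^ l]
    for [y]. The factors have size at most [l] in [X], so both sides have size at most [2 * l] and
    the congruence is an equality of polynomials. Evaluating it at [X = x] gives the claim. *)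
Lemma ok1_fold W l m c ks X Y z : (0 < W)%N -> (0 < l)%N -> (0 < m)%N ->
  ok2 W (2 * l) m 0 c ks (fun k => unfoldW l m (X k)) (fun k => unfoldW l m (Y k)) z ->
  ok1 W (m * l) c ks X Y (foldW W l m z).
Proof.
move=> W1 l0 m0 H T T0 e x Hx; pose y := x ^+ l.
have Hy : e * y ^+ m = - e by rewrite /y -exprM mulnC.
pose R f i := pev m (fun j => unfoldW l m f (i * m + j)%N) y.
pose P f := \poly_(i < 2 * l) R f i.
pose Z := \poly_(i < 2 * l) pev m (fun j => z (i * m + j)%N) y.
have R0 f i : (l <= i)%N -> R f i = 0.
  move=> Hi; apply: big1 => j _; rewrite /unfoldW divmodE // ltnNge Hi /=; exact: mul0r.
have SP f : (size (P f) <= l)%N.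
  apply/leq_sizeP => j Hj; rewrite coef_poly; case: ifP => // _; exact: R0.
have EP f : (P f).[x] = pev (m * l) f x.
  have -> : P f = \poly_(i < l) R f i.
    apply/polyP => i; rewrite !coef_poly; case: (ltnP i l) => Hi.
      by rewrite (leq_trans Hi) // leq_pmull.
    by case: ifP => // _; apply: R0.
  rewrite horner_poly /pev (sum_prod (fun k => (f k)%:R * x ^+ k)); apply: eq_bigr => i _ /=.
  rewrite /R mulr_suml; apply: eq_bigr => j _; rewrite /unfoldW !divmodE // ltn_ord.
  by rewrite -mulrA -exprM -exprD mulnC.
have EZ : e * Z.[x] = e * pev (m * l) (foldW W l m z) x.
  rewrite horner_poly /pev (sum_prod (fun k => (foldW W l m z k)%:R * x ^+ k)).
  rewrite -(big_mkord xpredT (fun i => pev m (fun j => z (i * m + j)%N) y * x ^+ i)).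
  rewrite (@big_cat_nat _ _ _ l) //=; last by rewrite leq_pmull.
  rewrite -{2}[l]add0n big_addn mul2n -addnn addnK !big_mkord -big_split !mulr_sumr.
  apply: eq_bigr => i _ /=.
  pose row := fun j : nat => z ((i + l) * m + j)%N.
  have E := @pev_rot T W m 1 row e y W1 T0 Hy m0.
  transitivity ((e * pev m (fun j => z (i * m + j)%N) y + e * pev m (rotW W m 1 row) y) * x ^+ i).
    by rewrite E expr1 exprD -/y -/row; ring.
  rewrite -mulrDr /pev -big_split -mulrA mulr_suml /=; congr (_ * _); apply: eq_bigr => j _.
  rewrite -mulrDl /foldW !divmodE // natr_addW // exprD -mulrA; congr (_ * _).
  by rewrite -exprM mulnC mulrC.
pose h : {poly T} := 'X^(2 * l) - 1.
have l20 : (0 < 2 * l)%N by rewrite muln_gt0.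
have W' : W%:R = 0 :> {poly %/ h} by rewrite -(rmorph_nat (in_qpoly h)) -polyC_natr T0 rmorph0.
have A : in_qpoly h e%:P * in_qpoly h y%:P ^+ m = - in_qpoly h e%:P.
  by rewrite -rmorphXn -rmorphM /= -polyC_exp -polyCM Hy polyCN rmorphN.
have B : in_qpoly h e%:P * in_qpoly h 'X ^+ (2 * l) = in_qpoly h e%:P * in_qpoly h y%:P ^+ 0.
  by rewrite expr0 -rmorphXn /= in_qpoly_mod.
have E2 f : pev2 (2 * l) m (unfoldW l m f) (in_qpoly h 'X) (in_qpoly h y%:P) = in_qpoly h (P f).
  exact: pev2_poly.
have := H _ W' _ _ _ A B; rewrite pev2_poly -in_qpolyM.
under eq_bigr => k _ do rewrite !E2 -(in_qpolyM h e%:P (P (X k))) -(in_qpolyM h (e%:P * P (X k)) (P (Y k))).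
rewrite -(rmorph_sum (in_qpoly h)) -(rmorph_nat (in_qpoly h)) -in_qpolyM => HH.
have Sm (p q : {poly T}) : (size p <= l)%N -> (size q <= l)%N -> (size (e%:P * p * q)%R <= 2 * l)%N.
  move=> Hp Hq; rewrite -mulrA; apply: leq_trans (size_Cmul_leq _ _) _.
  by apply: leq_trans (size_polyMleq _ _) _; lia.
have S1 : (size (e%:P * Z)%R <= 2 * l)%N by apply: leq_trans (size_Cmul_leq _ _) (size_poly _ _).
have S2 : (size (c%:R * \sum_(k <- ks) e%:P * P (X k) * P (Y k))%R <= 2 * l)%N.
  rewrite -polyC_natr; apply: leq_trans (size_Cmul_leq _ _) _.
  by apply: size_sum_leq => k; apply: Sm; apply: SP.
have /(congr1 (horner^~ x)) /= := cyclic_poly_eq l20 S1 S2 HH.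
rewrite hornerM hornerC EZ => ->; rewrite -polyC_natr hornerM hornerC; congr (_ * _).
rewrite horner_sum; apply: eq_bigr => k _.
by rewrite !hornerM hornerC !EP.
Qed.

Lemma ok2_leaf W m r c ks X Y z : ok1 W m c ks X Y z -> ok2 W 1 m r c ks X Y z.
Proof.
move=> H T T0 e x y Hy _; have E f : pev2 1 m f x y = pev m f y.
  by rewrite /pev2 big_ord1 expr0 mulr1.
by rewrite E H //; congr (_ * _); apply: eq_bigr => k _; rewrite !E.
Qed.

Lemma eq_ok1 W N c ks X Y z X' Y' z' :
  (forall k i, (i < N)%N -> X k i = X' k i) -> (forall k i, (i < N)%N -> Y k i = Y' k i) ->
  (forall i, (i < N)%N -> z i = z' i) -> ok1 W N c ks X Y z -> ok1 W N c ks X' Y' z'.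
Proof.
move=> HX HY Hz H T T0 e x Hx; rewrite -(eq_pev _ Hz) H //; congr (_ * _).
by apply: eq_bigr => k _; rewrite (eq_pev _ (HX k)) (eq_pev _ (HY k)).
Qed.

Lemma eq_ok2 W L m r c ks X Y z X' Y' z' :
  (forall k i, (i < L * m)%N -> X k i = X' k i) -> (forall k i, (i < L * m)%N -> Y k i = Y' k i) ->
  (forall i, (i < L * m)%N -> z i = z' i) -> ok2 W L m r c ks X Y z -> ok2 W L m r c ks X' Y' z'.
Proof.
move=> HX HY Hz H T T0 e x y Hy Hx; rewrite -(eq_pev2 _ _ Hz) H //; congr (_ * _).
by apply: eq_bigr => k _; rewrite (eq_pev2 _ _ (HX k)) (eq_pev2 _ _ (HY k)).
Qed.

(** The two coefficients of a product modulo [x ^ 2 + 1], as for complex numbers. *)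
Definition base0 W (f g : nat -> nat) := subW W (mulW W (f 0%N) (g 0%N)) (mulW W (f 1%N) (g 1%N)).
Definition base1 W (f g : nat -> nat) := addW W (mulW W (f 0%N) (g 1%N)) (mulW W (f 1%N) (g 0%N)).

Lemma ok1_base W ks X Y z : (0 < W)%N ->
  z 0%N = (\sum_(k <- ks) base0 W (X k) (Y k)) %[mod W] ->
  z 1%N = (\sum_(k <- ks) base1 W (X k) (Y k)) %[mod W] ->
  ok1 W 2 1 ks X Y z.
Proof.
move=> W1 E0 E1 T T0 e x Hx.
have E f : pev 2 f x = (f 0%N)%:R + (f 1%N)%:R * x :> T.
  by rewrite /pev !big_ord_recl big_ord0 /= expr0 expr1 mulr1 addr0.
rewrite E -(natrW T0 (z 0%N)) E0 -(natrW T0 (z 1%N)) E1 !natrW // !natr_sum mul1r.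
rewrite mulr_suml -big_split mulr_sumr; apply: eq_bigr => k _ /=; rewrite !E.
rewrite natr_subW // natr_addW // !natr_mulW //.
set a := (X k 0%N)%:R; set b := (X k 1%N)%:R; set a' := (Y k 0%N)%:R; set b' := (Y k 1%N)%:R.
transitivity (e * (a * a') + e * (a * b' + b * a') * x + (- e) * (b * b')); first by ring.
by rewrite -Hx; ring.
Qed.

Definition conv (f g : nat -> nat) k := (\sum_(i < k.+1) f i * g (k - i))%N.

(** Instantiates the identity in [Z_W[X] / (X ^ N + 1)] with [e = 1]. By [a + b <= N.+1] the
    products have size at most [N], so nothing wraps around and coefficients can be compared. *)
Lemma ok1_conv W N c ks X Y z a b : (1 < W)%N -> (0 < N)%N -> (a + b <= N.+1)%N ->
  (forall k i, (a <= i)%N -> X k i = 0%N) -> (forall k i, (b <= i)%N -> Y k i = 0%N) ->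
  ok1 W N c ks X Y z -> forall i, (i < N)%N ->
  z i = (c * \sum_(k <- ks) conv (X k) (Y k) i)%N %[mod W].
Proof.
move=> W1 N0 ab HX HY H i Hi.
pose R := 'Z_W; pose h : {poly R} := 'X^N + 1.
have hE : h = 'X^N - (-1)%:P by rewrite /h polyCN opprK.
have hM : h \is monic by rewrite hE monicXnsubC.
have hS : size h = N.+1 by rewrite hE size_XnsubC.
have hK : mk_monic h = h by rewrite /mk_monic hS ltnS N0 hM.
have WR : W%:R = 0 :> R by apply: pchar_Zp.
have W0 : W%:R = 0 :> {poly %/ h} by rewrite -(rmorph_nat (in_qpoly h)) -polyC_natr WR rmorph0.
have XN : 1 * in_qpoly h 'X ^+ N = - 1 :> {poly %/ h}.
  rewrite mul1r -rmorphXn; have -> : 'X^N = h - 1 by rewrite /h addrK.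
  rewrite rmorphB rmorph1 -[RHS]add0r; congr (_ - _).
  by apply: val_inj => /=; rewrite hK Pdiv.RingMonic.rmodpp.
have EV f : pev N f (in_qpoly h 'X) = in_qpoly h (\poly_(i < N) (f i)%:R).
  rewrite poly_def rmorph_sum; apply: eq_bigr => j _ /=.
  by rewrite -mul_polyC rmorphM rmorphXn polyC_natr rmorph_nat.
pose P f : {poly R} := \poly_(i < N) (f i)%:R.
have E3 k : 1 * pev N (X k) (in_qpoly h 'X) * pev N (Y k) (in_qpoly h 'X) = in_qpoly h (P (X k) * P (Y k)).
  by rewrite !EV in_qpolyM; congr (_ * _); exact: mul1r.
have := H _ W0 _ _ XN; rewrite mul1r EV.
rewrite (eq_bigr _ (fun k _ => E3 k)).
rewrite -(rmorph_sum (in_qpoly h)) -(rmorph_nat (in_qpoly h)) -in_qpolyM => /(congr1 val) /=.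
have Sz n f (Hf : forall i, (n <= i)%N -> f i = 0%N) : (size (\poly_(i < N) (f i)%:R : {poly R})%R <= n)%N.
  apply/leq_sizeP => j Hj; rewrite coef_poly Hf //; by case: ifP.
rewrite hK !Pdiv.CommonRing.rmodp_small ?hS ?ltnS ?size_poly //; last first.
  rewrite -polyC_natr; apply: leq_trans (size_Cmul_leq _ _) _.
  apply: size_sum_leq => k; apply: leq_trans (size_polyMleq _ _) _.
  have HA : (size (P (X k)) <= a)%N by apply: Sz; apply: HX.
  have HB : (size (P (Y k)) <= b)%N by apply: Sz; apply: HY.
  by move: HA HB; set u := size _; set v := size _; lia.
move=> /(congr1 (fun p : {poly R} => p`_i)); rewrite coef_poly Hi -polyC_natr coefCM coef_sum => E.
have : (z i)%:R = (c * \sum_(k <- ks) conv (X k) (Y k) i)%N%:R :> R.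
  rewrite E natrM natr_sum; congr (_ * _); apply: eq_bigr => k _.
  rewrite coefM /conv natr_sum; apply: eq_bigr => j _; rewrite natrM !coef_poly.
  have Hj := ltn_ord j.
  by rewrite (leq_ltn_trans _ Hi) ?(leq_ltn_trans (leq_subr _ _) Hi) // -ltnS.
by move=> /(congr1 (fun v : 'Z_W => nat_of_ord v)); rewrite !val_Zp_nat.
Qed.
End Algebra.

(** * In-place transforms on arrays *)

Definition sh (o : nat) (f : nat -> nat) := fun i => f (o + i).
Definition eqon n (f g : nat -> nat) := forall i, i < n -> f i = g i.

(** All nodes of one depth are split in the same pass and in place: the halves of node [g] are
    overwritten by its two children. *)
Definition bflyF W L m (tt : nat -> nat) f y :=
  let g := y %/ (2 * (L * m)) in
  child W L m (tt g) (L * m <= y %% (2 * (L * m))) (sh (g * (2 * (L * m))) f) (y %% (L * m)).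

Definition mergeF W L m (tt : nat -> nat) z y :=
  let g := y %/ (2 * (L * m)) in
  merge W L m (tt g) (sh (g * (2 * (L * m))) z) (sh (g * (2 * (L * m)) + L * m) z) (y %% (2 * (L * m))).

Definition unfF l m f y :=
  unfoldW l m (sh (y %/ (2 * (l * m)) * (l * m)) f) (y %% (2 * (l * m))).

Definition foldF W l m z y :=
  foldW W l m (sh (y %/ (l * m) * (2 * (l * m))) z) (y %% (l * m)).

(** Bit reversal of the [d] low bits. *)
Fixpoint rv d nu := if d is d'.+1 then rv d' (nu %/ 2) + nu %% 2 * 2 ^ d' else 0.

Lemma rvS d nu : rv d.+1 nu = rv d (nu %/ 2) + nu %% 2 * 2 ^ d.
Proof. by []. Qed.

Lemma rv_lt d nu : rv d nu < 2 ^ d.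
Proof. by elim: d nu => //= d IH nu; have := IH (nu %/ 2); rewrite expnS; have := ltn_pmod nu (isT : 0 < 2); nia. Qed.

(** Twiddle exponent of node [g] at depth [d]. The residue [g %% 2 ^ d] is its position within its
    own tree; bit reversal turns this path of left and right turns into an exponent. *)
Definition ttF kp d g := rv d (g %% 2 ^ d) * 2 ^ (kp - d).

Lemma ttF_lt kp d g : d <= kp -> ttF kp d g < 2 ^ kp.
Proof.
by move=> H; rewrite /ttF -{2}(subnKC H) expnD ltn_pmul2r ?rv_lt ?expn_gt0.
Qed.

(** * Locality: each transform of a prefix depends only on the corresponding prefix *)

Section Cong.
Variables (W L m : nat).
Hypothesis L0 : 0 < L.
Hypothesis m0 : 0 < m.

Lemma rowlt p j : p < L * m -> j < m -> p %/ m * m + j < L * m.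
Proof.
move=> Hp Hj; have : p %/ m < L by rewrite ltn_divLR.
move=> H; apply: (@leq_trans ((p %/ m).+1 * m)); first by rewrite mulSn; lia.
by rewrite leq_mul2r H orbT.
Qed.

Lemma eq_rotW t f g j : t <= m -> j < m -> eqon m f g -> rotW W m t f j = rotW W m t g j.
Proof.
by move=> tm Hj E; rewrite /rotW; case: leqP => H; [|congr subW]; apply: E; lia.
Qed.

Lemma eq_child t b f g : t <= m -> eqon (2 * (L * m)) f g ->
  eqon (L * m) (child W L m t b f) (child W L m t b g).
Proof.
move=> tm E p Hp; rewrite /child E; last by lia.
have Hj : p %% m < m by rewrite ltn_mod.
rewrite (eq_rotW (g := fun j => g (L * m + p %/ m * m + j)) tm Hj) // => j {}Hj.
by apply: E; have := rowlt Hp Hj; lia.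
Qed.

Lemma eq_merge t z0 z1 z0' z1' : eqon (L * m) z0 z0' -> eqon (L * m) z1 z1' ->
  eqon (2 * (L * m)) (merge W L m t z0 z1) (merge W L m t z0' z1').
Proof.
move=> E0 E1 p Hp; rewrite /merge; case: ltnP => H; first by rewrite E0 ?E1.
have Hq : p - L * m < L * m by lia.
congr subW; apply: eq_rotW; rewrite ?leq_subr ?ltn_mod // => j Hj.
by rewrite E0 ?E1 ?rowlt.
Qed.

Lemma eq_bflyF nb tt f g : (forall i, tt i <= m) -> eqon (nb * (2 * (L * m))) f g ->
  eqon (nb * (2 * (L * m))) (bflyF W L m tt f) (bflyF W L m tt g).
Proof.
have H0 : 0 < L * m by rewrite muln_gt0 L0.
move=> tm E y Hy; rewrite /bflyF; apply: eq_child => //; last by rewrite ltn_mod.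
move=> p Hp; apply: E; have : y %/ (2 * (L * m)) < nb by rewrite ltn_divLR // muln_gt0.
by set q := _ %/ _; set H := 2 * _ in Hp *; nia.
Qed.

Lemma eq_mergeF nb tt f g : eqon (nb * (2 * (L * m))) f g ->
  eqon (nb * (2 * (L * m))) (mergeF W L m tt f) (mergeF W L m tt g).
Proof.
have H0 : 0 < L * m by rewrite muln_gt0 L0.
move=> E y Hy; have : y %/ (2 * (L * m)) < nb by rewrite ltn_divLR // muln_gt0.
rewrite /mergeF; set q := _ %/ _ => Hq.
apply: eq_merge => [p Hp|p Hp|]; last (by rewrite ltn_mod muln_gt0); apply: E; nia.
Qed.

Lemma eq_unfF nb f g : eqon (nb * (L * m)) f g -> eqon (nb * (2 * (L * m))) (unfF L m f) (unfF L m g).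
Proof.
have H0 : 0 < L * m by rewrite muln_gt0 L0.
move=> E y Hy; have : y %/ (2 * (L * m)) < nb by rewrite ltn_divLR // muln_gt0.
rewrite /unfF /unfoldW; set q := _ %/ (2 * _) => Hq; case: ifP => // Hl; apply: E.
have : y %% (2 * (L * m)) %% m < m by rewrite ltn_mod.
set a := _ %% m; set b := (_ %/ m) in Hl * => Ha.
have : a * L + b < L * m by nia.
nia.
Qed.

Lemma eq_foldF nb f g : 0 < m -> eqon (nb * (2 * (L * m))) f g -> eqon (nb * (L * m)) (foldF W L m f) (foldF W L m g).
Proof.
have H0 : 0 < L * m by rewrite muln_gt0 L0.
move=> _ E y Hy; have : y %/ (L * m) < nb by rewrite ltn_divLR.
rewrite /foldF /foldW; set q := _ %/ (L * _) => Hq.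
have : y %% (L * m) < L * m by rewrite ltn_mod.
set y' := _ %% (L * m) => Hy'.
have Hi : y' %% L < L by rewrite ltn_mod.
have Hj : y' %/ L < m by rewrite ltn_divLR // mulnC.
congr addW; first by apply: E; nia.
apply: eq_rotW => // j {}Hj; apply: E; nia.
Qed.
End Cong.

(** * One level of the transform: a tree of butterflies *)

Section Stage.
Variables (W : nat) (ks : seq nat).
Hypothesis W0 : 0 < W.
Implicit Types X Y : nat -> nat -> nat.

(** The product identity at all nodes of depth [d] of [nb] trees. At the roots the exponent is 0, so
    the modulus is [x ^ (2 ^ a) - 1] with [2 ^ a] equal to [2 * l]; at depth [a] only one block is
    left. *)
Definition okn k1 kp nb d c X Y z :=
  let a := k1 - kp + 1 in let sz := 2 ^ (a - d) * 2 ^ kp in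
  forall g, g < nb * 2 ^ d ->
   ok2 W (2 ^ (a - d)) (2 ^ kp) (rv d (g %% 2 ^ d) * 2 ^ (kp.+1 - d)) c ks
     (fun k => sh (g * sz) (X k)) (fun k => sh (g * sz) (Y k)) (sh (g * sz) z).

Lemma node_split g b p H : p < H -> b < 2 -> ((2 * g + b) * H + p) %/ (2 * H) = g /\
   ((2 * g + b) * H + p) %% (2 * H) = b * H + p /\ ((2 * g + b) * H + p) %% H = p.
Proof.
move=> Hp Hb; have H0 : 0 < 2 * H by lia.
have -> : (2 * g + b) * H + p = g * (2 * H) + (b * H + p) by lia.
have Hq : b * H + p < 2 * H by nia.
rewrite divnMDl // (divn_small Hq) addn0 modnMDl (modn_small Hq); split=> //; split=> //.
have -> : g * (2 * H) + (b * H + p) = (2 * g + b) * H + p by lia.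
by rewrite modnMDl modn_small.
Qed.

(** The children of node [g] are the nodes [2 * g + b]. Appending the bit [b] to [g] adds
    [b * 2 ^ d] to the bit reversal, hence changes the exponent to [t + b * m], as [ok2_merge]
    requires. *)
Lemma okn_step k1 kp nb d c X Y z : kp <= k1 -> d <= kp -> d < k1 - kp + 1 ->
  let F := bflyF W (2 ^ (k1 - kp - d)) (2 ^ kp) (ttF kp d) in
  okn k1 kp nb d.+1 c (fun k => F (X k)) (fun k => F (Y k)) z ->
  okn k1 kp nb d (2 * c) X Y (mergeF W (2 ^ (k1 - kp - d)) (2 ^ kp) (ttF kp d) z).
Proof.
move=> Hk Hd Ha F H; rewrite /okn => g Hg; set L := 2 ^ (k1 - kp - d) in F H *.
have E1 : 2 ^ (k1 - kp + 1 - d.+1) = L by congr (2 ^ _); lia.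
have E2 : 2 ^ (k1 - kp + 1 - d) = 2 * L by rewrite -expnS; congr (2 ^ _); lia.
rewrite /okn E1 in H; rewrite E2; set m := 2 ^ kp in F H *.
have L0 : 0 < L by rewrite expn_gt0.
have m0 : 0 < m by rewrite expn_gt0.
have N0 : 0 < L * m by rewrite muln_gt0 L0.
pose t := ttF kp d g; have tm : t < m by apply: ttF_lt.
have -> : rv d (g %% 2 ^ d) * 2 ^ (kp.+1 - d) = 2 * t.
  by rewrite /t /ttF subSn // expnS; lia.
have Hb b : b < 2 -> 2 * g + b < nb * 2 ^ d.+1 by rewrite expnS; nia.
have Er b : b < 2 -> rv d.+1 ((2 * g + b) %% 2 ^ d.+1) * 2 ^ (kp.+1 - d.+1) = t + b * m.
  move=> b2; have -> : (2 * g + b) %% 2 ^ d.+1 = 2 * (g %% 2 ^ d) + b.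
    rewrite {1}(divn_eq g (2 ^ d)) expnS.
    have -> : 2 * (g %/ 2 ^ d * 2 ^ d + g %% 2 ^ d) + b = g %/ 2 ^ d * (2 * 2 ^ d) + (2 * (g %% 2 ^ d) + b) by lia.
    rewrite modnMDl modn_small //; have : g %% 2 ^ d < 2 ^ d by rewrite ltn_mod expn_gt0.
    lia.
  rewrite rvS [2 * _]mulnC divnMDl // modnMDl (divn_small b2) (modn_small b2) addn0 subSS mulnDl; congr (_ + _).
  by rewrite -mulnA -expnD subnKC.
have X0 f b : b < 2 -> eqon (L * m) (sh ((2 * g + b) * (L * m)) (F f)) (child W L m t (0 < b) (sh (g * (2 * L * m)) f)).
  move=> b2 p Hp; rewrite /sh /F /bflyF; have [-> [-> ->]] := node_split g Hp b2.
  rewrite -/t; have -> : (L * m <= b * (L * m) + p) = (0 < b) by case: b b2 => [|[|]] // _; lia.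
  by rewrite /child /sh !mulnA.
have Z0 f : eqon (2 * L * m) (merge W L m t (sh ((2 * g + 0) * (L * m)) f) (sh ((2 * g + 1) * (L * m)) f)) (sh (g * (2 * L * m)) (mergeF W L m (ttF kp d) f)).
  rewrite -mulnA => p Hp; have P0 : 0 < 2 * (L * m) by rewrite muln_gt0.
  rewrite [RHS]/mergeF /sh divnMDl // (divn_small Hp) !addn0 modnMDl (modn_small Hp) -/t.
  by apply: (eq_merge W L0 m0) => // q Hq; rewrite /sh; congr f; lia.
have H0 := H (2 * g + 0) (Hb 0 isT); have H1 := H (2 * g + 1) (Hb 1 isT).
rewrite !Er // mul0n (addn0 t) in H0; rewrite Er // mul1n in H1.
pose s0 f := sh (g * (2 * L * m)) f.
have K0 : ok2 W L m t c ks (fun k => child W L m t false (s0 (X k))) (fun k => child W L m t false (s0 (Y k)))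
    (sh ((2 * g + 0) * (L * m)) z).
  apply: eq_ok2 H0 => // k; [exact: (X0 (X k) 0 isT) | exact: (X0 (Y k) 0 isT)].
have K1 : ok2 W L m (t + m) c ks (fun k => child W L m t true (s0 (X k))) (fun k => child W L m t true (s0 (Y k)))
    (sh ((2 * g + 1) * (L * m)) z).
  by apply: eq_ok2 H1 => // k; [exact: (X0 (X k) 1 isT) | exact: (X0 (Y k) 1 isT)].
have M := @ok2_merge W L m t W0 tm c ks (fun k => s0 (X k)) (fun k => s0 (Y k)) _ _ K0 K1.
by apply: eq_ok2 M => // i Hi; rewrite -Z0.
Qed.

Fixpoint FS k1 kp d f :=
  if d is d'.+1 then bflyF W (2 ^ (k1 - kp - d')) (2 ^ kp) (ttF kp d') (FS k1 kp d' f)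
  else unfF (2 ^ (k1 - kp)) (2 ^ kp) f.

Fixpoint JS k1 kp j z :=
  if j is j'.+1 then let d := k1 - kp - j' in mergeF W (2 ^ (k1 - kp - d)) (2 ^ kp) (ttF kp d) (JS k1 kp j' z)
  else z.

(** With [kp] half of [k1] rounded up, [l = 2 ^ (k1 - kp)] is at most [m = 2 ^ kp]; hence a power of
    [y], which has order [2 * m], is a root of unity of the order [2 * l] needed by the tree. *)
Definition fwdL k1 f := let kp := k1.+1 %/ 2 in FS k1 kp (k1 - kp).+1 f.
Definition invL k1 z := let kp := k1.+1 %/ 2 in foldF W (2 ^ (k1 - kp)) (2 ^ kp) (JS k1 kp (k1 - kp).+1 z).

Lemma okn_all k1 kp nb c X Y z d : kp <= k1 -> k1 - kp <= kp -> d <= (k1 - kp).+1 ->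
  okn k1 kp nb (k1 - kp).+1 c (fun k => FS k1 kp (k1 - kp).+1 (X k)) (fun k => FS k1 kp (k1 - kp).+1 (Y k)) z ->
  okn k1 kp nb ((k1 - kp).+1 - d) (2 ^ d * c) (fun k => FS k1 kp ((k1 - kp).+1 - d) (X k))
     (fun k => FS k1 kp ((k1 - kp).+1 - d) (Y k)) (JS k1 kp d z).
Proof.
move=> Hk Hk2; elim: d => [_|d IH Hd H]; first by rewrite subn0 expn0 mul1n.
have {IH}:= IH (ltnW Hd) H; rewrite expnS -mulnA [JS _ _ d.+1 _]/=.
rewrite subSS; have -> : (k1 - kp).+1 - d = (k1 - kp - d).+1 by lia.
by apply: okn_step; lia.
Qed.

(** Combines folding, the [k1 - kp + 1] stages of the tree and its leaves; every stage contributes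
    one factor 2. *)
Lemma ok_level k1 nb c X Y z : let kp := k1.+1 %/ 2 in
  (forall q, q < nb * 2 ^ (k1 - kp).+1 -> ok1 W (2 ^ kp) c ks (fun k => sh (q * 2 ^ kp) (fwdL k1 (X k)))
     (fun k => sh (q * 2 ^ kp) (fwdL k1 (Y k))) (sh (q * 2 ^ kp) z)) ->
  forall q, q < nb -> ok1 W (2 ^ k1) (2 ^ (k1 - kp).+1 * c) ks (fun k => sh (q * 2 ^ k1) (X k))
     (fun k => sh (q * 2 ^ k1) (Y k)) (sh (q * 2 ^ k1) (invL k1 z)).
Proof.
move=> kp H q Hq; have Hk : kp <= k1 by rewrite /kp; lia.
have Hk2 : k1 - kp <= kp by rewrite /kp; lia.
have Ek : 2 ^ k1 = 2 ^ (k1 - kp) * 2 ^ kp by rewrite -expnD subnK.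
have leaf : okn k1 kp nb (k1 - kp).+1 c (fun k => FS k1 kp (k1 - kp).+1 (X k))
    (fun k => FS k1 kp (k1 - kp).+1 (Y k)) z.
  rewrite /okn addn1 subnn expn0 mul1n => g Hg; apply: ok2_leaf; exact: H.
have := okn_all Hk Hk2 (leqnn _) leaf; rewrite subnn.
move=> /(_ q); rewrite expn0 muln1 => /(_ Hq); rewrite modn1 /= mul0n subn0 addn1.
set l := 2 ^ (k1 - kp); set m := 2 ^ kp; have -> : 2 ^ (k1 - kp).+1 = 2 * l by rewrite expnS.
have l0 : 0 < l by rewrite expn_gt0.
have m0 : 0 < m by rewrite expn_gt0.
have Ek' : 2 ^ k1 = m * l by rewrite Ek mulnC.
move=> H2; rewrite Ek'.
have E f : eqon (2 * l * m) (sh (q * (2 * l * m)) (unfF l m f)) (unfoldW l m (sh (q * (m * l)) f)).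
  move=> i; rewrite -mulnA => Hi; have P0 : 0 < 2 * (l * m) by rewrite muln_gt0 /= muln_gt0 l0.
  by rewrite {1}/sh /unfF divnMDl // (divn_small Hi) addn0 modnMDl (modn_small Hi) [l * m]mulnC.
have {}H2 := eq_ok2 (fun k => E (X k)) (fun k => E (Y k)) (fun i _ => erefl) H2.
apply: eq_ok1 (ok1_fold W0 l0 m0 H2) => // i Hi.
have P0 : 0 < l * m by rewrite muln_gt0 l0.
rewrite mulnC in Hi; rewrite /invL -/kp -/l -/m [RHS]/sh /foldF [m * l]mulnC.
by rewrite divnMDl // (divn_small Hi) addn0 modnMDl (modn_small Hi) -[2 * l * m]mulnA.
Qed.
End Stage.

(** * Iterating the levels down to blocks of length two *)

Definition kap k i := (k.-1 %/ 2 ^ i).+1.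

(** [kap k i] is [k / 2 ^ i] rounded up, the exponent of the block length after [i] levels; this is
    its recursion. *)
Lemma kapS k i : (kap k i).+1 %/ 2 = kap k i.+1.
Proof. by rewrite /kap expnSr divnMA; lia. Qed.

Lemma kap_le k i : 0 < k -> kap k i <= k.
Proof. by move=> k0; rewrite /kap; have := leq_div k.-1 (2 ^ i); lia. Qed.

Lemma kapS_le k i : kap k i.+1 <= kap k i.
Proof. by rewrite -kapS; have : 0 < kap k i by []; lia. Qed.

Lemma kap0 k : 0 < k -> kap k 0 = k.
Proof. by move=> k0; rewrite /kap expn0 divn1 prednK. Qed.

Fixpoint FW W k i f := if i is i'.+1 then fwdL W (kap k i') (FW W k i' f) else f.

Fixpoint IV W k lam j z := if j is j'.+1 then invL W (kap k (lam - j)) (IV W k lam j' z) else z.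

Section Levels.
Variables (W : nat) (ks : seq nat) (X Y : nat -> nat -> nat) (k : nat).
Hypotheses (W0 : 0 < W) (k0 : 0 < k).

(** Each level doubles the array: after [i] levels it has length [2 ^ (k + i)], cut into blocks of
    length [2 ^ kap k i]. *)
Definition okl i c z := forall q, q < 2 ^ (k + i - kap k i) ->
  ok1 W (2 ^ kap k i) c ks (fun h => sh (q * 2 ^ kap k i) (FW W k i (X h)))
    (fun h => sh (q * 2 ^ kap k i) (FW W k i (Y h))) (sh (q * 2 ^ kap k i) z).

(** Undoing level [i] contributes the exponent [kap k i - kap k i.+1 + 1] to the power of two, and
    these telescope. *)
Lemma okl_down lam j c z : j <= lam -> okl lam c z ->
  okl (lam - j) (2 ^ (kap k (lam - j) - kap k lam + j) * c) (IV W k lam j z).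
Proof.
elim: j => [_|j IH Hj H]; first by rewrite subn0 subnn expn0 mul1n.
have {IH} := IH (ltnW Hj) H; set i := lam - j.+1.
have -> : lam - j = i.+1 by rewrite /i; lia.
have mono a b : a <= b -> kap k b <= kap k a.
  by move=> Hab; rewrite /kap ltnS leq_div2l ?expn_gt0 // leq_exp2l.
have M1 := kapS_le k i; have M2 : kap k lam <= kap k i.+1 by apply: mono; rewrite /i; lia.
have M3 := kap_le i k0.
rewrite /okl [IV _ _ _ j.+1 _]/= -/i => {}H q Hq.
have -> : 2 ^ (kap k i - kap k lam + j.+1) * c =
  2 ^ (kap k i - kap k i.+1).+1 * (2 ^ (kap k i.+1 - kap k lam + j) * c).
  by rewrite mulnA -expnD; congr (2 ^ _ * _); lia.
rewrite -(kapS k i); apply: (ok_level (nb := 2 ^ (k + i - kap k i)) W0) => // q'.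
rewrite -expnD !kapS => Hq'; apply: H; apply: leq_trans Hq' _.
by rewrite leq_exp2l //; lia.
Qed.

(** [k.-1 < 2 ^ lam] forces [kap k lam = 1], so after [lam] levels the blocks have length 2 and [z]
    collects products modulo [x ^ 2 + 1]. Going back up, the powers of two multiply to
    [2 ^ (k - 1 + lam)]. *)
Lemma levels_conv lam z a b : 1 < W -> k.-1 < 2 ^ lam -> a + b <= (2 ^ k).+1 ->
  (forall h i, a <= i -> X h i = 0) -> (forall h i, b <= i -> Y h i = 0) ->
  (forall q, q < 2 ^ (k + lam - 1) ->
    z (2 * q) = \sum_(h <- ks) base0 W (sh (2 * q) (FW W k lam (X h))) (sh (2 * q) (FW W k lam (Y h))) %[mod W] /\
    z (2 * q + 1) = \sum_(h <- ks) base1 W (sh (2 * q) (FW W k lam (X h))) (sh (2 * q) (FW W k lam (Y h))) %[mod W]) ->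
  forall i, i < 2 ^ k ->
  IV W k lam lam z i = 2 ^ (k - 1 + lam) * \sum_(h <- ks) conv (X h) (Y h) i %[mod W].
Proof.
move=> W1 Hlam ab HX HY Hz i Hi.
have K1 : kap k lam = 1 by rewrite /kap divn_small.
have H : okl lam 1 z.
  rewrite /okl K1 expn1 => q /Hz; rewrite [2 * q]mulnC => -[H0 H1].
  by apply: ok1_base => //; rewrite [sh _ z _]/sh ?addn0 ?H0 ?H1.
have := okl_down (leqnn _) H; rewrite subnn kap0 // K1 muln1 /okl kap0 // addn0 subnn => /(_ 0 isT).
rewrite mul0n => H2; apply: (ok1_conv W1 _ ab HX HY H2) => //.
by rewrite expn_gt0.
Qed.
End Levels.

(** * Distances and numbers of shortest paths *)

Section Graph.
Variables (n : nat) (E : rel 'I_n).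
Implicit Types u v x : 'I_n.

Fixpoint wk d u v : nat := if d is d'.+1 then \sum_(x | E u x) wk d' x v else (u == v).

Lemma wk_cat a b u v : wk (a + b) u v = \sum_x wk a u x * wk b x v.
Proof.
elim: a u => [|a IH] u /=.
  rewrite add0n (bigD1 u) //= eqxx mul1n big1 ?addn0 // => x.
  by rewrite eq_sym => /negbTE ->.
under eq_bigr do rewrite IH.
by rewrite exchange_big; apply: eq_bigr => x _; rewrite big_distrl.
Qed.

Fixpoint walks d u v : seq (seq 'I_n) :=
  if d is d'.+1 then [seq x :: p | x <- enum (E u), p <- walks d' x v]
  else if u == v then [:: [::]] else [::].

Lemma size_walks d u v : size (walks d u v) = wk d u v.
Proof.
elim: d u => [|d IH] u /=; first by case: eqP.
rewrite size_allpairs_dep -big_enum /= sumnE big_map.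
by apply: eq_bigr => x _; rewrite IH.
Qed.

Lemma uniq_walks d u v : uniq (walks d u v).
Proof.
elim: d u => [|d IH] u /=; first by case: eqP.
apply: allpairs_uniq_dep => [|x _|]; rewrite ?enum_uniq ?IH //.
by move=> [x p] [y q] _ _ /= [-> ->].
Qed.

Lemma mem_walks d u v p : (p \in walks d u v) = [&& size p == d, path E u p & last u p == v].
Proof.
elim: d u p => [|d IH] u p.
  rewrite /=; case: p => [|x p] /=; case: eqP => // _; by rewrite inE.
apply/allpairsPdep/and3P => [[x [q [Hx Hq ->]]]|].
  move: Hx Hq; rewrite mem_enum IH => Hx /and3P[/eqP <- Hp Hl].
  by rewrite /= eqxx Hp Hl; split=> //; rewrite andbT.
case: p => [[]|x q [Hs /= /andP[Hx Hp] Hl]] //; exists x, q; split=> //.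
  by rewrite mem_enum.
by rewrite IH -eqSS Hs Hp.
Qed.

Lemma wk_gt0P d u v : reflect (exists p, [/\ size p = d, path E u p & last u p = v]) (0 < wk d u v).
Proof.
rewrite -size_walks -has_predT; apply: (iffP hasP) => [[p]|[p [H1 H2 H3]]].
  by rewrite mem_walks => /and3P[/eqP H1 H2 /eqP H3] _; exists p.
by exists p => //; rewrite mem_walks H1 H2 H3 !eqxx.
Qed.

(** [find] returns the length of the list when nothing is found, so [n] encodes unreachable. *)
Definition dist u v := find (fun d => 0 < wk d u v) (iota 0 n).

Lemma dist_le u v : dist u v <= n.
Proof. by rewrite -[X in _ <= X](size_iota 0 n) find_size. Qed.

Lemma dist_wk u v : dist u v < n -> 0 < wk (dist u v) u v.
Proof.
move=> H; have Hh : has (fun d => 0 < wk d u v) (iota 0 n) by rewrite has_find size_iota.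
by have := nth_find 0 Hh; rewrite nth_iota // add0n.
Qed.

Lemma wk_dist d u v : 0 < wk d u v -> dist u v <= d.
Proof.
move=> H; rewrite leqNgt; apply/negP => Hd.
have Hn : d < n := leq_trans Hd (dist_le u v).
have := before_find 0 Hd; by rewrite nth_iota // add0n H.
Qed.

(** Removing cycles from a walk leaves one without repeated vertices, which has fewer than [n]
    edges. *)
Lemma wk_dist_n d u v : 0 < wk d u v -> dist u v < n.
Proof.
case/wk_gt0P => p [_ Hp Hl].
case/shortenP: Hp Hl => q Hq Uq _ Hl.
have Hs : size q < n.
  by have /card_uniqP := Uq => /= <-; rewrite -[X in _ <= X]card_ord max_card.
apply: leq_ltn_trans Hs; apply: wk_dist; apply/wk_gt0P; by exists q.
Qed.

Lemma dist_tri u x v : dist u v <= dist u x + dist x v.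
Proof.
have H := dist_le u v.
case: (leqP n (dist u x)) => H1; first lia.
case: (leqP n (dist x v)) => H2; first lia.
apply: wk_dist; rewrite wk_cat (bigD1 x) //=.
by rewrite addn_gt0 muln_gt0 !dist_wk.
Qed.

Lemma dist_mid u v a b : dist u v = a + b -> a + b < n ->
  exists x, dist u x = a /\ dist x v = b.
Proof.
move=> H Hn; have := @dist_wk u v; rewrite H => /(_ Hn).
rewrite wk_cat lt0n sum_nat_eq0 negb_forall => /existsP[x] /=.
rewrite muln_eq0 negb_or -!lt0n => /andP[/wk_dist Ha /wk_dist Hb].
by exists x; have := dist_tri u x v; lia.
Qed.

Definition cnt u v := if dist u v < n then wk (dist u v) u v else 0.

(** Cut the walks of minimal length after [a] steps. By the triangle inequality only vertices at
    distance exactly [a] from [u] and [b] to [v] contribute, and there the walk counts are counts of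
    shortest paths. *)
Lemma cnt_split u v a b : dist u v = a + b -> a + b < n ->
  cnt u v = \sum_(x | (dist u x == a) && (dist x v == b)) cnt u x * cnt x v.
Proof.
move=> H Hn; rewrite {1}/cnt H Hn wk_cat (bigID (fun x => (dist u x == a) && (dist x v == b))) /=.
rewrite [X in _ + X]big1 ?addn0 => [|x].
  apply: eq_bigr => x /andP[/eqP Ha /eqP Hb]; rewrite /cnt Ha Hb.
  have -> : a < n by apply: leq_ltn_trans Hn; apply: leq_addr.
  by have -> : b < n by apply: leq_ltn_trans Hn; apply: leq_addl.
move=> Hx; apply/eqP; rewrite muln_eq0; apply: contraR Hx; rewrite negb_or -!lt0n.
move=> /andP[/wk_dist Ha /wk_dist Hb].
by have := dist_tri u x v; lia.
Qed.

Lemma wk_bound d u v : wk d u v <= n ^ d.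
Proof.
elim: d u => [|d IH] u /=; first by case: eqP.
rewrite expnS; apply: leq_trans (_ : \sum_(x < n) n ^ d <= _); last by rewrite sum_nat_const card_ord.
rewrite [X in X <= _]big_mkcond; apply: leq_sum => x _; by case: ifP.
Qed.

Lemma dist_refl u : dist u u = 0.
Proof. by apply/eqP; rewrite -leqn0; apply: wk_dist; rewrite /= eqxx. Qed.

Lemma dist_eq0 u v : dist u v = 0 -> u = v.
Proof.
move=> H; have n0 : 0 < n := leq_ltn_trans (leq0n u) (ltn_ord u).
by have := @dist_wk u v; rewrite H => /(_ n0) /=; case: eqP.
Qed.

Lemma wk1 u v : wk 1 u v = E u v.
Proof.
rewrite /= (eq_bigr (fun x => nat_of_bool (v == x))) => [|x _]; last by rewrite eq_sym.
rewrite big_mkcond (bigD1 v) //= eqxx big1 ?addn0; first by case: (E u v).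
by move=> x; rewrite eq_sym => /negbTE ->; case: ifP.
Qed.

Lemma dist_edge u v : u != v -> E u v -> dist u v = 1.
Proof.
move=> Huv He; have : dist u v <= 1 by apply: wk_dist; rewrite wk1 He.
by case H : (dist u v) => [|[|]] //; move: Huv; rewrite (dist_eq0 H) eqxx.
Qed.

Lemma cnt_le1 u v : dist u v <= 1 -> dist u v < n -> cnt u v = 1.
Proof.
move=> H Hn; rewrite /cnt Hn; have := dist_wk Hn.
by case: (dist u v) H => [|[|]] // _; [rewrite /=; case: eqP | rewrite wk1; case: (E u v)].
Qed.

Lemma cnt_bound u v : cnt u v <= n ^ dist u v.
Proof. by rewrite /cnt; case: ifP => // _; apply: wk_bound. Qed.

Lemma cnt_correct u v : num_shortest_paths E u v (cnt u v).
Proof.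
rewrite /cnt; case: ltnP => Hn.
  exists (walks (dist u v) u v); split; rewrite ?uniq_walks ?size_walks // => p.
  rewrite mem_walks; split.
    case/and3P => /eqP Hs Hp /eqP Hl; split=> // q [Hq1 Hq2].
    by rewrite Hs; apply: wk_dist; apply/wk_gt0P; exists q.
  case=> [[Hp Hl] Hm]; rewrite Hp Hl eqxx !andbT eqn_leq.
  rewrite wk_dist ?andbT; last by apply/wk_gt0P; exists p.
  have /wk_gt0P[q [Hq1 Hq2 Hq3]] := dist_wk Hn.
  by rewrite -Hq1; apply: Hm.
exists [::]; split=> // p; split=> // -[[Hp Hl] _].
have : 0 < wk (size p) u v by apply/wk_gt0P; exists p.
by move/wk_dist_n; rewrite ltnNge Hn.
Qed.

Definition layer u t := \sum_(x < n) (dist u x == t).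

Lemma sum_layer u d : \sum_(t < d) layer u t <= n.
Proof.
rewrite /layer exchange_big /=.
apply: leq_trans (_ : \sum_(x < n) 1 <= _); last by rewrite sum1_card card_ord.
apply: leq_sum => x _; case: (ltnP (dist u x) d) => H.
  rewrite (bigD1 (Ordinal H)) //= eqxx big1 // => i Hi; case: eqP => // Ei.
  by case/eqP: Hi; apply: val_inj.
by rewrite big1 // => i _; case: eqP => // Ei; have := ltn_ord i; lia.
Qed.

(** The [d.-1] inner layers are disjoint sets of vertices, each at least as large as layer [t]. *)
Lemma small_layer u d t : 0 < t < d -> (forall i, 0 < i < d -> layer u t <= layer u i) ->
  layer u t * d.-1 <= n.
Proof.
move=> Ht H; apply: leq_trans (sum_layer u d).
case: d Ht H => [|d] Ht H; first lia.
rewrite big_ord_recl /=; apply: leq_trans (leq_addl _ _).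
rewrite mulnC -[X in X * _](card_ord d) -sum_nat_const; apply: leq_sum => i _.
by apply: H; rewrite /= /bump /=; have := ltn_ord i; lia.
Qed.

End Graph.

(** * Array programs *)

Notation rX := 3 (only parsing).
Notation rXB := 4 (only parsing).
Notation aTMP := 7 (only parsing).

(** [Pass a r e]: simultaneous assignment [a[x] := e(x)] for all [x] below register [r]. *)
Definition Pass a r e :=
  Seq (For rX rXB (Var r) (Sto aTMP (Var rX) e))
      (For rX rXB (Var r) (Sto a (Var rX) (Rd aTMP (Var rX)))).

Fixpoint notmp (e : expr) : bool :=
  match e with
  | Num _ | Var _ => true
  | Rd a e => (a != aTMP) && notmp e
  | Bin _ e1 e2 => notmp e1 && notmp e2
  | Ite e e1 e2 => [&& notmp e, notmp e1 & notmp e2]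
  end.

Section Sem.
Variables (V w : nat).
Hypothesis V256 : 256 <= V.
Hypothesis W_V : 2 ^ w = V ^ 8.
Notation ev := (ev V w).
Notation run := (run V w).
Notation cost := (cost V w).
Notation inv := (inv V w).
Notation W := (2 ^ w).

Definition at_ n i s := setr (setr s rXB n) rX i.

Lemma ev_ext e s1 s2 : (forall r, rg s1 r = rg s2 r) ->
  (forall a, a != aTMP -> forall i, ar s1 a i = ar s2 a i) -> notmp e -> ev e s1 = ev e s2.
Proof.
move=> Hr Ha; elim: e => //= [a e IH /andP[H1 /IH ->]|o e1 IH1 e2 IH2 /andP[/IH1 -> /IH2 ->]|
  e IH e1 IH1 e2 IH2 /and3P[/IH -> /IH1 -> /IH2 ->]] //.
exact: Ha.
Qed.

Lemma run_pass a r e s i : inv s -> r != rX -> r != rXB -> a != aTMP -> notmp e ->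
  ar (run (Pass a r e) s) a i = if i < rg s r then stv V a (ev e (at_ (rg s r) i s)) else ar s a i.
Proof.
move=> Hs H1 H2 Ha He; set n := rg s r.
have [I1 I2 I3] := Hs.
have nV : n < V by apply: I1.
set c1 := For rX rXB (Var r) (Sto aTMP (Var rX) e).
set s1 := run c1 s.
have Er : rg s1 r = n by rewrite run_rg //= !inE negb_or H1 H2.
have Ea : ar s1 a = ar s a by rewrite run_ar //= inE.
have ET j : j < n -> ar s1 aTMP j = ev e (at_ n j s).
  rewrite /s1 /c1 [run _ _]/= -/n (modn_small nV).
  pose Q i s' := [/\ forall r, r != rX -> rg s' r = rg (setr s rXB n) r,
     forall b, b != aTMP -> ar s' b =1 ar s b
   & forall j, j < i -> ar s' aTMP j = ev e (at_ n j s)].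
  suff : Q n (loop (run (Sto aTMP (Var rX) e)) rX n (setr s rXB n)) by case=> _ _ H /H.
  apply: loop_inv => [|k s' Hk [Q1 Q2 Q3]]; first by split.
  split=> [q Hq|b Hb x|x Hx] /=; first by rewrite (negbTE Hq) Q1.
    by rewrite (negbTE Hb) /= Q2.
  rewrite (modn_small (ltn_trans Hk nV)); case: eqP => Exk; last by apply: Q3; lia.
  rewrite /stv /= Exk; apply: ev_ext => // q /=.
  by case: eqP => // /eqP Hq; rewrite Q1.
rewrite -[run (Pass a r e) s]/(run (For rX rXB (Var r) (Sto a (Var rX) (Rd aTMP (Var rX)))) s1).
clearbody s1; rewrite [run _ _]/= Er (modn_small nV).
pose Q i s' := [/\ forall j, ar s' aTMP j = ar s1 aTMP j
   & forall j, ar s' a j = if j < i then stv V a (ev e (at_ n j s)) else ar s a j].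
suff : Q n (loop (run (Sto a (Var rX) (Rd aTMP (Var rX)))) rX n (setr s1 rXB n)) by case=> _ /(_ i).
apply: loop_inv => [|k s' Hk [Q1 Q2]]; first by split=> //= j; rewrite Ea.
have kV : k < V by lia.
split=> j /=; first by rewrite eq_sym (negbTE Ha) /= Q1.
rewrite !eqxx /= !(modn_small kV); case: eqP => [->|Hjk].
  by rewrite ltnS leqnn Q1 ET.
by rewrite Q2; congr (if _ then _ else _); lia.
Qed.

Lemma cost_pass a r e s : inv s -> r != rX -> r != rXB ->
  cost (Pass a r e) s <= (esz e + 40) * (rg s r).+1.
Proof.
move=> [I1 _ _] H1 H2; set n := rg s r; have nV : n < V by apply: I1.
pose c1 := For rX rXB (Var r) (Sto aTMP (Var rX) e).
have Er : rg (run c1 s) r = n.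
  by rewrite run_rg //= !inE negb_or H1 H2.
rewrite -[cost _ _]/(cost c1 s + cost (For rX rXB (Var r) (Sto a (Var rX) (Rd aTMP (Var rX)))) (run c1 s)).
move: (run c1 s) Er => s1 Er; rewrite /c1 /= Er !(modn_small nV) !sum_nat_const !card_ord.
have : idxarr a <= 1 by case: idxarr.
by rewrite /idxarr /=; nia.
Qed.

Lemma subWE x y : y < W -> (x + W - y) %% W = subW W x y.
Proof. by move=> H; rewrite /subW (modn_small H). Qed.

End Sem.

(* Concrete syntax; names of registers and arrays *)
Declare Scope prog_scope.
Delimit Scope prog_scope with P.
Notation "x + y" := (Bin Add x y) : prog_scope.
Notation "x * y" := (Bin Mul x y) : prog_scope.
Notation "x - y" := (Bin Sub x y) : prog_scope.
Notation "x %/ y" := (Bin Div x y) : prog_scope.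
Notation "x %% y" := (Bin Mod x y) : prog_scope.
Notation "x < y" := (Bin Lt x y) : prog_scope.
Notation "x == y" := (Bin Eq x y) : prog_scope.
Notation "x >>^ y" := (Bin Shr x y) (at level 30) : prog_scope.
Notation "x <<^ y" := (Bin RShl x y) (at level 30) : prog_scope.
Notation "x +^ y" := (Bin RAdd x y) (at level 50) : prog_scope.
Notation "x -^ y" := (Bin RSub x y) (at level 50) : prog_scope.
Notation "x *^ y" := (Bin RMul x y) (at level 40) : prog_scope.
Notation "$ r" := (Var r) (at level 1, format "$ r") : prog_scope.
Notation "# k" := (Num k) (at level 1, format "# k") : prog_scope.
Notation "c ;; d" := (Seq c d) (at level 90, right associativity) : prog_scope.
Arguments Asg _ _%_P.
Arguments Sto _ _%_P _%_P.
Arguments Rd _ _%_P.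
Arguments Ite _%_P _%_P _%_P.
Arguments If _%_P _%_P _%_P.
Arguments For _ _ _%_P _%_P.
Arguments Pass _ _ _%_P.

Notation rN := 0 (only parsing).
Notation rB := 1 (only parsing).
Notation rh := 2 (only parsing).
Notation rI := 5 (only parsing).
Notation rIB := 6 (only parsing).
Notation rZ := 7 (only parsing).
Notation rZB := 8 (only parsing).
Notation rD := 9 (only parsing).
Notation rDB := 10 (only parsing).
Notation rK := 11 (only parsing).
Notation rLam := 12 (only parsing).
Notation rP := 13 (only parsing).
Notation rPB := 14 (only parsing).
Notation rU := 15 (only parsing).
Notation rV := 16 (only parsing).
Notation rT := 17 (only parsing).
Notation rL := 18 (only parsing).
Notation rLB := 19 (only parsing).
Notation rS := 20 (only parsing).
Notation rSB := 21 (only parsing).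
Notation rkp := 22 (only parsing).
Notation ra := 23 (only parsing).
Notation rm := 24 (only parsing).
Notation rl := 25 (only parsing).
Notation rbs := 26 (only parsing).
Notation rH := 27 (only parsing).
Notation rdn := 28 (only parsing).
Notation rcar := 29 (only parsing).
Notation rq := 30 (only parsing).
Notation rsg := 31 (only parsing).
Notation rk1 := 32 (only parsing).
Notation rNN := 33 (only parsing).
Notation rsz := 34 (only parsing).
Notation rMx := 35 (only parsing).
Notation rst := 36 (only parsing).
Notation rlev := 37 (only parsing).
Notation rgs := 38 (only parsing).
Notation rN2 := 39 (only parsing).

(** Edges, distances, layer sizes, twiddle table, digits of the counts; then the first transformed
    factor, the accumulator, the second factor and the packed output. *)
Notation aE := 0 (only parsing).
Notation aD := 1 (only parsing).
Notation aCnt := 2 (only parsing).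
Notation aG := 3 (only parsing).
Notation aC := 4 (only parsing).
Notation aX := 5 (only parsing).
Notation aAcc := 6 (only parsing).
Notation aY := 8 (only parsing).
Notation aOut := 9 (only parsing).

(** * The transforms as array programs *)

Section Exprs.
Local Open Scope prog_scope.

Definition unfE a :=
  let y := $rX in let N := $rl * $rm in let q := y %/ (#2 * N) in let r := y %% (#2 * N) in
  Ite (r %/ $rm < $rl) (Rd a (q * N + (r %% $rm * $rl + r %/ $rm))) #0.

Definition foldE a :=
  let y := $rX in let N := $rl * $rm in let o := (y %/ N) * (#2 * N) in let r := y %% N in
  let j := r %/ $rl in let row := (r %% $rl + $rl) * $rm in
  Rd a (o + (r %% $rl * $rm + j)) +^
  Ite (j < #1) (#0 -^ Rd a (o + (row + (j + $rm - #1)))) (Rd a (o + (row + (j - #1)))).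

(** The twiddle exponent of node [g]. *)
Definition twE (g : expr) := (Rd aG (#2 * ($rdn + g %% $rdn)) * $rm) %/ $rMx.

Definition bflyE a :=
  let y := $rX in let H := $rH in let g := y %/ (#2 * H) in let o := g * (#2 * H) in
  let p := y %% H in let pm := p %% $rm in let t := twE g in
  let row := H + p %/ $rm * $rm in
  let r := Ite (pm < t) (#0 -^ Rd a (o + (row + (pm + $rm - t)))) (Rd a (o + (row + (pm - t)))) in
  Ite (y %% (#2 * H) < H) (Rd a (o + p) +^ r) (Rd a (o + p) -^ r).

Definition mergeE a :=
  let y := $rX in let H := $rH in let g := y %/ (#2 * H) in let o := g * (#2 * H) in
  let p := y %% (#2 * H) in let q := p - H in let t := $rm - twE g in
  let qm := q %% $rm in let row := q %/ $rm * $rm in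
  let df j := Rd a (o + (row + j)) -^ Rd a (o + H + (row + j)) in
  Ite (p < H) (Rd a (o + p) +^ Rd a (o + H + p))
    (#0 -^ Ite (qm < t) (#0 -^ df (qm + $rm - t)) (df (qm - t))).

Definition levelC (i : expr) : cmd :=
  Asg rlev i ;;
  Asg rk1 (#1 + (($rK - #1) >>^ $rlev)) ;;
  Asg rkp (($rk1 + #1) %/ #2) ;;
  Asg ra ($rk1 - $rkp + #1) ;;
  Asg rm (#1 <<^ $rkp) ;;
  Asg rl (#1 <<^ ($rk1 - $rkp)) ;;
  Asg rbs (#1 <<^ ($rK + $rlev + #1)).

Definition nodeC (d : expr) : cmd :=
  Asg rdn (#1 <<^ d) ;;
  Asg rH (($rl %/ $rdn) * $rm).

Definition fwdC a : cmd :=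
  For rL rLB $rLam (
    levelC $rL ;;
    Pass a rbs (unfE a) ;;
    For rS rSB $ra (nodeC $rS ;; Pass a rbs (bflyE a))).

Definition invC a : cmd :=
  For rL rLB $rLam (
    levelC ($rLam - #1 - $rL) ;;
    For rS rSB $ra (nodeC ($ra - #1 - $rS) ;; Pass a rbs (mergeE a)) ;;
    Asg rbs ($rbs %/ #2) ;;
    Pass a rbs (foldE a)).
End Exprs.

(** * The pass expressions compute the transforms *)

Section Sem.
Variables (V w : nat).
Hypothesis V256 : 256 <= V.
Hypothesis W_V : 2 ^ w = V ^ 8.
Notation ev := (ev V w).
Notation run := (run V w).
Notation cost := (cost V w).
Notation inv := (inv V w).
Notation W := (2 ^ w).

(** Array reads reduce their index modulo [V]; putting this into the array makes the evaluation
    lemmas unconditional, and [eqon_cl] removes it on the part in use. *)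
Definition cl (f : nat -> nat) := fun i => f (i %% V).

Lemma eqon_cl n f : n <= V -> eqon n (cl f) f.
Proof. by move=> H i Hi; rewrite /cl modn_small // (leq_trans Hi). Qed.

Lemma ev_unfE a s l m i : rg s rl = l -> rg s rm = m -> rg s rX = i ->
  ev (unfE a) s = unfF l m (cl (ar s a)) i.
Proof. by move=> /= -> -> ->; rewrite /unfF /unfoldW /sh /cl; case: ltnP. Qed.

Lemma ev_foldE a s l m i : inv s -> rg s rl = l -> rg s rm = m -> rg s rX = i ->
  ev (foldE a) s = foldF W l m (cl (ar s a)) i.
Proof.
move=> [_ _ Hw] /= -> -> ->; rewrite /foldF /foldW /sh /addW /rotW /cl.
by case: ltnP => /= H; rewrite ?subWE.
Qed.

Lemma ev_bflyE a s L m tt i : inv s -> rg s rm = m -> rg s rH = L * m -> rg s rX = i ->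
  ev (twE (Bin Div (Var rX) (Bin Mul (Num 2) (Var rH)))) s = tt (i %/ (2 * (L * m))) ->
  ev (bflyE a) s = bflyF W L m tt (cl (ar s a)) i.
Proof.
move=> [_ _ Hw] /= -> -> -> ->; rewrite /bflyF /child /rotW /sh /cl [L * m <= i %% _]leqNgt.
set t := tt _; set pm := (_ %% (L * m) %% m).
have B x : (x %% W) < W by rewrite ltn_mod expn_gt0.
case: (ltnP (i %% _) (L * m)) => /= H; case: (ltnP pm t) => /= H'; rewrite /addW ?subWE //; apply: B.
Qed.

Lemma ev_mergeE a s L m tt i : inv s -> rg s rm = m -> rg s rH = L * m -> rg s rX = i ->
  ev (twE (Bin Div (Var rX) (Bin Mul (Num 2) (Var rH)))) s = tt (i %/ (2 * (L * m))) ->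
  ev (mergeE a) s = mergeF W L m tt (cl (ar s a)) i.
Proof.
move=> [_ _ Hw] /= -> -> -> ->; rewrite /mergeF /merge /rotW /sh /cl.
have B x : (x %% W) < W by rewrite ltn_mod expn_gt0.
case: ltnP => /= H //; set q := _ - L * m; set t := m - _.
by case: (ltnP (q %% m) t) => /= H'; rewrite ?subWE ?addnA //; apply: B.
Qed.
End Sem.

(** * Correctness and running time of the transforms *)

Section Sem.
Variables (V w : nat).
Hypothesis V256 : 256 <= V.
Hypothesis W_V : 2 ^ w = V ^ 8.
Notation ev := (ev V w).
Notation run := (run V w).
Notation cost := (cost V w).
Notation inv := (inv V w).
Notation W := (2 ^ w).

(** Loop rule treating the invariant and the time per iteration together, since time bounds hold
    only under the invariant. *)
Lemma for_spec (Q : nat -> st -> Prop) K r rb e c s n : ev e s = n -> n < V ->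
  Q 0 (setr s rb n) ->
  (forall i s', i < n -> Q i s' -> Q i.+1 (run c (setr s' r i)) /\ cost c (setr s' r i) <= K i) ->
  (exists s', run (For r rb e c) s = setr s' r n /\ Q n s') /\
  cost (For r rb e c) s <= esz e + 4 + \sum_(i < n) (K i + 5).
Proof.
move=> En nV Q0 QS.
have QI i : i <= n -> Q i (loop (run c) r i (setr s rb n)).
  move=> Hi; apply: loop_inv => // j s' Hj Hq; have [] // := QS j s' _ Hq.
  exact: leq_trans Hj Hi.
rewrite /= En (modn_small nV); split; first by eexists; split; [reflexivity | apply: QI].
rewrite leq_add2l; apply: leq_sum => i _; rewrite leq_add2r.
by have [] := QS i _ (ltn_ord i) (QI i (ltnW (ltn_ord i))).
Qed.

Lemma run_seq c d s : run (Seq c d) s = run d (run c s). Proof. by []. Qed.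
Lemma cost_seq c d s : cost (Seq c d) s = cost c s + cost d (run c s). Proof. by []. Qed.
Lemma run_asg r e s v : ev e s = v -> v < V -> run (Asg r e) s = setr s r v.
Proof. by move=> /= -> H; rewrite modn_small. Qed.

Lemma run_level e s k lv : rg s rK = k -> 0 < k -> ev e s = lv -> 2 ^ (k + lv + 1) < V ->
  let s' := run (levelC e) s in let k1 := kap k lv in let kp := kap k lv.+1 in
  [/\ rg s' rkp = kp, rg s' ra = k1 - kp + 1, rg s' rm = 2 ^ kp,
   rg s' rl = 2 ^ (k1 - kp) & rg s' rbs = 2 ^ (k + lv + 1)].
Proof.
move=> Ek k0 El HV s' k1 kp.
have HkV : k + lv + 1 < V by apply: ltn_trans HV; apply: ltn_expl.
have Hk1 : k1 <= k by apply: kap_le.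
have Hkp : kp <= k1 by apply: kapS_le.
have P x : x <= k + lv + 1 -> 2 ^ x < V by move=> H; apply: leq_ltn_trans HV; rewrite leq_exp2l.
rewrite /s' /levelC !run_seq.
rewrite (run_asg _ El); last lia.
rewrite (@run_asg rk1 _ _ k1) => [||]; last lia; last first.
  by rewrite /= Ek add1n subn1.
rewrite (@run_asg rkp _ _ kp) => [||]; last lia; last first.
  by rewrite /= -/k1 /kp -kapS addn1.
rewrite (@run_asg ra _ _ (k1 - kp + 1)) => [||]; last lia; last by [].
have M y : 2 ^ y < V -> (1 * 2 ^ y) %% W = 2 ^ y.
  by move=> H; rewrite mul1n modn_small // (ltn_trans H (V_ltW V256 W_V)).
have P1 := P kp; have P2 := P (k1 - kp); have P3 := P (k + lv + 1).
rewrite (@run_asg rm _ _ (2 ^ kp)) => [||]; last (by apply: P1; lia); last by apply: M; apply: P1; lia.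
rewrite (@run_asg rl _ _ (2 ^ (k1 - kp))) => [||]; last (by apply: P2; lia); last by apply: M; apply: P2; lia.
rewrite (@run_asg rbs _ _ (2 ^ (k + lv + 1))) => [||]; last (by apply: P3; lia); last by rewrite /= Ek; apply: M; apply: P3; lia.
by [].
Qed.

Lemma run_node e s d l' m : ev e s = d -> rg s rl = 2 ^ l' -> rg s rm = m -> d <= l' ->
  2 ^ l' * m < V -> 0 < m ->
  let s' := run (nodeC e) s in rg s' rdn = 2 ^ d /\ rg s' rH = 2 ^ (l' - d) * m.
Proof.
move=> Ed El Em Hd HV m0 s'.
have P : 2 ^ d < V.
  apply: leq_ltn_trans HV; rewrite -[2 ^ d]muln1; apply: leq_mul => //.
  by rewrite leq_exp2l.
have E : 2 ^ l' %/ 2 ^ d = 2 ^ (l' - d) by rewrite expnB.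
rewrite /s' /nodeC run_seq.
rewrite (@run_asg rdn _ _ (2 ^ d)) => [||]; last exact: P; last first.
  by rewrite /= Ed mul1n modn_small // (ltn_trans P (V_ltW V256 W_V)).
rewrite (@run_asg rH _ _ (2 ^ (l' - d) * m)) => [||]; first by [].
  by rewrite /= El Em E.
by apply: leq_ltn_trans HV; rewrite leq_mul2r leq_exp2l // leq_subr orbT.
Qed.

(** The table stores exponents at the fixed resolution [rMx]; multiplying by [2 ^ kp] and dividing
    by [rMx] rescales them to blocks of length [2 ^ kp], so one table serves all levels. *)
Definition Gok s kp := forall d g, d <= kp ->
  ar s aG ((2 * (2 ^ d + g %% 2 ^ d)) %% V) * 2 ^ kp %/ rg s rMx = ttF kp d g.

Lemma inv_at s n i : inv s -> n < V -> i < V -> inv (at_ n i s).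
Proof. by move=> Hs Hn Hi; do 2 apply: inv_setr => //. Qed.

(** Forward and inverse stages differ only in the pass expression, so the flag [fw] covers both with
    one proof. *)
Lemma stage_spec fw a e s d l' kp nb f : let E := if fw then bflyE a else mergeE a in
  let bs := nb * (2 * (2 ^ (l' - d) * 2 ^ kp)) in
  inv s -> a \in [:: aX; aAcc; aY] -> wfe e -> esz e <= 20 ->
  ev e s = d -> rg s rl = 2 ^ l' -> rg s rm = 2 ^ kp -> rg s rbs = bs -> 0 < nb ->
  d <= l' -> d <= kp -> 2 ^ l' * 2 ^ kp < V -> Gok s kp -> eqon bs (ar s a) f ->
  let s' := run (Seq (nodeC e) (Pass a rbs E)) s in
  eqon bs (ar s' a) ((if fw then bflyF else mergeF) W (2 ^ (l' - d)) (2 ^ kp) (ttF kp d) f) /\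
  cost (Seq (nodeC e) (Pass a rbs E)) s <= 1000 * bs + 100.
Proof.
move=> E bs Hs Ha He Hee Ed El Em Eb nb0 Hd Hd2 HV HG Hf s'.
have Ha7 : a != 7 by move: Ha; rewrite !inE => /or3P[]/eqP ->.
have m0 : 0 < 2 ^ kp by rewrite expn_gt0.
have L0 : 0 < 2 ^ (l' - d) by rewrite expn_gt0.
pose s1 := run (nodeC e) s.
have [R1 R2] := run_node Ed El Em Hd HV m0; rewrite -/s1 in R1 R2.
have I1 : inv s1 by apply: inv_run => //; rewrite /= He.
have R3 : rg s1 rm = 2 ^ kp by rewrite run_rg.
have R4 : rg s1 rMx = rg s rMx by rewrite run_rg.
have R5 : rg s1 rbs = bs by rewrite run_rg.
have A1 b : ar s1 b = ar s b by rewrite run_ar.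
have bsV : bs < V by rewrite -Eb; case: Hs.
have b0 : 0 < bs by rewrite !muln_gt0 nb0 L0.
have ia : idxarr a = false by move: Ha; rewrite !inE => /or3P[]/eqP ->.
have NT : notmp E by rewrite /E; case: (fw); rewrite /= Ha7.
split; last first.
  have := cost_pass V256 W_V a E I1 (isT : rbs != rX) (isT : rbs != rXB).
  rewrite cost_seq -/s1 R5.
  have : esz E <= 416 by rewrite /E; case: (fw).
  by rewrite /= ; nia.
have Ecl : eqon bs (cl V (ar s1 a)) f.
  by move=> i Hi; rewrite (eqon_cl _ (ltnW bsV)) // A1 Hf.
have core i : i < bs -> ev E (at_ bs i s1) = (if fw then bflyF else mergeF) W (2 ^ (l' - d)) (2 ^ kp) (ttF kp d) (cl V (ar s1 a)) i.
  move=> Hi; have Iat := inv_at I1 bsV (ltn_trans Hi bsV).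
  have T : ev (twE (Bin Div (Var rX) (Bin Mul (Num 2) (Var rH)))) (at_ bs i s1) =
     ttF kp d (i %/ (2 * (2 ^ (l' - d) * 2 ^ kp))).
    by clearbody s1; rewrite /= R1 R2 R3 R4 A1 HG.
  by clearbody s1; rewrite /E; case: (fw); [apply: ev_bflyE|apply: ev_mergeE].
move=> i Hi; rewrite /s' run_seq -/s1 run_pass // R5 Hi /stv ia core //.
by case: (fw); [apply: eq_bflyF Hi|apply: eq_mergeF Hi] => // x; apply: ltnW; apply: ttF_lt.
Qed.

Definition GK s kmax := forall kp, kp <= kmax -> Gok s kp.

Lemma Gok_ext s s' kp : ar s' aG = ar s aG -> rg s' rMx = rg s rMx -> Gok s kp -> Gok s' kp.
Proof. by move=> H1 H2 H d g; rewrite H1 H2; apply: H. Qed.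

Lemma size_split k i d : 0 < k -> let k1 := kap k i in let kp := kap k i.+1 in d <= k1 - kp ->
  2 ^ (k + i + 1) = 2 ^ (k + i - k1 + d) * (2 * (2 ^ (k1 - kp - d) * 2 ^ kp)).
Proof.
move=> k0 k1 kp Hd; have H1 : k1 <= k by apply: kap_le.
have H2 : kp <= k1 by apply: kapS_le.
by rewrite -expnD -expnS -expnD; congr (2 ^ _); lia.
Qed.

Lemma kap_half k i : kap k i - kap k i.+1 <= kap k i.+1.
Proof. by rewrite -kapS; lia. Qed.

Lemma level_cost k b c1 c2 c3 : c1 <= 100 -> c2 <= 400 * b -> c3 <= 10 + k * (1000 * b + 200) ->
  4 <= b -> c1 + (c2 + c3) <= (k + 1) * (2000 * b).
Proof.
move=> H1 H2 H3 H4; have : k * (1000 * b + 200) <= k * (1050 * b) by rewrite leq_mul2l; apply/orP; right; lia.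
have -> : k * (1050 * b) = 1050 * (k * b) by lia.
have -> : (k + 1) * (2000 * b) = 2000 * (k * b) + 2000 * b by lia.
by lia.
Qed.

Lemma level_cost' k b c1 c2 c3 : c1 <= 80 -> c2 <= 400 * b -> c3 <= 10 + k * (1000 * b + 200) ->
  4 <= b -> c1 + (c3 + (4 + c2)) <= (k + 1) * (2000 * b).
Proof.
move=> H1 H2 H3 H4; apply: leq_trans (level_cost (leqnn 100) H2 H3 H4); lia.
Qed.

Section Level.
Variables (k i : nat) (a : nat).
Hypotheses (k0 : 0 < k) (HV : 2 ^ (k + i + 1) < V) (Ha : a \in [:: aX; aAcc; aY]).
Let k1 := kap k i.
Let kp := kap k i.+1.
Let bs := 2 ^ (k + i + 1).

Let Hk1 : k1 <= k. Proof. exact: kap_le. Qed.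
Let Hkp : kp <= k1. Proof. exact: kapS_le. Qed.
Let Hh : k1 - kp <= kp. Proof. exact: kap_half. Qed.
Let bs4 : 4 <= bs. Proof. by rewrite -[4]/(2 ^ 2) leq_exp2l //; lia. Qed.
Let ia : idxarr a = false.
Proof. by move: Ha; rewrite !inE => /or3P[]/eqP ->. Qed.
Let HlmV : 2 ^ (k1 - kp) * 2 ^ kp < V.
Proof. by apply: leq_ltn_trans HV; rewrite -expnD leq_exp2l //; lia. Qed.

Lemma nodes_spec fw e s f : inv s -> wfe e -> esz e <= 20 -> rbs \notin [:: rS; rSB] ->
  rg s ra = (k1 - kp).+1 -> rg s rl = 2 ^ (k1 - kp) -> rg s rm = 2 ^ kp -> rg s rbs = bs -> Gok s kp ->
  (forall s' d, rg s' rS = d -> rg s' ra = (k1 - kp).+1 -> ev e s' = if fw then d else k1 - kp - d) ->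
  eqon bs (ar s a) (if fw then FS W k1 kp 0 f else f) ->
  let c := For rS rSB (Var ra) (Seq (nodeC e) (Pass a rbs (if fw then bflyE a else mergeE a))) in
  eqon bs (ar (run c s) a) (if fw then FS W k1 kp (k1 - kp).+1 f else JS W k1 kp (k1 - kp).+1 f) /\
  cost c s <= 10 + k * (1000 * bs + 200).
Proof.
move=> Hs He Hee _ Ea El Em Eb HG Hev Hf c.
have aV : (k1 - kp).+1 < V by rewrite -Ea; case: Hs.
pose S d := if fw then FS W k1 kp d f else JS W k1 kp d f.
pose Q d s' := [/\ inv s', forall r, r \notin [:: rS; rSB; rdn; rH; rX; rXB] -> rg s' r = rg s r,
   ar s' aG = ar s aG & eqon bs (ar s' a) (S d)].
have [||[s' [-> [_ _ _ H]]] HC] := @for_spec Q (fun _ => 1000 * bs + 100) rS rSB (Var ra)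
    (Seq (nodeC e) (Pass a rbs (if fw then bflyE a else mergeE a))) s _ Ea aV.
- split=> //.
    exact: inv_setr.
    by move=> r Hr /=; case: eqP Hr => // ->.
- move=> d s' Hd [Q1 Q2 Q3 Q4].
  set s2 := setr s' rS d.
  have I2 : inv s2 by apply: inv_setr => //; lia.
  have E2 r : r \notin [:: rS; rSB; rdn; rH; rX; rXB] -> rg s2 r = rg s r.
    by move=> Hr; rewrite -(Q2 r Hr) /s2 /=; case: eqP Hr => // ->.
  have Es : rg s2 rS = d by [].
  have Ee : ev e s2 = if fw then d else k1 - kp - d by apply: Hev => //; rewrite E2.
  set dd := (if fw then d else k1 - kp - d) in Ee.
  have Hdd : dd <= k1 - kp by rewrite /dd; case: (fw); lia.
  have Hsz := size_split k0 Hdd; rewrite -/bs -/k1 -/kp in Hsz.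
  have G2 : Gok s2 kp by apply: Gok_ext HG; rewrite ?E2.
  have [| | | | | | | | |R1 R2] := @stage_spec fw a e s2 dd (k1 - kp) kp (2 ^ (k + i - k1 + dd)) (S d) I2 Ha He Hee Ee.
  + by rewrite E2.
  + by rewrite E2.
  + by rewrite E2 // Eb Hsz.
  + by rewrite expn_gt0.
  + exact: Hdd.
  + by lia.
  + exact: HlmV.
  + exact: G2.
  + by rewrite -Hsz.
  rewrite -Hsz in R1 R2; split; last by rewrite (leq_trans R2).
  split.
  + apply: inv_run => //; move: Ha; rewrite !inE => /or3P[]/eqP ->; case: (fw); by rewrite /= He.
  + move=> r Hr; rewrite run_rg ?E2 //; move: Hr; apply: contra; rewrite !inE; case: (fw) => /=; lia.
  + rewrite run_ar ?Q3 //; move: Ha; rewrite !inE => /or3P[]/eqP ->; by case: (fw).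
  + move: R1; rewrite /S /dd; case: (fw) => //.
- split; first exact: H.
  apply: leq_trans HC _; rewrite sum_nat_const card_ord /=; nia.
Qed.

Lemma unf_spec s f : inv s -> rg s rl = 2 ^ (k1 - kp) -> rg s rm = 2 ^ kp -> rg s rbs = bs ->
  eqon (2 ^ (k + i)) (ar s a) f ->
  eqon bs (ar (run (Pass a rbs (unfE a)) s) a) (FS W k1 kp 0 f) /\
  cost (Pass a rbs (unfE a)) s <= 200 * bs.
Proof.
move=> Hs El Em Eb Hf.
have bsV : bs < V := HV.
have Ha7 : a != 7 by move: Ha; rewrite !inE => /or3P[]/eqP ->.
have HbV : 2 ^ (k + i) <= V by apply: ltnW; apply: leq_ltn_trans HV; rewrite leq_exp2l //; lia.
have Hsz := size_split k0 (leq0n (k1 - kp)); rewrite -/bs -/k1 -/kp subn0 addn0 in Hsz.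
split; last first.
  have := cost_pass V256 W_V a (unfE a) Hs (isT : rbs != rX) (isT : rbs != rXB).
  by rewrite Eb /=; lia.
move=> x Hx; rewrite run_pass //=; last by rewrite Ha7.
rewrite Eb Hx /stv ia.
have Iat : inv (at_ bs x s) by apply: inv_at => //; lia.
rewrite -[RHS]/(unfF (2 ^ (k1 - kp)) (2 ^ kp) f x).
rewrite -(@eq_unfF (2 ^ (k1 - kp)) (2 ^ kp) _ _ (2 ^ (k + i - k1)) (cl V (ar s a))) ?expn_gt0 -?Hsz //.
  by rewrite -(@ev_unfE V w a (at_ bs x s) _ _ x El Em).
have -> : 2 ^ (k + i - k1) * (2 ^ (k1 - kp) * 2 ^ kp) = 2 ^ (k + i) by rewrite -!expnD; congr (2 ^ _); lia.
by move=> y Hy; rewrite (eqon_cl _ HbV) // Hf.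
Qed.

Lemma fold_spec s f : inv s -> rg s rl = 2 ^ (k1 - kp) -> rg s rm = 2 ^ kp -> rg s rbs = 2 ^ (k + i) ->
  eqon bs (ar s a) f ->
  eqon (2 ^ (k + i)) (ar (run (Pass a rbs (foldE a)) s) a) (foldF W (2 ^ (k1 - kp)) (2 ^ kp) f) /\
  cost (Pass a rbs (foldE a)) s <= 400 * bs.
Proof.
move=> Hs El Em Eb Hf.
have bsV : bs < V := HV.
have Ha7 : a != 7 by move: Ha; rewrite !inE => /or3P[]/eqP ->.
have HbV : 2 ^ (k + i) < V by apply: leq_ltn_trans HV; rewrite leq_exp2l //; lia.
have Hb2 : 2 ^ (k + i) < bs by rewrite ltn_exp2l //; lia.
have Hsz := size_split k0 (leq0n (k1 - kp)); rewrite -/bs -/k1 -/kp subn0 addn0 in Hsz.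
split; last first.
  have := cost_pass V256 W_V a (foldE a) Hs (isT : rbs != rX) (isT : rbs != rXB).
  by rewrite Eb /=; lia.
have E2 : 2 ^ (k + i) = 2 ^ (k + i - k1) * (2 ^ (k1 - kp) * 2 ^ kp) by rewrite -!expnD; congr (2 ^ _); lia.
move=> x Hx; rewrite run_pass //=; last by rewrite Ha7.
rewrite Eb Hx /stv ia.
have Iat : inv (at_ (2 ^ (k + i)) x s) by apply: inv_at => //; lia.
rewrite -(@eq_foldF W (2 ^ (k1 - kp)) (2 ^ kp) _ _ (2 ^ (k + i - k1)) (cl V (ar s a))) ?expn_gt0 -?Hsz -?E2 //.
  by rewrite -(@ev_foldE V w a (at_ (2 ^ (k + i)) x s) _ _ x Iat El Em).
by move=> y Hy; rewrite (eqon_cl _ (ltnW bsV)) // Hf.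
Qed.

Definition fwd_body :=
  Seq (levelC (Var rL)) (Seq (Pass a rbs (unfE a))
   (For rS rSB (Var ra) (Seq (nodeC (Var rS)) (Pass a rbs (bflyE a))))).

Lemma fwd_body_spec s f : inv s -> rg s rK = k -> rg s rL = i -> GK s k ->
  eqon (2 ^ (k + i)) (ar s a) f ->
  eqon bs (ar (run fwd_body s) a) (fwdL W k1 f) /\ cost fwd_body s <= (k + 1) * (2000 * bs).
Proof.
move=> Hs Ek Ei HG Hf.
have [R1 R2 R3 R4 R5] := @run_level (Var rL) s k i Ek k0 Ei HV.
rewrite /fwd_body !run_seq !cost_seq; set s1 := run (levelC _) s in R1 R2 R3 R4 R5 *.
have I1 : inv s1 by apply: inv_run.
have A1 b : ar s1 b = ar s b by rewrite run_ar.
have M1 : rg s1 rMx = rg s rMx by rewrite run_rg.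
have C1 : cost (levelC (Var rL)) s <= 60 by [].
have [|U1 U2] := @unf_spec s1 f I1 R4 R3 R5; first by rewrite A1.
set s2 := run (Pass a rbs (unfE a)) s1 in U1 *.
have I2 : inv s2 by apply: inv_run => //; move: Ha; rewrite !inE => /or3P[]/eqP ->.
have E2 r : r \notin [:: rX; rXB] -> rg s2 r = rg s1 r.
  by move=> Hr; rewrite run_rg //=; move: Hr; apply: contra; rewrite !inE; lia.
have G2 : Gok s2 kp.
  apply: (@Gok_ext s); first by rewrite run_ar ?A1 //; move: Ha; rewrite !inE => /or3P[]/eqP ->.
    by rewrite E2.
  by apply: HG; lia.
have [|||||||N1 N2] := @nodes_spec true (Var rS) s2 f I2 isT isT isT; rewrite ?E2 //.
- by rewrite R2 addn1.
have -> : fwdL W k1 f = FS W k1 kp (k1 - kp).+1 f by rewrite /fwdL /kp /k1 kapS.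
split; first exact: N1.
by apply: level_cost bs4; [apply: leq_trans C1 _ | apply: leq_trans U2 _; rewrite leq_mul2r orbT |].
Qed.

Definition inv_body :=
  Seq (levelC (Bin Sub (Bin Sub (Var rLam) (Num 1)) (Var rL)))
   (Seq (For rS rSB (Var ra) (Seq (nodeC (Bin Sub (Bin Sub (Var ra) (Num 1)) (Var rS))) (Pass a rbs (mergeE a))))
   (Seq (Asg rbs (Bin Div (Var rbs) (Num 2))) (Pass a rbs (foldE a)))).

Lemma inv_body_spec s f : inv s -> rg s rK = k -> rg s rLam - 1 - rg s rL = i -> GK s k ->
  eqon bs (ar s a) f ->
  eqon (2 ^ (k + i)) (ar (run inv_body s) a) (invL W k1 f) /\ cost inv_body s <= (k + 1) * (2000 * bs).
Proof.
move=> Hs Ek Ei HG Hf.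
have [R1 R2 R3 R4 R5] := @run_level (Bin Sub (Bin Sub (Var rLam) (Num 1)) (Var rL)) s k i Ek k0 Ei HV.
rewrite /inv_body !run_seq !cost_seq; set s1 := run (levelC _) s in R1 R2 R3 R4 R5 *.
have I1 : inv s1 by apply: inv_run.
have A1 b : ar s1 b = ar s b by rewrite run_ar.
have M1 : rg s1 rMx = rg s rMx by rewrite run_rg.
have C1 : cost (levelC (Bin Sub (Bin Sub (Var rLam) (Num 1)) (Var rL))) s <= 80 by [].
have G1 : Gok s1 kp.
  by apply: (@Gok_ext s) => //; apply: HG; lia.
have [|||||||N1 N2] := @nodes_spec false (Bin Sub (Bin Sub (Var ra) (Num 1)) (Var rS)) s1 f I1 isT isT isT.
- by rewrite R2 addn1.
- exact: R4.
- exact: R3.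
- exact: R5.
- exact: G1.
- by move=> s' d /= -> ->; rewrite subn1.
- by rewrite A1.
set c2 := For rS rSB _ _ in N1 N2 *.
set s2 := run c2 s1 in N1 *.
have I2 : inv s2 by apply: inv_run => //; rewrite /c2; move: Ha; rewrite !inE => /or3P[]/eqP ->.
have E2 r : r \notin [:: rS; rSB; rdn; rH; rX; rXB] -> rg s2 r = rg s1 r.
  by move=> Hr; rewrite run_rg // /c2 /=; move: Hr; apply: contra; rewrite !inE; lia.
have Ebs : bs %/ 2 = 2 ^ (k + i) by rewrite /bs addn1 expnS mulKn.
have HbV : 2 ^ (k + i) < V by apply: leq_ltn_trans HV; rewrite leq_exp2l //; lia.
rewrite (@run_asg rbs _ s2 (2 ^ (k + i))) //; last by rewrite -Ebs -(R5 : _ = bs) -(E2 rbs).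
set s3 := setr s2 rbs _.
have I3 : inv s3 by apply: inv_setr.
have [||||F1 F2] := @fold_spec s3 (JS W k1 kp (k1 - kp).+1 f) I3.
- by rewrite -R4 -E2.
- by rewrite -R3 -E2.
- by [].
- exact: N1.
split; first by rewrite /invL kapS.
have C3 : cost (Asg rbs (Bin Div (Var rbs) (Num 2))) s2 = 4 by [].
rewrite C3; exact: level_cost' C1 F2 N2 bs4.
Qed.
End Level.

(** Each of the [lam] levels makes one unfolding pass and [k1 - kp + 1] butterfly passes, at most
    [k + 1] in all, over at most [2 ^ (k + lam)] cells. *)
Lemma fwd_spec s a k lam f : inv s -> a \in [:: aX; aAcc; aY] -> rg s rK = k -> 0 < k -> rg s rLam = lam ->
  2 ^ (k + lam) < V -> GK s k -> eqon (2 ^ k) (ar s a) f ->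
  eqon (2 ^ (k + lam)) (ar (run (fwdC a) s) a) (FW W k lam f) /\
  cost (fwdC a) s <= 10 + lam * ((k + 1) * (2010 * 2 ^ (k + lam))).
Proof.
move=> Hs Ha Ek k0 El HV HG Hf.
have lV : lam < V by rewrite -El; case: Hs.
pose Q i s' := [/\ inv s', forall r, r \notin wr (fwdC a) -> rg s' r = rg s r,
   ar s' aG = ar s aG & eqon (2 ^ (k + i)) (ar s' a) (FW W k i f)].
have [||[s' [Es [_ _ _ H]]] HC] := @for_spec Q (fun _ => (k + 1) * (2000 * 2 ^ (k + lam))) rL rLB (Var rLam)
    (fwd_body a) s _ El lV.
- split=> //; [exact: inv_setr | | by rewrite addn0].
  by move=> r Hr /=; case: eqP Hr => // ->.
- move=> i s' Hi [Q1 Q2 Q3 Q4]; set s2 := setr s' rL i.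
  have I2 : inv s2 by apply: inv_setr => //; lia.
  have E2 r : r \notin wr (fwdC a) -> rg s2 r = rg s r.
    by move=> Hr; rewrite -(Q2 r Hr) /s2 /=; case: eqP Hr => // ->.
  have Le : 2 ^ (k + i + 1) <= 2 ^ (k + lam) by rewrite leq_exp2l //; lia.
  have [| | | |R1 R2] := @fwd_body_spec k i a k0 (leq_ltn_trans Le HV) Ha s2 (FW W k i f) I2.
  + by rewrite E2.
  + by [].
  + by move=> kp Hkp; apply: Gok_ext (HG kp Hkp) => //; rewrite E2.
  + exact: Q4.
  split; last by apply: leq_trans R2 _; rewrite leq_mul2l leq_mul2l Le !orbT.
  split.
  + by apply: inv_run => //; move: Ha; rewrite !inE => /or3P[]/eqP ->.
  + move=> r Hr; rewrite run_rg ?E2 //; move: Hr; apply: contra; rewrite !inE => /=; lia.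
  + rewrite run_ar ?Q3 //; move: Ha; rewrite !inE => /or3P[]/eqP -> //.
  + by have -> : k + i.+1 = k + i + 1 by lia.
rewrite -[fwdC a]/(For rL rLB (Var rLam) (fwd_body a)) Es; split=> //.
apply: leq_trans HC _; rewrite sum_nat_const card_ord /=.
have : 0 < 2 ^ (k + lam) by rewrite expn_gt0.
set P := 2 ^ _; nia.
Qed.

Lemma inv_spec s a k lam f : inv s -> a \in [:: aX; aAcc; aY] -> rg s rK = k -> 0 < k -> rg s rLam = lam ->
  2 ^ (k + lam) < V -> GK s k -> eqon (2 ^ (k + lam)) (ar s a) f ->
  eqon (2 ^ k) (ar (run (invC a) s) a) (IV W k lam lam f) /\
  cost (invC a) s <= 10 + lam * ((k + 1) * (2010 * 2 ^ (k + lam))).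
Proof.
move=> Hs Ha Ek k0 El HV HG Hf.
have lV : lam < V by rewrite -El; case: Hs.
pose Q i s' := [/\ inv s', forall r, r \notin wr (invC a) -> rg s' r = rg s r,
   ar s' aG = ar s aG & eqon (2 ^ (k + (lam - i))) (ar s' a) (IV W k lam i f)].
have [||[s' [Es [_ _ _ H]]] HC] := @for_spec Q (fun _ => (k + 1) * (2000 * 2 ^ (k + lam))) rL rLB (Var rLam)
    (inv_body a) s _ El lV.
- split=> //; [exact: inv_setr | | by rewrite subn0].
  by move=> r Hr /=; case: eqP Hr => // ->.
- move=> j s' Hj [Q1 Q2 Q3 Q4]; set s2 := setr s' rL j.
  have I2 : inv s2 by apply: inv_setr => //; lia.
  have E2 r : r \notin wr (invC a) -> rg s2 r = rg s r.
    by move=> Hr; rewrite -(Q2 r Hr) /s2 /=; case: eqP Hr => // ->.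
  pose i := lam - j.+1; have Ei : k + (lam - j) = k + i + 1 by rewrite /i; lia.
  have Le : 2 ^ (k + i + 1) <= 2 ^ (k + lam) by rewrite leq_exp2l // /i; lia.
  have [| | | |R1 R2] := @inv_body_spec k i a k0 (leq_ltn_trans Le HV) Ha s2 (IV W k lam j f) I2.
  + by rewrite E2.
  + by rewrite E2 // El /= /i; lia.
  + by move=> kp Hkp; apply: Gok_ext (HG kp Hkp) => //; rewrite E2.
  + by rewrite -Ei.
  split; last by apply: leq_trans R2 _; rewrite leq_mul2l leq_mul2l Le !orbT.
  split.
  + by apply: inv_run => //; move: Ha; rewrite !inE => /or3P[]/eqP ->.
  + move=> r Hr; rewrite run_rg ?E2 //; move: Hr; apply: contra; rewrite !inE => /=; lia.
  + rewrite run_ar ?Q3 //; move: Ha; rewrite !inE => /or3P[]/eqP -> //.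
  + exact: R1.
rewrite -[invC a]/(For rL rLB (Var rLam) (inv_body a)) Es; split.
  by move: H; rewrite subnn addn0.
apply: leq_trans HC _; rewrite sum_nat_const card_ord /=.
have : 0 < 2 ^ (k + lam) by rewrite expn_gt0.
set P := 2 ^ _; nia.
Qed.
End Sem.

(** * Digits and carries *)

Section Digits.
Definition dig B x i := (x %/ B ^ i) %% B.

Lemma mixed_lt a r P B : a < B -> r < P -> a * P + r < P * B.
Proof.
move=> Ha Hr; apply: (@leq_trans (a.+1 * P)); first by rewrite mulSn addnC ltn_add2r.
by rewrite mulnC leq_mul2l Ha orbT.
Qed.

Import GRing.Theory.

Section Dig.
Variable B : nat.
Hypothesis B0 : 0 < B.

Lemma dig_small x i j : x < B ^ j -> j <= i -> dig B x i = 0.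
Proof.
move=> Hx Hj; rewrite /dig divn_small ?mod0n //.
by apply: leq_trans Hx _; rewrite leq_pexp2l.
Qed.

Lemma sum_dig x m : \sum_(j < m) dig B x j * B ^ j = x %% B ^ m.
Proof.
elim: m => [|m IH]; first by rewrite big_ord0 expn0 modn1.
rewrite big_ord_recr /= IH /dig expnS [B * _]mulnC.
rewrite [in RHS](divn_eq x (B ^ m)) [in RHS](divn_eq (x %/ B ^ m) B).
have -> : (x %/ B ^ m %/ B * B + x %/ B ^ m %% B) * B ^ m + x %% B ^ m =
  x %/ B ^ m %/ B * (B ^ m * B) + (x %/ B ^ m %% B * B ^ m + x %% B ^ m) by lia.
have H1 : x %/ B ^ m %% B < B by rewrite ltn_mod.
have H2 : x %% B ^ m < B ^ m by rewrite ltn_mod expn_gt0 B0.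
by rewrite modnMDl (modn_small (mixed_lt H1 H2)) addnC.
Qed.

Lemma dig_add x z i : dig B (x + B ^ i.+1 * z) i = dig B x i.
Proof.
rewrite /dig expnS; have -> : x + B * B ^ i * z = (z * B) * B ^ i + x by lia.
by rewrite divnMDl ?expn_gt0 ?B0 // modnMDl.
Qed.

(** One Horner step: appending the next lower digit to a window of [i] digits. It drives the packing
    of digits into words. *)
Lemma horner_step x k i : (x %/ B ^ k.+1) %% B ^ i * B + dig B x k = (x %/ B ^ k) %% B ^ i.+1.
Proof.
rewrite /dig expnSr divnMA; set y := x %/ B ^ k.
rewrite [in RHS](divn_eq y B) [in RHS](divn_eq (y %/ B) (B ^ i)) expnSr.
have -> : (y %/ B %/ B ^ i * B ^ i + (y %/ B) %% B ^ i) * B + y %% B =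
  y %/ B %/ B ^ i * (B ^ i * B) + ((y %/ B) %% B ^ i * B + y %% B) by lia.
have H1 : y %% B < B by rewrite ltn_mod.
have H2 : y %/ B %% B ^ i < B ^ i by rewrite ltn_mod expn_gt0 B0.
have H3 := mixed_lt H2 H1; rewrite [B * _]mulnC in H3.
by rewrite modnMDl (modn_small H3).
Qed.

(** Both sides are the value at [B] of a product of polynomials over the semiring of natural
    numbers; [a + b <= N.+1] means that [N] coefficients exhaust it. *)
Lemma conv_value f g a b N : a + b <= N.+1 ->
  (forall i, a <= i -> f i = 0) -> (forall i, b <= i -> g i = 0) ->
  \sum_(i < N) conv f g i * B ^ i = (\sum_(i < a) f i * B ^ i) * (\sum_(j < b) g j * B ^ j).
Proof.
move=> ab Hf Hg; pose p : {poly nat} := (\poly_(i < a) f i)%R; pose q : {poly nat} := (\poly_(i < b) g i)%R.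
have Sp : size p <= a by apply: size_poly.
have Sq : size q <= b by apply: size_poly.
have Ev F c : (\poly_(i < c) F i : {poly nat})%R.[B]%R = \sum_(i < c) F i * B ^ i.
  by rewrite horner_poly; apply: eq_bigr => i _; rewrite -natrXE.
have Co F c (HF : forall i, c <= i -> F i = 0) j : ((\poly_(i < c) F i : {poly nat})`_j = F j)%R.
  by rewrite coef_poly; case: ltnP => // /HF.
have HM := hornerM p q B; rewrite !Ev in HM; apply: etrans HM.
rewrite (@horner_coef_wide _ N).
  apply: eq_bigr => i _; rewrite natrXE coefM /conv; congr (_ * _).
  by apply: eq_bigr => j _; rewrite !Co.
by apply: leq_trans (size_polyMleq _ _) _; rewrite -subn1 leq_subLR add1n; apply: leq_trans (leq_add Sp Sq) ab.
Qed.

(** Carry propagation computes the digits of [\sum_i z i * B ^ i]. *)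
Fixpoint carry (z : nat -> nat) i := if i is j.+1 then (z j + carry z j) %/ B else 0.

Lemma carryE z i : carry z i = (\sum_(j < i) z j * B ^ j) %/ B ^ i.
Proof.
elim: i => [|i IH]; first by rewrite big_ord0 div0n.
rewrite /= IH big_ord_recr /= expnSr divnMA; congr (_ %/ _).
by rewrite [in RHS]addnC divnMDl // expn_gt0 B0.
Qed.

(** Terms beyond [i] are multiples of [B ^ i.+1] and leave digit [i] alone; the terms before it
    enter through the carry. *)
Lemma carry_dig z i d : i < d -> (z i + carry z i) %% B = dig B (\sum_(j < d) z j * B ^ j) i.
Proof.
move=> Hi; rewrite -(big_mkord xpredT (fun j => z j * B ^ j)) (@big_cat_nat _ _ _ i.+1) //=.
have -> : \sum_(i.+1 <= j < d) z j * B ^ j = B ^ i.+1 * \sum_(i.+1 <= j < d) z j * B ^ (j - i.+1).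
  rewrite big_distrr /=; apply: eq_big_nat => j /andP[Hj _].
  by rewrite mulnCA -expnD subnKC.
rewrite dig_add /dig carryE big_mkord big_ord_recr /= addnC; congr (_ %% _).
by rewrite [in RHS]addnC divnMDl ?expn_gt0 ?B0 // addnC.
Qed.

(** Two summands of at most [M], divided by [B >= 2], give again at most [M]. *)
Lemma carry_le z i M : 1 < B -> (forall j, z j <= M) -> carry z i <= M.
Proof.
move=> B1 H; elim: i => //= i IH.
have : z i + carry z i <= M * 2 by have := H i; lia.
move=> H2; apply: leq_trans (leq_div2r B H2) _.
by apply: leq_trans (leq_div2l (M * 2) (isT : 0 < 2) B1) _; rewrite mulnK.
Qed.
End Dig.
End Digits.

(** * The algorithm *)

Section Program.
Local Open Scope prog_scope.

(** [$rN] stands for infinity, in agreement with the default value of [dist]. *)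
Definition distInitE :=
  Ite ($rX %/ $rN == $rX %% $rN) #0 (Ite (Rd aE $rX) #1 $rN).

Definition relaxE :=
  let t := Rd aD (($rX %/ $rN) * $rN + $rZ) + Rd aD ($rZ * $rN + $rX %% $rN) in
  Ite (t < Rd aD $rX) t (Rd aD $rX).

Definition cntE :=
  Rd aCnt $rX + (Rd aD (($rX %/ $rN) * $rN + $rZ) == $rX %% $rN).

Definition twiddleE :=
  Ite ($rX < #2) #0 (Rd aG ($rX %/ #2) %/ #2 + ($rX %% #2) * $rMx).

Definition digitInitE :=
  Ite ($rX %% $rst == #0) (Rd aD ($rX %/ $rst) < #2) #0.

(** A count gets [n] words, that is [128 * n] digits in base [B], as a word is a number below
    [B ^ 128]. [8 * B] is the size of the twiddle table. *)
Definition constC : cmd :=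
  Asg rsz ($rN * $rN) ;; Asg rMx ($rB * $rB) ;; Asg rst (#128 * $rN) ;;
  Asg rgs (#8 * $rB) ;; Asg rN2 ($rsz * $rst).

Definition distC : cmd :=
  Pass aD rsz distInitE ;;
  For rI rIB $rh (For rZ rZB $rN (Pass aD rsz relaxE)).

Definition layerC : cmd := For rZ rZB $rN (Pass aCnt rsz cntE).

Definition twiddleC : cmd := For rI rIB ($rh + #3) (Pass aG rgs twiddleE).

Definition initC : cmd := constC ;; distC ;; layerC ;; twiddleC ;; Pass aC rN2 digitInitE.

(** Finds [k] with [d <= 2 ^ k <= 2 * d] and [lam] with [k - 1 < 2 ^ lam <= 2 * k] by counting
    up. *)
Definition sizesC : cmd :=
  Asg rK #1 ;;
  For rI rIB $rD (If ((#1 <<^ $rK) < $rD) (Asg rK ($rK + #1)) Skip) ;;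
  Asg rLam #0 ;;
  For rI rIB $rK (If (#0 < (($rK - #1) >>^ $rLam)) (Asg rLam ($rLam + #1)) Skip) ;;
  Asg rNN (#1 <<^ $rK) ;;
  Asg rsg ($rK - #1 + $rLam) ;;
  Asg rgs (#1 <<^ ($rK + $rLam)).

Definition pickC : cmd :=
  Asg rU ($rP %/ $rN) ;; Asg rV ($rP %% $rN) ;; Asg rT #1 ;;
  For rI rIB $rD
    (If (#0 < $rI)
      (If (Rd aCnt ($rU * $rN + $rI) < Rd aCnt ($rU * $rN + $rT)) (Asg rT $rI) Skip) Skip).

(** Even cells accumulate [base0] and odd cells [base1] of the block of length 2 containing them. *)
Definition accE :=
  Ite ($rX %% #2 == #0)
    (Rd aAcc $rX +^ ((Rd aX $rX *^ Rd aY $rX) -^ (Rd aX ($rX + #1) *^ Rd aY ($rX + #1))))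
    (Rd aAcc $rX +^ ((Rd aX ($rX - #1) *^ Rd aY $rX) +^ (Rd aX $rX *^ Rd aY ($rX - #1)))).

Definition macC : cmd :=
  Pass aX rNN (Rd aC (($rU * $rN + $rZ) * $rst + $rX)) ;;
  Pass aY rNN (Rd aC (($rZ * $rN + $rV) * $rst + $rX)) ;;
  fwdC aX ;; fwdC aY ;; Pass aAcc rgs accE.

Definition sumC : cmd :=
  Pass aAcc rgs #0 ;;
  For rZ rZB $rN
    (If (Rd aD ($rU * $rN + $rZ) == $rT)
      (If (Rd aD ($rZ * $rN + $rV) == $rD - $rT) macC Skip) Skip).

(** The shift by [rsg], which is [k - 1 + lam], removes the power of two left by the inverse
    transform. *)
Definition carryC : cmd :=
  Asg rcar #0 ;;
  For rI rIB $rD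
    (Asg rq ((Rd aAcc $rI >>^ $rsg) +^ $rcar) ;;
     Sto aC ($rP * $rst + $rI) ($rq %% $rB) ;;
     Asg rcar ($rq %/ $rB)).

Definition pairC : cmd := pickC ;; sumC ;; invC aAcc ;; carryC.

Definition distanceC : cmd :=
  sizesC ;; For rP rPB $rsz (If (Rd aD $rP == $rD) pairC Skip).

(** Increasing distances: a midpoint splits a pair at distance [d] into pairs at smaller distances,
    already done. Distances 0 and 1 are settled by the initialisation. *)
Definition countC : cmd := For rD rDB $rN (If (#1 < $rD) distanceC Skip).

Definition packC : cmd :=
  Asg rN2 ($rsz * $rN) ;;
  For rI rIB #128
    (Pass aOut rN2 ((Rd aOut $rX *^ $rB) +^ Rd aC (#128 * $rX + (#127 - $rI)))).

Definition mainC : cmd := initC ;; countC ;; packC.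

(** Overflow and register discipline of the whole program are decided by computation. *)
Lemma wfc_mainC : wfc mainC.
Proof. by vm_compute. Qed.
End Program.

(** * Correctness and cost of the algorithm *)

Lemma slack c d N : c + 5 <= d -> 0 < N -> c * N + 5 <= d * N.
Proof. by move=> H HN; apply: leq_trans (_ : (c + 5) * N <= _); rewrite ?leq_mul2r ?H ?orbT // mulnDl leq_add2l leq_pmulr. Qed.

Lemma sub_exch a b d : d <= a -> d <= b -> a - d + b = b - d + a.
Proof. lia. Qed.

Lemma heap_bound a b c : a <= 2 * b -> c < a -> 2 * (a + c) < 8 * b.
Proof. lia. Qed.

Lemma init_cost_bound n h B : B <= 2 * n.+1 ->
  200 + (400 * (h.+1 * (n.+1 * (n * n).+1)) + (5 + n * (100 * (n * n).+1) + (20 + (h + 3) * (80 * (8 * B).+1)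
   + 62 * (n * n * (128 * n)).+1))) <= 20 * 1000 * (n.+1 ^ 3 * h.+1 ^ 5).
Proof.
move=> HB; set M := n.+1 ^ 3 * h.+1 ^ 5.
have a3 : n.+1 ^ 3 = n.+1 * (n.+1 * n.+1) by rewrite !expnS expn0 muln1.
have b5 : h.+1 <= h.+1 ^ 5 by rewrite -{1}[h.+1]expn1 leq_pexp2l.
have E0 : (n * n).+1 <= n.+1 * n.+1 by rewrite mulSn mulnS; lia.
have P0 : 0 < n.+1 ^ 3 by rewrite expn_gt0.
have M1 : h.+1 * n.+1 ^ 3 <= M by rewrite mulnC leq_mul2l b5 orbT.
have M2 : n.+1 ^ 3 <= M by apply: leq_trans M1; rewrite leq_pmull.
have H1 : h.+1 * (n.+1 * (n * n).+1) <= M.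
  apply: leq_trans M1; rewrite leq_mul2l a3 leq_mul2l; by rewrite E0 !orbT.
have H2 : n * (n * n).+1 <= M by apply: leq_trans M2; rewrite a3; apply: leq_mul.
have H3 : h.+1 * n.+1 <= M by apply: leq_trans M1; rewrite leq_mul2l a3 leq_pmulr.
have H4 : n * n * n <= M by apply: leq_trans H2; rewrite -mulnA leq_mul2l leqnSn orbT.
have H5 : (h + 3) * (80 * (8 * B).+1) <= 3 * h.+1 * (80 * (17 * n.+1)).
  by apply: leq_mul; lia.
have E5 : 3 * h.+1 * (80 * (17 * n.+1)) = 4080 * (h.+1 * n.+1) by lia.
have E4 : n * n * (128 * n) = 128 * (n * n * n) by lia.
have E2 : n * (100 * (n * n).+1) = 100 * (n * (n * n).+1) by lia.
rewrite E4 E2; lia.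
Qed.

Lemma sizes_cost x y d k n h : x <= 5 + d -> y <= 5 + k -> d <= n -> k <= h ->
  2 + (x + (2 + (y + (4 + (10 + 6))))) <= 80 + n + h.
Proof. lia. Qed.

Lemma pick_cost x y : x <= 5 + y -> 4 + (4 + (2 + x)) <= 40 + y.
Proof. lia. Qed.

Lemma even_succ_lt x b : x < 2 * b -> x %% 2 = 0 -> x + 1 < 2 * b.
Proof. lia. Qed.

Lemma mac_cost p S F x1 x2 x3 x4 x5 : 0 < p -> p <= S -> x1 <= 54 * p.+1 -> x2 <= 54 * p.+1 ->
  x3 <= F -> x4 <= F -> x5 <= 135 * S.+1 -> x1 + (x2 + (x3 + (x4 + x5))) <= 2 * F + 500 * S.
Proof. lia. Qed.

Lemma sum_cost q F : q <= F -> 14 + 1 + (16 + 1 + (q + 1) + 1) <= 60 + F.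
Proof. lia. Qed.

Lemma FC_le lam k S d H : S <= 4 * (d * H) -> lam <= H -> k + 1 <= 2 * H -> 0 < d -> 0 < H ->
  10 + lam * ((k + 1) * (2010 * S)) <= 17 * 1000 * (d * H ^ 3).
Proof.
move=> HS Hl Hk d0 H0.
have K1 : lam * ((k + 1) * (2010 * S)) <= H * ((2 * H) * (2010 * (4 * (d * H)))).
  by apply: leq_mul => //; apply: leq_mul => //; rewrite leq_mul2l HS.
have -> : d * H ^ 3 = d * (H * (H * H)) by rewrite !expnS expn0 muln1.
have P : 0 < d * (H * (H * H)) by rewrite !muln_gt0 d0 H0.
have E1 : H * ((2 * H) * (2010 * (4 * (d * H)))) = 16 * 1005 * (d * (H * (H * H))) by lia.
rewrite E1 in K1; move: P K1; set T := d * (H * (H * H)); set U := lam * _; clear; lia.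
Qed.

(** Where the running time is won: [L] midpoints at about [d * K] steps each cost about
    [L * d * K <= 2 * n * K]. Here [L] is the size of the chosen layer and [K] a polylogarithmic
    factor. *)
Lemma pair_cost n d K S L F M c1 c2 c3 c4 c5 : 0 < n -> 0 < K -> d <= n -> L * d <= 2 * n -> S <= 4 * (d * K) ->
  F <= 17 * 1000 * (d * K) -> M <= 2 * F + 500 * S -> c1 <= 40 + n * 60 -> c2 <= 41 * S.+1 ->
  c3 <= 5 + (n * 65 + L * M) -> c4 <= F -> c5 <= 10 + n * 60 ->
  c1 + ((c2 + c3) + (c4 + c5)) <= 100 * 1000 * (K * n.+1).
Proof.
move=> n0 K0 Hd HL HS HF HM H1 H2 H3 H4 H5.
have A1 : d * K <= n * K by rewrite leq_mul2r Hd orbT.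
have A2 : M <= 36 * 1000 * (d * K) by lia.
have A3 : L * M <= 36 * 1000 * (L * d * K).
  by apply: (@leq_trans (L * (36 * 1000 * (d * K)))); [rewrite leq_mul2l A2 orbT | lia].
have A4 : L * d * K <= 2 * n * K by rewrite leq_mul2r HL orbT.
have A5 : n <= n * K by rewrite leq_pmulr.
have A6 : K * n.+1 = n * K + K by rewrite mulnS mulnC addnC.
have A7 : 2 * n * K = 2 * (n * K) by rewrite mulnA.
rewrite A7 in A4; rewrite A6.
move: A1 A2 A3 A4 A5 HS HF HM H1 H2 H3 H4 H5 n0 K0.
clear; set a := d * K; set b := n * K; set e := L * M; set f := L * d * K; lia.
Qed.

Lemma distance_cost a b X : 80 + a + b + (5 + X) <= 85 + a + b + X.
Proof. lia. Qed.

Lemma count_cost n h : 5 + (n * (110 + n * 30 + (h + 1) * 30) + (n * (n * n * 30) + n * n * (100 * 1000 * (h.+1 ^ 3 * n.+1))))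
  <= 101 * 1000 * (n.+1 ^ 3 * h.+1 ^ 5).
Proof.
set M := n.+1 ^ 3 * h.+1 ^ 5.
have a3 : n.+1 ^ 3 = n.+1 * (n.+1 * n.+1) by rewrite !expnS expn0 muln1.
have b5 : h.+1 <= h.+1 ^ 5 by rewrite -{1}[h.+1]expn1 leq_pexp2l.
have b35 : h.+1 ^ 3 <= h.+1 ^ 5 by rewrite leq_pexp2l.
have P0 : 0 < n.+1 ^ 3 by rewrite expn_gt0.
have M1 : h.+1 * n.+1 ^ 3 <= M by rewrite mulnC leq_mul2l b5 orbT.
have M2 : n.+1 ^ 3 <= M by apply: leq_trans M1; rewrite leq_pmull.
have Q1 : n <= n.+1 by [].
have Q2 : n * n <= n.+1 * n.+1 by apply: leq_mul.
have H1 : n * (n * n) <= M by apply: leq_trans M2; rewrite a3; apply: leq_mul.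
have H2 : n * n <= M by apply: leq_trans Q2 _; apply: leq_trans M2; rewrite a3 leq_pmull.
have H3 : n * h.+1 <= M by apply: leq_trans M1; rewrite mulnC leq_mul2l a3; apply: leq_trans Q1 _; rewrite leq_pmulr ?orbT.
have H0 : 0 < M by rewrite muln_gt0 P0 expn_gt0.
have H4 : n <= M by apply: leq_trans H3; rewrite leq_pmulr.
have H5 : n * n * (h.+1 ^ 3 * n.+1) <= M.
  apply: (@leq_trans (n.+1 * n.+1 * (h.+1 ^ 5 * n.+1))); first by apply: leq_mul => //; rewrite leq_mul2r b35 orbT.
  by rewrite [h.+1 ^ 5 * _]mulnC mulnA /M a3 !mulnA.
have E1 : n * n * (100 * 1000 * (h.+1 ^ 3 * n.+1)) = 100 * 1000 * (n * n * (h.+1 ^ 3 * n.+1)) by rewrite mulnCA.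
have E2 : n * (110 + n * 30 + (h + 1) * 30) = 110 * n + 30 * (n * n) + 30 * (n * h.+1) by rewrite addn1; lia.
have E3 : n * (n * n * 30) = 30 * (n * (n * n)) by lia.
rewrite E1 E2 E3; move: H0 H1 H2 H3 H4 H5.
clear; set a := n * (n * n); set b := n * n; set c := n * _; set e := b * _; lia.
Qed.

Lemma count_step_cost x a b c : x <= 85 + a + b + c -> 3 + 1 + (x + 1) <= 90 + a + b + c.
Proof. lia. Qed.

Lemma count_term a b c : 90 + a + b + c + 5 <= 110 + a + b + c.
Proof. lia. Qed.

Lemma pack_cost n h x y : x = 4 -> y <= 5 + 128 * (70 * (n * n * n).+1 + 5) -> x + y <= 10 * 1000 * (n.+1 ^ 3 * h.+1 ^ 5).
Proof.
move=> -> Hy.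
have H : (n * n * n).+1 <= n.+1 ^ 3 by rewrite -[n.+1 ^ 3]/(n.+1 * (n.+1 * n.+1)); lia.
have H2 : n.+1 ^ 3 <= n.+1 ^ 3 * h.+1 ^ 5 by rewrite leq_pmulr // expn_gt0.
move: (leq_trans H H2) Hy; set a := n * n * n; set M := n.+1 ^ 3 * _; clear; lia.
Qed.

Lemma main_cost a b c M : a <= 20 * 1000 * M -> b <= 101 * 1000 * M -> c <= 10 * 1000 * M ->
  a + (b + c) <= 200 * 1000 * M.
Proof. lia. Qed.

(** * The scales [n < B], [V] and [W], and the indexing of matrices *)

Section Main.
Variables (n : nat) (E : rel 'I_n) (h w V : nat).
Notation B := (2 ^ h).
Notation W := (2 ^ w).
Hypothesis h0 : 0 < h.
Hypothesis nB : n < B.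
Hypothesis V_E : V = B ^ 16.
Hypothesis W_V : W = V ^ 8.
Notation ev := (ev V w).
Notation run := (run V w).
Notation cost := (cost V w).
Notation inv := (inv V w).

Lemma B2 : 2 <= B. Proof. by rewrite -{1}[2]expn1 leq_exp2l. Qed.

Lemma leB k j : k <= 2 ^ j -> k <= B ^ j.
Proof. by move=> H; apply: leq_trans H _; case: j => // j; rewrite leq_exp2r ?B2. Qed.

Lemma leBM a b i j : a <= B ^ i -> b <= B ^ j -> a * b <= B ^ (i + j).
Proof. by move=> Ha Hb; rewrite expnD; apply: leq_mul. Qed.

(** All sizes are compared with [V] through powers of [B] with exponent below 16. *)
Lemma ltV a i : a <= B ^ i -> i < 16 -> a < V.
Proof.
move=> Ha Hi; rewrite V_E; apply: leq_ltn_trans Ha _; rewrite ltn_exp2l //; exact: B2.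
Qed.

Lemma nB1 : n <= B ^ 1. Proof. by rewrite expn1 ltnW. Qed.
Lemma BB1 : B <= B ^ 1. Proof. by rewrite expn1. Qed.

Lemma V256 : 256 <= V.
Proof. by apply: ltnW; apply: (@ltV _ 8) => //; apply: leB. Qed.

Lemma smallV k : k < 256 -> k < V.
Proof. by move=> H; apply: leq_trans H V256. Qed.

Lemma nV : n < V. Proof. exact: ltV nB1 _. Qed.
Lemma nnV : n * n < V. Proof. exact: ltV (leBM nB1 nB1) _. Qed.
Lemma B8V : 8 * B < V. Proof. exact: ltV (leBM (leB (isT : 8 <= 2 ^ 3)) BB1) _. Qed.
Lemma BBV : B * B < V. Proof. exact: ltV (leBM BB1 BB1) _. Qed.
Lemma n128 : 128 * n <= B ^ 8. Proof. exact: leBM (leB (isT : 128 <= 2 ^ 7)) nB1. Qed.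
Lemma n128V : 128 * n < V. Proof. exact: ltV n128 _. Qed.
Lemma nnn128V : n * n * (128 * n) < V. Proof. exact: ltV (leBM (leBM nB1 nB1) n128) _. Qed.
Lemma nnnV : n * n * n < V. Proof. exact: ltV (leBM (leBM nB1 nB1) nB1) _. Qed.
Lemma hV : h < V. Proof. by apply: (@ltV _ 1) => //; rewrite expn1 ltnW // ltn_expl. Qed.

Lemma idx_lt (u v : 'I_n) : u * n + v < n * n.
Proof. by apply: mixed_lt. Qed.

Lemma idxE (u v : 'I_n) : ((u * n + v) %/ n = u) * ((u * n + v) %% n = v).
Proof. exact: divmodE. Qed.

Lemma idx_ex x : x < n * n -> exists u v : 'I_n, x = u * n + v.
Proof.
move=> H; have n0 : 0 < n by case: (n) H.
have Hu : x %/ n < n by rewrite ltn_divLR.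
exists (Ordinal Hu), (Ordinal (ltn_pmod x n0)); exact: divn_eq.
Qed.

Lemma idxV (u v : 'I_n) : u * n + v < V. Proof. exact: ltn_trans (idx_lt u v) nnV. Qed.

Lemma idxm (u v : 'I_n) : (u * n + v) %% V = u * n + v.
Proof. by rewrite modn_small // idxV. Qed.

(** Everything the later phases need about the result of the initialisation. *)
Record consts s : Prop := Consts {
  c_inv : inv s;
  c_N : rg s rN = n;
  c_B : rg s rB = B;
  c_h : rg s rh = h;
  c_sz : rg s rsz = n * n;
  c_Mx : rg s rMx = B * B;
  c_st : rg s rst = 128 * n }.

Definition cregs := [:: rN; rB; rh; rsz; rMx; rst].

Lemma consts_ext s s' : consts s -> inv s' -> (forall r, r \in cregs -> rg s' r = rg s r) -> consts s'.
Proof. by case=> H1 H2 H3 H4 H5 H6 H7 Hi H; split; rewrite // H. Qed.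

Lemma consts_run c s : wfc c -> ~~ has (mem cregs) (wr c) -> consts s -> consts (run c s).
Proof.
move=> Hw Hr Hc; apply: (consts_ext Hc).
  by apply: inv_run => //; [apply: V256 | case: Hc].
move=> r Hcr; rewrite run_rg //; apply: contra Hr => Hm; by apply/hasP; exists r.
Qed.

Lemma consts_set s r v : v < V -> r \notin cregs -> consts s -> consts (setr s r v).
Proof.
move=> Hv Hr Hc; apply: (consts_ext Hc); first by apply: inv_setr => //; case: Hc.
by move=> q Hq /=; case: eqP => // Eq; rewrite -Eq Hq in Hr.
Qed.

Lemma pass2 a e s (u v : 'I_n) : consts s -> a != aTMP -> notmp e ->
  ar (run (Pass a rsz e) s) a (u * n + v) = stv V a (ev e (at_ (n * n) (u * n + v) s)).
Proof.
move=> C Ha He; rewrite run_pass //; [|exact: V256|exact: c_inv C].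
by rewrite (c_sz C) idx_lt.
Qed.

Lemma stv_small a v : v < V -> stv V a v = v.
Proof. by move=> H; rewrite /stv modn_small //; case: ifP. Qed.

(** * Distances by repeated min-plus squaring *)

Definition Dinv r s := forall u v : 'I_n,
  [/\ dist E u v <= ar s aD (u * n + v), ar s aD (u * n + v) <= n
   & dist E u v <= 2 ^ r -> ar s aD (u * n + v) = dist E u v].

Definition edges s := forall u v : 'I_n, ar s aE (u * n + v) = E u v.

Lemma distInit_spec s : consts s -> edges s -> Dinv 0 (run (Pass aD rsz distInitE) s).
Proof.
move=> C He u v; rewrite pass2 //= !(c_N C) !idxE idxm He.
have n0 : 0 < n := leq_ltn_trans (leq0n u) (ltn_ord u).
have Euv : (u == v :> nat) = (u == v) by [].
rewrite Euv; case: (u =P v) => [->|/eqP Huv] /=.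
  by rewrite stv_small ?dist_refl ?smallV.
case Huv' : (E u v) => /=.
  have D1 := dist_edge Huv Huv'; have := dist_le E u v.
  by rewrite stv_small ?D1 ?smallV.
rewrite stv_small ?nV // dist_le; split=> // D1; apply/eqP; rewrite eqn_leq dist_le andbT leqNgt.
apply/negP => Hlt; have := dist_wk Hlt; case Ed : (dist E u v) D1 Hlt => [|[|]] // _ Hlt.
  by have := dist_eq0 Ed => Ed'; rewrite Ed' eqxx in Huv.
by rewrite wk1 Huv'.
Qed.

Definition Rinv r z s := forall u v : 'I_n,
  [/\ dist E u v <= ar s aD (u * n + v), ar s aD (u * n + v) <= n,
   dist E u v <= 2 ^ r -> ar s aD (u * n + v) = dist E u v
   & forall x : 'I_n, x < z -> dist E u x <= 2 ^ r -> dist E x v <= 2 ^ r ->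
     ar s aD (u * n + v) <= dist E u x + dist E x v].

(** Updating in place is harmless: entries only decrease and never drop below the true distance, so
    those that are already exact stay so. *)
Lemma relax_step r (Z : 'I_n) s : consts s -> rg s rZ = Z -> Rinv r Z s ->
  Rinv r Z.+1 (run (Pass aD rsz relaxE) s).
Proof.
move=> C Ez HR u v; rewrite pass2 //= !(c_N C) Ez !idxE !idxm.
have [A1 A2 A3 A4] := HR u v; have [B1 B2' B3 _] := HR u Z; have [C1 C2 C3 _] := HR Z v.
set duv := ar s aD _ in A1 A2 A3 A4 *; set duz := ar s aD _ in B1 B2' B3 *.
set dzv := ar s aD _ in C1 C2 C3 *.
have T := dist_tri E u Z v.
pose m := minn duv (duz + dzv).
have -> : stv V aD (if (duz + dzv < duv) == 0 :> nat then duv else duz + dzv) = m.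
  rewrite /m; case: (ltnP (duz + dzv) duv) => H /=; rewrite stv_small //; try lia.
  + by apply: leq_ltn_trans nV; lia.
  + by apply: leq_ltn_trans nV; lia.
split.
- by rewrite /m leq_min A1; lia.
- by rewrite /m; lia.
- by move=> H; have := A3 H; rewrite /m; lia.
- move=> x; rewrite ltnS leq_eqVlt => /orP[/eqP Ex|Hx] H1 H2.
    have Ex' : x = Z by apply: val_inj.
    by rewrite Ex' in H1 H2 *; rewrite -(B3 H1) -(C3 H2) /m geq_minr.
  by apply: leq_trans (A4 x Hx H1 H2); rewrite /m geq_minl.
Qed.

Lemma Rinv0 r s : Dinv r s -> Rinv r 0 s.
Proof. by move=> H u v; have [] := H u v; split. Qed.

(** A distance in the range from [2 ^ r] to [2 ^ r.+1] is split at a vertex at distance [2 ^ r] from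
    the source; both parts were exact, and this midpoint has been tried. *)
Lemma RinvS r s : Rinv r n s -> Dinv r.+1 s.
Proof.
move=> H u v; have [A1 A2 A3 A4] := H u v; split=> // Hd.
case: (leqP (dist E u v) (2 ^ r)) => [/A3 //|Hr].
case: (ltnP (dist E u v) n) => Hn; last by apply/eqP; rewrite eqn_leq A1 andbT (leq_trans A2).
have Es : dist E u v = 2 ^ r + (dist E u v - 2 ^ r) by lia.
rewrite Es in Hn.
have [x [X1 X2]] := dist_mid Es Hn.
apply/eqP; rewrite eqn_leq A1 andbT.
have -> : dist E u v = dist E u x + dist E x v by rewrite X1 X2 -Es.
apply: A4; rewrite ?X1 ?X2 //.
by rewrite expnS in Hd; lia.
Qed.

Lemma Rinv_ext r z s s' : ar s' aD = ar s aD -> Rinv r z s -> Rinv r z s'.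
Proof. by move=> H HR u v; rewrite H; apply: HR. Qed.

Lemma pass_cost a e s : consts s -> cost (Pass a rsz e) s <= (esz e + 40) * (n * n).+1.
Proof.
move=> C; have := cost_pass V256 W_V a e (c_inv C) (isT : rsz != rX) (isT : rsz != rXB).
by rewrite (c_sz C).
Qed.

Definition Dok s := forall u v : 'I_n, ar s aD (u * n + v) = dist E u v.

Lemma relax_round r s : consts s -> Dinv r s ->
  let c := For rZ rZB (Var rN) (Pass aD rsz relaxE) in
  [/\ consts (run c s), Dinv r.+1 (run c s) & cost c s <= 5 + n * (200 * (n * n).+1)].
Proof.
move=> C HD c.
have [||[s' [-> [C' H]]] HC] := @for_spec V w (fun z s' => consts s' /\ Rinv r z s')
   (fun _ => 150 * (n * n).+1) rZ rZB (Var rN) (Pass aD rsz relaxE) s _ (c_N C) nV.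
- split; first by apply: consts_set => //; exact: nV.
  by apply: Rinv_ext (Rinv0 HD).
- move=> z s' Hz [C' HR]; have C2 : consts (setr s' rZ z).
    by apply: consts_set => //; apply: ltn_trans nV.
  split; last by apply: leq_trans (pass_cost _ _ C2) _; rewrite leq_mul2r orbT.
  split; first by apply: consts_run.
  by apply: (@relax_step r (Ordinal Hz)).
split.
- by apply: consts_set => //; exact: nV.
- exact: (RinvS (Rinv_ext _ H)).
- by apply: leq_trans HC _; rewrite sum_nat_const card_ord /=; lia.
Qed.

Lemma dist_spec s : consts s -> edges s ->
  [/\ consts (run distC s), Dok (run distC s) & cost distC s <= 400 * (h.+1 * (n.+1 * (n * n).+1))].
Proof.
move=> C He; rewrite /distC run_seq cost_seq.
set s1 := run (Pass aD rsz distInitE) s.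
have C1 : consts s1 by apply: consts_run.
have D0 := distInit_spec C He; rewrite -/s1 in D0.
have K0 := pass_cost aD distInitE C; move: (esz distInitE) (isT : esz distInitE <= 60) K0 => ? ? K0.
have [||[s' [-> [C' H]]] HC] := @for_spec V w (fun r s' => consts s' /\ Dinv r s')
   (fun _ => 5 + n * (200 * (n * n).+1)) rI rIB (Var rh)
   (For rZ rZB (Var rN) (Pass aD rsz relaxE)) s1 _ (c_h C1) hV.
- split; first by apply: consts_set => //; exact: hV.
  exact: D0.
- move=> r s' Hr [C' HR]; have C2 : consts (setr s' rI r).
    by apply: consts_set => //; apply: ltn_trans hV.
  have HR' : Dinv r (setr s' rI r) by [].
  by have [R1 R2 R3] := relax_round C2 HR'.
split.
- by apply: consts_set => //; exact: hV.
(* After [h] rounds all distances up to [2 ^ h] are exact, and no distance exceeds [n < 2 ^ h]. *)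
- move=> u v; have [_ _ H3] := H u v; apply: H3.
  by apply: leq_trans (dist_le _ _ _) (ltnW nB).
- apply: leq_trans (leq_add K0 HC) _; rewrite sum_nat_const card_ord /=.
  by set N := (n * n).+1; nia.
Qed.

Lemma run_arE c s a : a \notin wa c -> ar (run c s) a = ar s a.
Proof. exact: run_ar. Qed.

(** * Layer sizes and the twiddle table *)

Definition Lok s := forall u t : 'I_n, ar s aCnt (u * n + t) = layer E u t.

Definition layz z (u : 'I_n) t := \sum_(x < n | x < z) (dist E u x == t).

Lemma layzS (Z u : 'I_n) t : layz Z.+1 u t = layz Z u t + (dist E u Z == t).
Proof.
rewrite /layz (bigD1 Z) //= addnC; congr (_ + _); apply: eq_bigl => x.
by rewrite ltnS [RHS]ltn_neqAle andbC.
Qed.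

Lemma layz_le z u t : layz z u t <= n.
Proof.
rewrite /layz big_mkcond; apply: leq_trans (_ : \sum_(x < n) 1 <= _); last by rewrite sum1_card card_ord.
by apply: leq_sum => x _; case: ifP => // _; apply: leq_b1.
Qed.

Lemma layer_spec s : consts s -> Dok s -> (forall i, ar s aCnt i = 0) ->
  Lok (run layerC s) /\ cost layerC s <= 5 + n * (100 * (n * n).+1).
Proof.
move=> C HD H0.
have [||[s' [-> [C' _ H]]] HC] := @for_spec V w (fun z s' => [/\ consts s', Dok s' &
   forall u t : 'I_n, ar s' aCnt (u * n + t) = layz z u t])
   (fun _ => 70 * (n * n).+1) rZ rZB (Var rN) (Pass aCnt rsz cntE) s _ (c_N C) nV.
- split=> //; first by apply: consts_set => //; exact: nV.
  by move=> u t; rewrite /= H0 /layz big_pred0 // => x; rewrite ltn0.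
- move=> z s' Hz [C' HD' HL]; pose Z := Ordinal Hz; have C2 : consts (setr s' rZ z).
    by apply: consts_set => //; apply: ltn_trans nV.
  split; last by apply: leq_trans (pass_cost _ _ C2) _; rewrite leq_mul2r orbT.
  split; first by apply: consts_run.
    by move=> u v; rewrite run_arE //; exact: HD'.
  move=> u t; rewrite pass2 //= !(c_N C') !idxE idxm HL -[z]/(nat_of_ord Z) idxm HD' -layzS.
  by rewrite stv_small // (leq_ltn_trans (layz_le _ _ _) nV).
split.
- move=> u t; rewrite /= H /layz /layer; apply: eq_bigl => x; exact: ltn_ord.
- by apply: leq_trans HC _; rewrite sum_nat_const card_ord /=; lia.
Qed.

(** The twiddle table after [r] passes, in heap order: cell [2 ^ d + nu] belongs to node [nu] at
    depth [d] and holds its bit reversal scaled by [2 ^ (h.*2.+1 - d)]. The parent of a cell is its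
    half, and each pass completes one more depth. *)
Fixpoint gf r x := if r is r'.+1 then
  (if x < 2 then 0 else gf r' (x %/ 2) %/ 2 + (x %% 2) * (B * B)) else 0.

Lemma gfE d r nu : d <= h.*2.+1 -> d < r -> nu < 2 ^ d ->
  gf r (2 ^ d + nu) = rv d nu * 2 ^ (h.*2.+1 - d).
Proof.
elim: d r nu => [|d IH] [|r] nu Hd Hr Hnu //.
  by have -> : nu = 0 by rewrite expn0 in Hnu; lia.
have P : 0 < 2 ^ d by rewrite expn_gt0.
rewrite rvS [LHS]/= ifF; last by rewrite expnS; lia.
have Hnu2 : nu %/ 2 < 2 ^ d by rewrite ltn_divLR // mulnC -expnS.
have -> : (2 ^ d.+1 + nu) %/ 2 = 2 ^ d + nu %/ 2 by rewrite expnS mulnC divnMDl.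
have -> : (2 ^ d.+1 + nu) %% 2 = nu %% 2 by rewrite expnS mulnC modnMDl.
rewrite IH //; last exact: ltnW.
have -> : h.*2.+1 - d = (h.*2 - d).+1 by lia.
rewrite subSS expnS mulnCA mulKn // mulnDl; congr (_ + _).
rewrite -mulnA -!expnD; congr (_ * 2 ^ _); lia.
Qed.

Lemma gf_lt r x : gf r x <= 2 * (B * B).
Proof.
elim: r x => // r IH x /=; case: ifP => // _.
have : gf r (x %/ 2) %/ 2 <= B * B by rewrite -[X in _ <= X](mulKn _ (isT : 0 < 2)) leq_div2r.
have : x %% 2 <= 1 by have := ltn_pmod x (isT : 0 < 2); lia.
by set M := B * B; set q := _ %/ 2; nia.
Qed.

Lemma twiddle_spec s : consts s -> rg s rgs = 8 * B -> (forall i, ar s aG i = 0) ->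
  GK V (run twiddleC s) h.+1 /\ cost twiddleC s <= 20 + (h + 3) * (80 * (8 * B).+1).
Proof.
move=> C Hg H0.
have E3 : ev (Bin Add (Var rh) (Num 3)) s = h + 3 by rewrite /= (c_h C).
have h3V : h + 3 < V.
  apply: (@ltV _ 3) => //; rewrite !expnS expn0 muln1.
  have := ltn_expl h (isT : 1 < 2); have := B2; set b := B; nia.
have Mx2 : 2 * (B * B) < V by apply: ltV (leBM (leB (isT : 2 <= 2 ^ 1)) (leBM BB1 BB1)) _.
have [||[s' [-> [C' Hg' H]]] HC] := @for_spec V w (fun r s' => [/\ consts s', rg s' rgs = 8 * B &
   forall x, x < 8 * B -> ar s' aG x = gf r x])
   (fun _ => 70 * (8 * B).+1) rI rIB (Bin Add (Var rh) (Num 3)) (Pass aG rgs twiddleE) s _ E3 h3V.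
- split=> [||x _]; [exact: consts_set | exact: Hg | exact: H0].
- move=> r s' Hr [C' Hg' HG]; have C2 : consts (setr s' rI r).
    by apply: consts_set => //; apply: ltn_trans h3V.
  have [I2 _ _ _ _ _ _] := C2.
  split; last first.
    have := cost_pass V256 W_V aG twiddleE I2 (isT : rgs != rX) (isT : rgs != rXB).
    rewrite [rg _ rgs]Hg' => H; apply: leq_trans H _; rewrite leq_mul2r orbT //.
  split; first by apply: consts_run.
    by rewrite run_rg.
  move=> x Hx; rewrite run_pass //; last exact: V256.
  rewrite [rg _ rgs]Hg' Hx.
  have -> : ev twiddleE (at_ (8 * B) x (setr s' rI r)) = gf r.+1 x.
    rewrite /= (c_Mx C'); case: (ltnP x 2) => //= Hx2.
    have Hx' : x %/ 2 < 8 * B by apply: leq_ltn_trans Hx; apply: leq_div.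
    by rewrite modn_small ?HG // (ltn_trans Hx' B8V).
  by rewrite stv_small // (leq_ltn_trans (gf_lt _ _) Mx2).
split; last first.
  apply: leq_trans HC _; rewrite sum_nat_const card_ord; apply: leq_add => //.
  by rewrite leq_mul2l slack ?orbT.
move=> kp Hkp d g Hd; rewrite /= (c_Mx C').
set nu := g %% 2 ^ d; have Hnu : nu < 2 ^ d by rewrite ltn_mod expn_gt0.
have Hi : 2 * (2 ^ d + nu) < 8 * B.
  have : 2 ^ d <= 2 ^ h.+1 by rewrite leq_exp2l // (leq_trans Hd Hkp).
  by rewrite expnS => Hd2; apply: heap_bound Hd2 Hnu.
rewrite modn_small ?(ltn_trans Hi B8V) // H //.
have Hd1 : d <= h.+1 := leq_trans Hd Hkp.
have Hd2 : d.+1 <= h.*2.+1.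
  by rewrite ltnS -addnn; apply: leq_trans Hd1 _; rewrite -addn1 leq_add2l.
(* The cell read is that of the left child, at depth [d.+1], whose extra bit 0 leaves the reversal
   unchanged; [h + 3] passes reach depth [h.+2]. *)
rewrite mulnDr -expnS gfE //; first last.
- by rewrite expnS ltn_mul2l.
- by rewrite addn3 !ltnS (leq_trans Hd1).
rewrite rvS mulKn // modnMr mul0n addn0 /ttF -/nu.
have -> : B * B = 2 ^ h.*2 by rewrite -expnD addnn.
rewrite subSS.
have -> : rv d nu * 2 ^ (h.*2 - d) * 2 ^ kp = rv d nu * 2 ^ (kp - d) * 2 ^ h.*2.
  rewrite -!mulnA -!expnD; congr (_ * 2 ^ _); exact: sub_exch.
by rewrite mulnK // expn_gt0.
Qed.

(** * Digit arrays, and the state shared by the later phases *)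

Notation stride := (128 * n).

Lemma idx3_lt (u v : 'I_n) i : i < stride -> (u * n + v) * stride + i < n * n * stride.
Proof. move=> Hi; rewrite [n * n * stride]mulnC; apply: mixed_lt => //; exact: idx_lt. Qed.

Lemma idx3V (u v : 'I_n) i : i < stride -> (u * n + v) * stride + i < V.
Proof. by move=> Hi; apply: ltn_trans (idx3_lt u v Hi) nnn128V. Qed.

Lemma idx3m (u v : 'I_n) i : i < stride -> ((u * n + v) * stride + i) %% V = (u * n + v) * stride + i.
Proof. by move=> Hi; rewrite modn_small // idx3V. Qed.

(** Counts at distance 0 or 1 equal 1, a single digit; all other entries start at zero. *)
Definition Cinit s := forall (u v : 'I_n) i, i < stride ->
  ar s aC ((u * n + v) * stride + i) = (i == 0) && (dist E u v < 2).

Lemma digitInit_spec s : consts s -> rg s rN2 = n * n * stride -> Dok s ->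
  Cinit (run (Pass aC rN2 digitInitE) s).
Proof.
move=> C EN HD u v i Hi; rewrite run_pass //; [|exact: V256|exact: c_inv C].
rewrite EN idx3_lt //.
have -> : ev digitInitE (at_ (n * n * stride) ((u * n + v) * stride + i) s) = (i == 0) && (dist E u v < 2).
  by rewrite /= (c_st C) !divmodE // idxm HD; case: (i == 0).
by rewrite stv_small // smallV //; case: (_ && _).
Qed.

Record ready s : Prop := Ready {
  r_c : consts s; r_D : Dok s; r_L : Lok s; r_G : GK V s h.+1 }.

Lemma const_spec s : inv s -> rg s rN = n -> rg s rB = B -> rg s rh = h ->
  [/\ consts (run constC s), rg (run constC s) rgs = 8 * B & rg (run constC s) rN2 = n * n * stride].
Proof.
move=> Hs EN EB Eh.
have I : inv (run constC s) by apply: inv_run => //; exact: V256.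
suff H : [/\ rg (run constC s) rsz = n * n, rg (run constC s) rMx = B * B, rg (run constC s) rst = stride,
    rg (run constC s) rgs = 8 * B & rg (run constC s) rN2 = n * n * stride].
  have [H1 H2 H3 H4 H5] := H; split=> //; split; rewrite // run_rg //.
rewrite /constC !run_seq.
rewrite (@run_asg V w rsz _ _ (n * n)) => [||]; first last; [exact: nnV | by rewrite /= EN|].
rewrite (@run_asg V w rMx _ _ (B * B)) => [||]; first last; [exact: BBV | by rewrite /= EB|].
rewrite (@run_asg V w rst _ _ stride) => [||]; first last; [exact: n128V | by rewrite /= EN|].
rewrite (@run_asg V w rgs _ _ (8 * B)) => [||]; first last; [exact: B8V | by rewrite /= EB|].
by rewrite (@run_asg V w rN2 _ _ (n * n * stride)) => [||]; first last; [exact: nnn128V | |].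
Qed.

Hypothesis Bn : B <= 2 * n.+1.
Notation MM := (n.+1 ^ 3 * h.+1 ^ 5).

Lemma ready_ext s s' : consts s' -> (forall a, a \in [:: aD; aCnt; aG] -> ar s' a = ar s a) ->
  ready s -> ready s'.
Proof.
move=> C Ha [C0 D0 L0 G0]; split=> //.
- by move=> u v; rewrite Ha // D0.
- by move=> u v; rewrite Ha // L0.
- by move=> kp Hkp; apply: Gok_ext (G0 kp Hkp); rewrite ?Ha // (c_Mx C) (c_Mx C0).
Qed.

Lemma ready_run c s : wfc c -> ~~ has (mem cregs) (wr c) -> ~~ has (mem [:: aD; aCnt; aG]) (wa c) ->
  ready s -> ready (run c s).
Proof.
move=> Hw Hr Ha R; apply: (ready_ext _ _ R); first by apply: consts_run => //; case: R.
move=> a Hm; rewrite run_ar //; apply: contra Ha => Hx; by apply/hasP; exists a.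
Qed.

Lemma ready_set s r v : v < V -> r \notin cregs -> ready s -> ready (setr s r v).
Proof. by move=> Hv Hr R; apply: (ready_ext _ _ R) => //; apply: consts_set => //; case: R. Qed.

Lemma init_spec s : inv s -> rg s rN = n -> rg s rB = B -> rg s rh = h -> edges s ->
  (forall a i, a != aE -> ar s a i = 0) ->
  [/\ ready (run initC s), Cinit (run initC s) & cost initC s <= 20 * 1000 * MM].
Proof.
move=> Hs EN EB Eh He H0; rewrite /initC 4!run_seq 4!cost_seq.
have [C1 G1 N1] := const_spec Hs EN EB Eh; set s1 := run constC s in C1 G1 N1 *.
have K1 : cost constC s <= 200 by [].
have A1 a : ar s1 a = ar s a by rewrite run_ar.
have E1 : edges s1 by move=> u v; rewrite A1.
have [C2 D2 K2] := dist_spec C1 E1; set s2 := run distC s1 in C2 D2 K2 *.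
have Z2 i : ar s2 aCnt i = 0 by rewrite run_ar // A1 H0.
have [L3 K3] := layer_spec C2 D2 Z2; set s3 := run layerC s2 in L3 K3 *.
have C3 : consts s3 by apply: consts_run.
have D3 : Dok s3 by move=> u v; rewrite run_ar // D2.
have Z3 i : ar s3 aG i = 0 by rewrite !run_ar // H0.
have G3 : rg s3 rgs = 8 * B by rewrite /s3 run_rg // /s2 run_rg.
have [G4 K4] := twiddle_spec C3 G3 Z3; set s4 := run twiddleC s3 in G4 K4 *.
have C4 : consts s4 by apply: consts_run.
have R4 : ready s4.
  by split=> //; [move=> u v; rewrite run_ar // D3 | move=> u v; rewrite run_ar // L3].
have N4 : rg s4 rN2 = n * n * stride by rewrite /s4 run_rg // /s3 run_rg // /s2 run_rg.
split.
- by apply: (ready_run _ _ _ R4).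
- by apply: digitInit_spec => //; case: R4.
- have K5 := cost_pass V256 W_V aC digitInitE (c_inv C4) (isT : rN2 != rX) (isT : rN2 != rXB).
  rewrite N4 in K5; apply: leq_trans (init_cost_bound h Bn).
  by apply: leq_add K1 _; apply: leq_add K2 _; apply: leq_add K3 _; apply: leq_add K4 _.
Qed.

(** * Transform lengths and the choice of the thinnest layer *)

Record sizes d k lam : Prop := Sizes {
  sz_k0 : 0 < k;
  sz_lo : d <= 2 ^ k;
  sz_hi : 2 ^ k <= 2 * d;
  sz_kh : k <= h.+1;
  sz_lam : k.-1 < 2 ^ lam;
  sz_lamhi : 2 ^ lam <= 2 * k;
  sz_V : 2 ^ (k + lam) < V }.

Definition size_regs s k lam := [/\ rg s rK = k, rg s rLam = lam, rg s rNN = 2 ^ k,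
  rg s rsg = k - 1 + lam & rg s rgs = 2 ^ (k + lam)].

Lemma run_if e c1 c2 s (b : bool) : ev e s = b -> run (If e c1 c2) s = if b then run c1 s else run c2 s.
Proof. by move=> /= ->; case: b. Qed.

Lemma cost_if e c1 c2 s (b : bool) : ev e s = b ->
  cost (If e c1 c2) s = esz e + 1 + if b then cost c1 s + 1 else cost c2 s.
Proof. by move=> /= ->; case: b. Qed.

Lemma two_n_V : 2 * n < V. Proof. exact: ltV (leBM (leB (isT : 2 <= 2 ^ 1)) nB1) _. Qed.

Lemma two_d_V d : d < n -> 2 * d < V.
Proof. by move=> H; apply: leq_ltn_trans two_n_V; rewrite leq_mul2l ltnW. Qed.

(** The invariant is that either [k] is large enough or it exceeds the number of iterations; [d]
    iterations suffice because [d < 2 ^ d]. *)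
Lemma kloop_spec s d : inv s -> rg s rD = d -> 1 < d -> d < n -> rg s rK = 1 ->
  let c := For rI rIB (Var rD) (If (Bin Lt (Bin RShl (Num 1) (Var rK)) (Var rD)) (Asg rK (Bin Add (Var rK) (Num 1))) Skip) in
  (exists k, [/\ rg (run c s) rK = k, 0 < k, d <= 2 ^ k & 2 ^ k <= 2 * d]) /\ cost c s <= 5 + d * 30.
Proof.
move=> Hs Ed d1 dn Ek c; have dV : d < V by apply: ltn_trans nV.
pose Q i s' := [/\ inv s', rg s' rD = d & exists k, [/\ rg s' rK = k, 0 < k, 2 ^ k <= 2 * d & d <= 2 ^ k \/ i < k]].
have [||[s' [-> [_ _ [k [K1 K2 K3 K4]]]]] HC] := @for_spec V w Q (fun _ => 25) rI rIB (Var rD)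
   (If (Bin Lt (Bin RShl (Num 1) (Var rK)) (Var rD)) (Asg rK (Bin Add (Var rK) (Num 1))) Skip) s d Ed dV.
- split; [exact: inv_setr | by [] |]; exists 1; split=> //; last by right.
  by rewrite expn1; lia.
- move=> i s' Hi [I D [k [K1 K2 K3 K4]]].
  have k2V : 2 ^ k < V by apply: leq_ltn_trans K3 _; exact: two_d_V.
  have k2W : (1 * 2 ^ k) %% W = 2 ^ k by rewrite mul1n modn_small // (ltn_trans k2V (V_ltW V256 W_V)).
  have kV : k < V by apply: ltn_trans k2V; apply: ltn_expl.
  split; last by rewrite /=; case: ifP.
  rewrite [run _ _]/= K1 D k2W; case: (ltnP (2 ^ k) d) => H /=.
    have k1V : k + 1 < V.
      by rewrite addn1; apply: leq_ltn_trans k2V; apply: ltn_expl.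
    rewrite modn_small //; split.
    + by apply: inv_setr => //; apply: inv_setr => //; apply: ltn_trans dV.
    + by [].
    + exists (k + 1); split; rewrite // ?addn1 ?expnS //.
        by rewrite leq_mul2l ltnW.
      by right; case: K4 => K4; [rewrite ltnNge K4 in H|].
  split; [by apply: inv_setr => //; apply: ltn_trans dV| by [] |].
  by exists k; split=> //; left.
split; last by apply: leq_trans HC _; rewrite sum_nat_const card_ord /=; lia.
exists k; split=> //; case: K4 => // K4; apply: ltnW; apply: ltn_trans K4 _; exact: ltn_expl.
Qed.

Lemma lamloop_spec s k : inv s -> rg s rK = k -> 0 < k -> k < V -> rg s rLam = 0 ->
  let c := For rI rIB (Var rK) (If (Bin Lt (Num 0) (Bin Shr (Bin Sub (Var rK) (Num 1)) (Var rLam)))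
    (Asg rLam (Bin Add (Var rLam) (Num 1))) Skip) in
  (exists lam, [/\ rg (run c s) rLam = lam, k.-1 < 2 ^ lam & 2 ^ lam <= 2 * k]) /\ cost c s <= 5 + k * 30.
Proof.
move=> Hs Ek k0 kV El c.
pose Q i s' := [/\ inv s', rg s' rK = k & exists lam, [/\ rg s' rLam = lam, 2 ^ lam <= 2 * k & k.-1 < 2 ^ lam \/ i <= lam]].
have [||[s' [-> [_ _ [k' [K1 K2 K3]]]]] HC] := @for_spec V w Q (fun _ => 25) rI rIB (Var rK)
   (If (Bin Lt (Num 0) (Bin Shr (Bin Sub (Var rK) (Num 1)) (Var rLam)))
    (Asg rLam (Bin Add (Var rLam) (Num 1))) Skip) s k Ek kV.
- split; [exact: inv_setr | by [] |]; exists 0; split=> //; last by right.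
  by rewrite expn0; lia.
- move=> i s' Hi [I D [lam [K1 K2 K3]]].
  have lk : 2 ^ lam <= k.-1 -> lam + 1 < V.
    move=> H; rewrite addn1; apply: leq_ltn_trans kV; apply: leq_trans (leq_pred k).
    by apply: leq_trans H; apply: ltn_expl.
  split; last by rewrite /=; case: ifP.
  rewrite [run _ _]/= K1 D divn_gt0 ?expn_gt0 // subn1; case: (leqP (2 ^ lam) k.-1) => H /=.
    rewrite modn_small ?lk //; split.
    + by apply: inv_setr; [apply: inv_setr => //; apply: ltn_trans kV | apply: lk].
    + by [].
    + exists (lam + 1); split; rewrite // ?addn1 ?expnS //.
        by rewrite leq_mul2l; apply: leq_trans H (leq_pred k).
      by right; case: K3 => K3; [rewrite ltnNge H in K3|].
  split; [by apply: inv_setr => //; apply: ltn_trans kV| by [] |].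
  by exists lam; split=> //; left.
split; last by apply: leq_trans HC _; rewrite sum_nat_const card_ord /=; lia.
exists k'; split=> //; case: K3 => // K3; apply: leq_ltn_trans (leq_pred k) _.
by apply: leq_ltn_trans K3 _; apply: ltn_expl.
Qed.

Lemma sizes_spec s d : consts s -> rg s rD = d -> 1 < d -> d < n ->
  exists k lam, [/\ sizes d k lam, size_regs (run sizesC s) k lam & cost sizesC s <= 80 + n * 30 + (h + 1) * 30].
Proof.
move=> C Ed d1 dn; have Hs := c_inv C.
have V1 : 1 < V by apply: smallV.
rewrite /sizesC 6!run_seq 6!cost_seq.
rewrite (@run_asg V w rK _ _ 1) //.
set s1 := setr s rK 1; have I1 : inv s1 by apply: inv_setr.
have [[k [K1 K2 K3 K4]] HC1] := @kloop_spec s1 d I1 Ed d1 dn erefl.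
set c1 := For _ _ _ _ in K1 HC1 *; set s2 := run c1 s1 in K1 *.
have I2 : inv s2 by apply: inv_run => //; exact: V256.
have V0 : 0 < V by apply: ltnW.
have kh : k <= h.+1.
  rewrite -(@leq_exp2l 2) // expnS; apply: leq_trans K4 _; rewrite leq_mul2l ltnW //; exact: ltn_trans nB.
have k2V : 2 ^ k < V.
  by apply: leq_ltn_trans K4 _; exact: two_d_V.
have kV : k < V by apply: ltn_trans k2V; apply: ltn_expl.
rewrite (@run_asg V w rLam _ _ 0) //.
set s3 := setr s2 rLam 0; have I3 : inv s3 by apply: inv_setr.
have [[lam [L1 L2 L3]] HC2] := @lamloop_spec s3 k I3 K1 K2 kV erefl.
set c2 := For _ _ _ _ in L1 HC2 *; set s4 := run c2 s3 in L1 *.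
have K4' : rg s4 rK = k by rewrite /s4 run_rg.
have klV : 2 ^ (k + lam) < V.
  have H1 : 2 ^ k <= B ^ 2.
    apply: leq_trans K4 _; apply: (leBM (i := 1) (j := 1)); first exact: leB.
    by apply: ltnW; rewrite expn1; apply: ltn_trans nB.
  have H2 : 2 ^ lam <= B ^ 2.
    apply: leq_trans L3 _; apply: (leBM (i := 1) (j := 1)); first exact: leB.
    by rewrite expn1; apply: leq_trans kh _; apply: ltn_expl.
  by rewrite expnD; apply: ltV (leBM H1 H2) _.
have klV' : k + lam < V by apply: ltn_trans klV; apply: ltn_expl.
exists k, lam; split=> //.
- have M y : y < V -> (1 * y) %% W = y by move=> H; rewrite mul1n modn_small // (ltn_trans H (V_ltW V256 W_V)).
  rewrite (@run_asg V w rNN _ _ (2 ^ k)) //; last by rewrite -[RHS](M _ k2V) -K4'.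
  rewrite (@run_asg V w rsg _ _ (k - 1 + lam)) //; last first.
  + by apply: leq_ltn_trans klV'; rewrite leq_add2r leq_subr.
  + by rewrite -[in RHS]K4' -[in RHS]L1.
  rewrite (@run_asg V w rgs _ _ (2 ^ (k + lam))) //; last by rewrite -[RHS](M _ klV) -[in RHS]K4' -[in RHS]L1.
- have Hd : d * 30 <= n * 30 by rewrite leq_mul2r ltnW.
  have Hk : k * 30 <= (h + 1) * 30 by rewrite leq_mul2r addn1 kh.
  apply: (@leq_trans (2 + (cost c1 s1 + (2 + (cost c2 s3 + (4 + (10 + 6))))))) => //.
  exact: sizes_cost HC1 HC2 Hd Hk.
Qed.

Definition pickloop := For rI rIB (Var rD)
  (If (Bin Lt (Num 0) (Var rI))
    (If (Bin Lt (Rd aCnt (Bin Add (Bin Mul (Var rU) (Var rN)) (Var rI)))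
                (Rd aCnt (Bin Add (Bin Mul (Var rU) (Var rN)) (Var rT)))) (Asg rT (Var rI)) Skip) Skip).

Lemma pickloop_spec s (u : 'I_n) d : ready s -> rg s rD = d -> 1 < d -> d < n -> rg s rU = u -> rg s rT = 1 ->
  (exists t, [/\ rg (run pickloop s) rT = t, 0 < t < d & forall i, 0 < i < d -> layer E u t <= layer E u i])
  /\ cost pickloop s <= 5 + n * 60.
Proof.
move=> R Ed d1 dn Eu Et; have dV : d < V by apply: ltn_trans nV.
pose Q i s' := [/\ ready s', rg s' rU = u & exists t, [/\ rg s' rT = t, 0 < t < d & forall j, 0 < j < i -> layer E u t <= layer E u j]].
have [||[s' [Es [_ _ [t [T1 T2 T3]]]]] HC] := @for_spec V w Q (fun _ => 55) rI rIB (Var rD)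
  (If (Bin Lt (Num 0) (Var rI))
    (If (Bin Lt (Rd aCnt (Bin Add (Bin Mul (Var rU) (Var rN)) (Var rI)))
                (Rd aCnt (Bin Add (Bin Mul (Var rU) (Var rN)) (Var rT)))) (Asg rT (Var rI)) Skip) Skip) s d Ed dV.
- split; [exact: ready_set | by [] |]; exists 1; split=> //.
  by case=> [|j] //; rewrite ltn0 andbF.
- move=> i s' Hi [R' Eu' [t [T1 T2 T3]]].
  have iV : i < V by apply: ltn_trans dV.
  have R2 : ready (setr s' rI i) by apply: ready_set.
  split; last first.
    by rewrite /=; case: ifP => // _; case: ifP.
  have [t0 td] := andP T2.
  pose I := Ordinal (ltn_trans Hi dn); pose T := Ordinal (ltn_trans td dn).
  have LI : ar s' aCnt ((u * n + i) %% V) = layer E u i by rewrite -[i]/(nat_of_ord I) idxm (r_L R').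
  have LT : ar s' aCnt ((u * n + t) %% V) = layer E u t by rewrite -[t]/(nat_of_ord T) idxm (r_L R').
  split.
  + exact: ready_run R2.
  + by rewrite run_rg.
  rewrite [run _ _]/= (c_N (r_c R')) Eu' T1 LI LT.
  case: (ltnP 0 i) => /= Hi0; last first.
    exists t; split=> // j /andP[Hj1 Hj2]; apply: T3; rewrite Hj1; lia.
  case: (ltnP (layer E u i) (layer E u t)) => /= H.
    exists i; split; [by rewrite modn_small | by rewrite Hi0 |].
    move=> j /andP[Hj1]; rewrite ltnS leq_eqVlt => /orP[/eqP -> //|Hj].
    by apply: ltnW; apply: leq_trans H _; apply: T3; rewrite Hj1.
  exists t; split=> // j /andP[Hj1]; rewrite ltnS leq_eqVlt => /orP[/eqP -> //|Hj].
  by apply: T3; rewrite Hj1.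
split; first by exists t; rewrite /pickloop Es.
apply: leq_trans HC _; rewrite sum_nat_const card_ord.
by apply: leq_add => //; apply: leq_mul => //; apply: ltnW.
Qed.

Lemma pick_spec s (u v : 'I_n) d : ready s -> rg s rP = u * n + v -> rg s rD = d -> 1 < d -> d < n ->
  [/\ ready (run pickC s), rg (run pickC s) rU = u, rg (run pickC s) rV = v,
   exists t, [/\ rg (run pickC s) rT = t, 0 < t < d & forall i, 0 < i < d -> layer E u t <= layer E u i]
   & cost pickC s <= 40 + n * 60].
Proof.
move=> R EP Ed d1 dn.
have uV : u < V by apply: ltn_trans nV.
have vV : v < V by apply: ltn_trans nV.
have V1 : 1 < V by apply: smallV.
have V0 : 0 < V by apply: ltnW.
have EN := c_N (r_c R).
rewrite /pickC 3!run_seq 3!cost_seq -/pickloop.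
rewrite (@run_asg V w rU _ s u) //; last by rewrite /= EP EN idxE.
rewrite (@run_asg V w rV _ _ v) //; last by rewrite /= EP EN idxE.
rewrite (@run_asg V w rT _ _ 1) //.
set s1 := setr _ rT 1.
have R1 : ready s1 by do 3 apply: ready_set => //.
have [T HC] := @pickloop_spec s1 u d R1 Ed d1 dn erefl erefl.
split.
- exact: ready_run R1.
- by rewrite run_rg.
- by rewrite run_rg.
- exact: T.
- apply: (@leq_trans (4 + (4 + (2 + cost pickloop s1)))) => //.
  exact: pick_cost HC.
Qed.

(** * Summing the products over the midpoints of one pair *)

Definition Cdone d s := forall (u v : 'I_n) i, i < stride -> dist E u v < d ->
  ar s aC ((u * n + v) * stride + i) = dig B (cnt E u v) i.

Lemma pow_st d k lam : sizes d k lam -> d < n -> 2 ^ k <= stride.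
Proof.
case=> _ _ H _ _ _ _ dn; apply: leq_trans H _; apply: leq_mul => //; exact: ltnW.
Qed.

Lemma load_spec s a e d k lam (x y : 'I_n) : ready s -> sizes d k lam -> d < n -> rg s rNN = 2 ^ k ->
  a \in [:: aX; aY] -> notmp e -> dist E x y < d -> Cdone d s ->
  (forall i, i < 2 ^ k -> ev e (at_ (2 ^ k) i s) = ar s aC (((x * n + y) * stride + i) %% V)) ->
  eqon (2 ^ k) (ar (run (Pass a rNN e) s) a) (dig B (cnt E x y)).
Proof.
move=> R Z dn EN Ha He Hd HC Hev i Hi.
rewrite run_pass //; [|exact: V256|exact: c_inv (r_c R)|by move: Ha; rewrite !inE => /orP[]/eqP ->].
have Hst : i < stride by apply: leq_trans (pow_st Z dn).
rewrite EN Hi Hev // idx3m // HC // /stv.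
by move: Ha; rewrite !inE => /orP[]/eqP ->.
Qed.

Definition accterm k lam f g x :=
  if x %% 2 == 0 then base0 W (sh x (FW W k lam f)) (sh x (FW W k lam g))
  else base1 W (sh (x - 1) (FW W k lam f)) (sh (x - 1) (FW W k lam g)).

Notation FC k lam := (10 + lam * ((k + 1) * (2010 * 2 ^ (k + lam)))).

Lemma acc_spec s k lam f g : ready s -> rg s rgs = 2 ^ (k + lam) -> 0 < k -> 2 ^ (k + lam) < V ->
  eqon (2 ^ (k + lam)) (ar s aX) (FW W k lam f) -> eqon (2 ^ (k + lam)) (ar s aY) (FW W k lam g) ->
  eqon (2 ^ (k + lam)) (ar (run (Pass aAcc rgs accE) s) aAcc) (fun x => addW W (ar s aAcc x) (accterm k lam f g x)).
Proof.
move=> R Es k0 SV Hf Hg x Hx; set S := 2 ^ (k + lam) in Es SV Hf Hg Hx.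
rewrite run_pass //; [|exact: V256|exact: c_inv (r_c R)].
have xV : x < V by apply: ltn_trans SV.
rewrite Es Hx /stv /= !(modn_small xV).
have B' y : y %% W < W by rewrite ltn_mod expn_gt0.
rewrite /accterm /base0 /base1 /sh; case Ex : (x %% 2 == 0) => /=.
  have Hx1 : x + 1 < S.
    have ES : S = 2 * 2 ^ (k + lam).-1 by rewrite -expnS prednK ?addn_gt0 ?k0.
    by rewrite ES in Hx *; move/eqP: Ex; move: Hx; exact: even_succ_lt.
  rewrite (modn_small (ltn_trans Hx1 SV)) !Hf // !Hg // !addn0 subWE //.
have x0 : 0 < x by case: (x) Ex.
have Hx1 : x - 1 < S by apply: leq_ltn_trans Hx; apply: leq_subr.
rewrite (modn_small (ltn_trans Hx1 SV)) !Hf // !Hg // !addn0 subnK //.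
Qed.

Lemma GK_le s k k' : k' <= k -> GK V s k -> GK V s k'.
Proof. by move=> H G kp Hk; apply: G; apply: leq_trans Hk H. Qed.

Lemma size_regs_ext s s' k lam : size_regs s k lam -> (forall r, r \in [:: rK; rLam; rNN; rsg; rgs] -> rg s' r = rg s r) ->
  size_regs s' k lam.
Proof. by case=> H1 H2 H3 H4 H5 H; split; rewrite H. Qed.

Lemma size_regs_run c s k lam : ~~ has (mem [:: rK; rLam; rNN; rsg; rgs]) (wr c) ->
  size_regs s k lam -> size_regs (run c s) k lam.
Proof.
move=> Hc H; apply: size_regs_ext H _ => r Hr; rewrite run_rg //.
by apply: contra Hc => Hx; apply/hasP; exists r.
Qed.

Lemma size_regs_set r v s k lam : r \notin [:: rK; rLam; rNN; rsg; rgs] ->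
  size_regs s k lam -> size_regs (setr s r v) k lam.
Proof.
by move=> Hr H; apply: size_regs_ext H _ => q Hq /=; case: eqP => // Eq; rewrite -Eq Hq in Hr.
Qed.

(** Handles one midpoint: both factors are transformed and their products added to the accumulator,
    which stays in the transformed domain. *)
Lemma mac_spec s d k lam (u v z : 'I_n) : ready s -> sizes d k lam -> size_regs s k lam -> d < n ->
  rg s rU = u -> rg s rV = v -> rg s rZ = z -> dist E u z < d -> dist E z v < d -> Cdone d s ->
  eqon (2 ^ (k + lam)) (ar (run macC s) aAcc)
    (fun x => addW W (ar s aAcc x) (accterm k lam (dig B (cnt E u z)) (dig B (cnt E z v)) x)) /\
  cost macC s <= 2 * FC k lam + 500 * 2 ^ (k + lam).
Proof.
move=> R Z SR dn EU EV EZ D1 D2 HC.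
have [k0 _ _ kh _ _ SV] := Z.
have P0 : 0 < 2 ^ k by rewrite expn_gt0.
have PS : 2 ^ k <= 2 ^ (k + lam) by rewrite leq_exp2l // leq_addr.
rewrite /macC 4!run_seq 4!cost_seq.
set e1 := Rd aC (Bin Add (Bin Mul (Bin Add (Bin Mul (Var rU) (Var rN)) (Var rZ)) (Var rst)) (Var rX)).
set e2 := Rd aC (Bin Add (Bin Mul (Bin Add (Bin Mul (Var rZ) (Var rN)) (Var rV)) (Var rst)) (Var rX)).
set c1 := Pass aX rNN e1; set c2 := Pass aY rNN e2.
have EN := c_N (r_c R); have Est := c_st (r_c R).
have [_ _ ENN _ _] := SR.
have L1 : eqon (2 ^ k) (ar (run c1 s) aX) (dig B (cnt E u z)).
  by apply: (load_spec R Z dn ENN) => // i Hi; rewrite /= EU EN EZ Est.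
have K1 := cost_pass V256 W_V aX e1 (c_inv (r_c R)) (isT : rNN != rX) (isT : rNN != rXB).
rewrite ENN -/c1 in K1.
set s1 := run c1 s in L1 *.
have R1 : ready s1 by apply: ready_run.
have SR1 : size_regs s1 k lam by apply: size_regs_run.
have [EK1 EL1 ENN1 _ _] := SR1.
have C1 : Cdone d s1 by move=> a b i Hi Hd; rewrite run_ar // HC.
have L2 : eqon (2 ^ k) (ar (run c2 s1) aY) (dig B (cnt E z v)).
  apply: (load_spec R1 Z dn ENN1) => // i Hi.
  have EZ1 : rg s1 rZ = z by rewrite run_rg.
  have EV1 : rg s1 rV = v by rewrite run_rg.
  by clearbody s1; rewrite /= EZ1 EV1 (c_N (r_c R1)) (c_st (r_c R1)).
have K2 := cost_pass V256 W_V aY e2 (c_inv (r_c R1)) (isT : rNN != rX) (isT : rNN != rXB).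
rewrite ENN1 -/c2 in K2.
set s2 := run c2 s1 in L2 *.
have R2 : ready s2 by apply: ready_run.
have SR2 : size_regs s2 k lam by apply: size_regs_run.
have [EK2 EL2 _ _ _] := SR2.
have L1' : eqon (2 ^ k) (ar s2 aX) (dig B (cnt E u z)) by move=> i Hi; rewrite run_ar // L1.
have [F1 KF1] := fwd_spec V256 W_V (c_inv (r_c R2)) (isT : aX \in [:: aX; aAcc; aY]) EK2 k0 EL2 SV (GK_le kh (r_G R2)) L1'.
set s3 := run (fwdC aX) s2 in F1 *.
have R3 : ready s3 by apply: ready_run.
have SR3 : size_regs s3 k lam by apply: size_regs_run.
have [EK3 EL3 _ _ _] := SR3.
have L3 : eqon (2 ^ k) (ar s3 aY) (dig B (cnt E z v)) by move=> i Hi; rewrite run_ar // L2.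
have [F2 KF2] := fwd_spec V256 W_V (c_inv (r_c R3)) (isT : aY \in [:: aX; aAcc; aY]) EK3 k0 EL3 SV (GK_le kh (r_G R3)) L3.
set s4 := run (fwdC aY) s3 in F2 *.
have R4 : ready s4 by apply: ready_run.
have [_ _ _ _ ES4] : size_regs s4 k lam by apply: size_regs_run.
have F1' : eqon (2 ^ (k + lam)) (ar s4 aX) (FW W k lam (dig B (cnt E u z))) by move=> i Hi; rewrite run_ar // F1.
have A4 : ar s4 aAcc = ar s aAcc by rewrite /s4 run_ar // /s3 run_ar // /s2 run_ar // /s1 run_ar.
have K5 := cost_pass V256 W_V aAcc accE (c_inv (r_c R4)) (isT : rgs != rX) (isT : rgs != rXB).
rewrite ES4 in K5.
split; first by rewrite -A4; apply: acc_spec.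
exact: (mac_cost P0 PS K1 K2 KF1 KF2 K5).
Qed.

Lemma macC_frame : [/\ wfc macC, ~~ has (mem (cregs ++ [:: rK; rLam; rNN; rsg; rgs; rU; rV; rT; rD; rP])) (wr macC),
  ~~ has (mem [:: aD; aCnt; aG]) (wa macC) & aC \notin wa macC].
Proof. by []. Qed.

Local Opaque macC.

Section Pair.
Variables (u v : 'I_n) (d t k lam : nat).
Hypothesis Z : sizes d k lam.
Hypothesis dn : d < n.
Hypothesis td : 0 < t < d.
Hypothesis Huv : dist E u v = d.

Definition mids h : bool :=
  if insub h is Some x then (dist E u x == t) && (dist E x v == d - t) else false.

(** Zero outside the midpoints, so that the support bounds hold for every index, as [levels_conv]
    requires. *)
Definition Xs h : nat -> nat :=
  if mids h then (if insub h is Some x then dig B (cnt E u x) else fun=> 0) else fun=> 0.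
Definition Ys h : nat -> nat :=
  if mids h then (if insub h is Some x then dig B (cnt E x v) else fun=> 0) else fun=> 0.

Lemma midsE (x : 'I_n) : mids x = (dist E u x == t) && (dist E x v == d - t).
Proof. by rewrite /mids valK. Qed.

Definition ms z := [seq h <- iota 0 z | mids h].

Lemma msS z : ms z.+1 = ms z ++ (if mids z then [:: z] else [::]).
Proof. by rewrite /ms -addn1 iotaD filter_cat /= add0n. Qed.

Definition accsum z x := (\sum_(h <- ms z) accterm k lam (Xs h) (Ys h) x) %% W.

Definition pairst s := [/\ ready s, size_regs s k lam &
  [/\ rg s rU = u, rg s rV = v, rg s rT = t, rg s rD = d & rg s rP = u * n + v]].

Definition pregs := [:: rK; rLam; rNN; rsg; rgs; rU; rV; rT; rD; rP].

Lemma pairst_set s r x : x < V -> r \notin cregs ++ pregs -> pairst s -> pairst (setr s r x).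
Proof.
rewrite mem_cat negb_or => Hx /andP[H1 H2] [R S [E1 E2 E3 E4 E5]]; split.
- exact: ready_set.
- by apply: size_regs_set => //; move: H2; apply: contra; rewrite !inE; lia.
- have ne q : q \in pregs -> (q == r) = false.
    by move=> Hq; apply/eqP => Eq; rewrite -Eq Hq in H2.
  by rewrite /= !ne.
Qed.

Lemma pairst_run c s : wfc c -> ~~ has (mem (cregs ++ pregs)) (wr c) -> ~~ has (mem [:: aD; aCnt; aG]) (wa c) ->
  pairst s -> pairst (run c s).
Proof.
move=> Hw Hr Ha [R S [E1 E2 E3 E4 E5]].
have H q : q \in cregs ++ pregs -> q \notin wr c.
  by move=> Hq; apply: contra Hr => Hx; apply/hasP; exists q.
split.
- apply: ready_run => //; apply/hasPn => q Hq; apply/negP => Hm.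
  by have := H q; rewrite mem_cat (Hm : q \in cregs) Hq => /(_ isT).
- apply: size_regs_run => //; apply/hasPn => q Hq; apply/negP => Hm.
  have Hp : q \in pregs by move: Hm; rewrite !inE /=; lia.
  by have := H q; rewrite mem_cat Hp orbT Hq => /(_ isT).
- by split; rewrite run_rg // H.
Qed.

Definition sumloop := For rZ rZB (Var rN)
    (If (Bin Eq (Rd aD (Bin Add (Bin Mul (Var rU) (Var rN)) (Var rZ))) (Var rT))
      (If (Bin Eq (Rd aD (Bin Add (Bin Mul (Var rZ) (Var rN)) (Var rV))) (Bin Sub (Var rD) (Var rT))) macC Skip) Skip).

Notation MC := (2 * FC k lam + 500 * 2 ^ (k + lam)).

(** Only midpoints pay for transforms, hence the factor [mids z] in the cost. *)
Lemma sumloop_spec s : pairst s -> Cdone d s -> eqon (2 ^ (k + lam)) (ar s aAcc) (fun=> 0) ->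
  [/\ pairst (run sumloop s), eqon (2 ^ (k + lam)) (ar (run sumloop s) aAcc) (accsum n) &
   cost sumloop s <= 5 + \sum_(z < n) (65 + mids z * MC)].
Proof.
move=> PS HC H0; have [R _ _] := PS.
have W0 : 0 < W by rewrite expn_gt0.
have [||[s' [Es [P' _ HA]]] HK] := @for_spec V w (fun z s' => [/\ pairst s', ar s' aC = ar s aC &
   eqon (2 ^ (k + lam)) (ar s' aAcc) (accsum z)]) (fun z => 60 + mids z * MC) rZ rZB (Var rN)
   (If (Bin Eq (Rd aD (Bin Add (Bin Mul (Var rU) (Var rN)) (Var rZ))) (Var rT))
      (If (Bin Eq (Rd aD (Bin Add (Bin Mul (Var rZ) (Var rN)) (Var rV))) (Bin Sub (Var rD) (Var rT))) macC Skip) Skip)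
   s n (c_N (r_c R)) nV.
- split=> //; first by apply: pairst_set => //; exact: nV.
  by move=> x Hx; rewrite /= H0 // /accsum big_nil mod0n.
- move=> z s' Hz [P' EC HA]; pose x := Ordinal Hz.
  have zV : z < V by apply: ltn_trans nV.
  have P2 : pairst (setr s' rZ z) by apply: pairst_set.
  have [R2 S2 [U2 V2 T2 D2 Q2]] := P2.
  have Em : mids z = (dist E u x == t) && (dist E x v == d - t) by rewrite -midsE.
  have Ev1 : ev (Bin Eq (Rd aD (Bin Add (Bin Mul (Var rU) (Var rN)) (Var rZ))) (Var rT)) (setr s' rZ z) = (dist E u x == t).
    by move: (r_D R2) U2 T2 (c_N (r_c R2)) => HD /= -> -> ->; rewrite -[z]/(nat_of_ord x) idxm HD.
  have Ev2 : ev (Bin Eq (Rd aD (Bin Add (Bin Mul (Var rZ) (Var rN)) (Var rV))) (Bin Sub (Var rD) (Var rT))) (setr s' rZ z)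
     = (dist E x v == d - t).
    by move: (r_D R2) V2 T2 D2 (c_N (r_c R2)) => HD /= -> -> -> ->; rewrite -[z]/(nat_of_ord x) idxm HD.
  set body := If _ _ _.
  rewrite /body (run_if _ _ Ev1) (cost_if _ _ Ev1) (run_if _ _ Ev2) (cost_if _ _ Ev2).
  rewrite Em; case E1 : (dist E u x == t) => /=; last first.
    split; last by rewrite addn0.
    split=> // y Hy; by rewrite /accsum msS Em E1 /= cats0 HA.
  case E2 : (dist E x v == d - t) => /=; last first.
    split; last by rewrite addn0.
    split=> // y Hy; by rewrite /accsum msS Em E1 E2 /= cats0 HA.
  have [t0 td'] := andP td.
  have D1 : dist E u x < d by rewrite (eqP E1).
  have D2' : dist E x v < d by rewrite (eqP E2); lia.
  have HC2 : Cdone d (setr s' rZ z) by move=> a b i Hi Hd; rewrite /= EC HC.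
  have [M1 M2] := mac_spec R2 Z S2 dn U2 V2 (erefl : rg (setr s' rZ z) rZ = x) D1 D2' HC2.
  split; last by rewrite mul1n; move: M2; set q := cost _ _; set F := _ + _ * _; exact: sum_cost.
  split.
  + by have [F1 F2 F3 F4] := macC_frame; apply: pairst_run P2.
  + by have [F1 F2 F3 F4] := macC_frame; rewrite run_ar.
  + move=> y Hy; rewrite M1 //= HA // /accsum msS Em E1 E2 /= big_cat big_seq1 /= /addW modnDml.
    have -> : accterm k lam (Xs z) (Ys z) y = accterm k lam (dig B (cnt E u x)) (dig B (cnt E x v)) y.
      by rewrite /Xs /Ys Em E1 E2 /= -[z]/(nat_of_ord x) valK.
    by [].
rewrite -/sumloop in Es HK; rewrite Es; split=> //.
- by apply: pairst_set => //; exact: nV.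
- apply: leq_trans HK _; rewrite leq_add2l; apply: leq_sum => i _.
  by rewrite -addnA [_ + 5]addnC addnA.
Qed.

(** The count is at most [n ^ dist] with [n < B]. At distance 0 it is 1, which still takes one
    digit; hence the condition on [m]. *)
Lemma cnt_lt (x y : 'I_n) m : dist E x y <= m -> 0 < m -> cnt E x y < B ^ m.
Proof.
move=> H m0; case Ed : (dist E x y) => [|e].
  have -> : cnt E x y = 1.
    by apply: cnt_le1; rewrite Ed //; exact: leq_ltn_trans (leq0n x) (ltn_ord x).
  by apply: leq_trans B2 _; rewrite -{1}[B]expn1 leq_pexp2l ?expn_gt0.
apply: leq_ltn_trans (cnt_bound _ _ _) _; rewrite Ed.
apply: (@leq_trans (B ^ e.+1)); first by rewrite ltn_exp2r.
by rewrite leq_pexp2l ?expn_gt0 // -Ed.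
Qed.

Lemma Xs_support g i : t <= i -> Xs g i = 0.
Proof.
rewrite /Xs /mids; case: insubP => // x _ _; case: (dist E u x =P t) => //= Et Hi.
case: eqP => // _; have [t0 _] := andP td; apply: (dig_small _ (cnt_lt _ t0)) => //; first by rewrite expn_gt0.
by rewrite Et.
Qed.

Lemma Ys_support g i : d - t <= i -> Ys g i = 0.
Proof.
rewrite /Ys /mids; case: insubP => // x _ _; case: eqP => //= _; case: (dist E x v =P d - t) => //= Et Hi.
have [_ td'] := andP td; have dt0 : 0 < d - t by rewrite subn_gt0.
apply: (dig_small _ (cnt_lt _ dt0)) => //; first by rewrite expn_gt0.
by rewrite Et.
Qed.

Definition zc i := if i < d then \sum_(g <- ms n) conv (Xs g) (Ys g) i else 0.

(** Evaluated at [B], the convolution of a midpoint becomes the product of its two counts by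
    [conv_value], and [cnt_split] adds these up to the count of the pair. *)
Lemma zc_value : \sum_(i < d) zc i * B ^ i = cnt E u v.
Proof.
have [t0 td'] := andP td; have dt0 : 0 < d - t by rewrite subn_gt0.
have Ed : t + (d - t) = d by rewrite subnKC // ltnW.
have B0 : 0 < B by rewrite expn_gt0.
rewrite (eq_bigr (fun i : 'I_d => \sum_(g <- ms n) conv (Xs g) (Ys g) i * B ^ i)) => [|i _]; last first.
  by rewrite /zc ltn_ord big_distrl.
rewrite exchange_big /=.
rewrite (eq_bigr (fun g => (\sum_(i < t) Xs g i * B ^ i) * (\sum_(j < d - t) Ys g j * B ^ j))) => [|g _]; last first.
  apply: conv_value; [by rewrite Ed | exact: Xs_support | exact: Ys_support].
rewrite (@cnt_split n E u v t (d - t)) ?Ed // big_filter -[n in iota 0 n]subn0 -/(index_iota 0 n) big_mkord.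
apply: eq_big => x; rewrite midsE // => /andP[/eqP E1 /eqP E2].
rewrite /Xs /Ys midsE E1 E2 !eqxx /= valK !sum_dig //.
by rewrite !modn_small // cnt_lt ?E1 ?E2.
Qed.

Lemma dig_le x i : dig B x i <= B.
Proof. by apply: ltnW; rewrite ltn_mod expn_gt0. Qed.

(** At most [n] midpoints, at most [d] digit products for each, every product at most [B ^ 2]; both
    [n] and [d] are below [B]. *)
Lemma zc_le i : zc i <= B ^ 4.
Proof.
rewrite /zc; case: ifP => // Hi.
have HX g j : Xs g j <= B.
  by rewrite /Xs; case: (mids g) => //; case: insub => // x; apply: dig_le.
have HY g j : Ys g j <= B.
  by rewrite /Ys; case: (mids g) => //; case: insub => // x; apply: dig_le.
have HC g : conv (Xs g) (Ys g) i <= B * (B * B).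
  rewrite /conv; apply: leq_trans (_ : \sum_(j < i.+1) B * B <= _).
    by apply: leq_sum => j _; apply: leq_mul.
  rewrite sum_nat_const card_ord leq_mul2r; apply/orP; right.
  by apply: leq_trans (ltnW nB); apply: ltn_trans Hi dn.
apply: leq_trans (_ : \sum_(g <- ms n) B * (B * B) <= _); first by apply: leq_sum.
rewrite big_const_seq iter_addn_0 count_predT mulnC.
have -> : B ^ 4 = B * (B * (B * B)) by rewrite !expnS expn0 muln1.
rewrite leq_mul2r; apply/orP; right; apply: leq_trans (ltnW nB).
by rewrite size_filter -[X in _ <= X](size_iota 0 n) count_size.
Qed.

Lemma acc_result i : i < d -> IV W k lam lam (accsum n) i = 2 ^ (k - 1 + lam) * zc i %[mod W].
Proof.
move=> Hi; have [k0 lo _ _ Hl _ _] := Z.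
have W1 : 1 < W by apply: leq_ltn_trans (V_ltW V256 W_V); apply: ltnW; apply: smallV.
have [t0 td'] := andP td.
rewrite /zc Hi; apply: (levels_conv (ltnW W1) k0 W1 Hl _ Xs_support Ys_support).
- by rewrite subnKC ?(ltnW td') //; apply: leq_trans lo _.
- move=> q Hq; rewrite /accsum !modn_mod; split; congr (_ %% _); apply: eq_bigr => g _; rewrite /accterm.
    by rewrite mulnC modnMl.
  by rewrite mulnC modnMDl /= addnK mulnC.
- by apply: leq_trans Hi lo.
Qed.

Definition carryloop := For rI rIB (Var rD)
    (Seq (Asg rq (Bin RAdd (Bin Shr (Rd aAcc (Var rI)) (Var rsg)) (Var rcar)))
     (Seq (Sto aC (Bin Add (Bin Mul (Var rP) (Var rst)) (Var rI)) (Bin Mod (Var rq) (Var rB)))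
     (Asg rcar (Bin Div (Var rq) (Var rB))))).

Lemma carryloop_spec s : pairst s -> rg s rcar = 0 -> (forall i, i < d -> ar s aAcc i = 2 ^ (k - 1 + lam) * zc i) ->
  [/\ pairst (run carryloop s),
   forall x, ar (run carryloop s) aC x = if (u * n + v) * stride <= x < (u * n + v) * stride + d
      then dig B (cnt E u v) (x - (u * n + v) * stride) else ar s aC x
   & cost carryloop s <= 5 + n * 60].
Proof.
move=> PS E0 HA; have [R S [_ _ _ ED _]] := PS.
have dV : d < V by apply: ltn_trans nV.
set base := (u * n + v) * stride.
have B0 : 0 < B by rewrite expn_gt0.
have B1 : 1 < B := B2.
have B5V : 2 * B ^ 4 < V by apply: ltV (leBM (leB (isT : 2 <= 2 ^ 1)) (leqnn (B ^ 4))) _.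
have dst : d <= stride by apply: leq_trans (ltnW dn) _; apply: leq_pmull.
have [||[s' [Es [P' _ _ HC]]] HK] := @for_spec V w (fun i s' => [/\ pairst s', rg s' rcar = carry B zc i, ar s' aAcc = ar s aAcc &
   forall x, ar s' aC x = if base <= x < base + i then dig B (cnt E u v) (x - base) else ar s aC x])
   (fun _ => 55) rI rIB (Var rD) (Seq (Asg rq (Bin RAdd (Bin Shr (Rd aAcc (Var rI)) (Var rsg)) (Var rcar)))
     (Seq (Sto aC (Bin Add (Bin Mul (Var rP) (Var rst)) (Var rI)) (Bin Mod (Var rq) (Var rB)))
     (Asg rcar (Bin Div (Var rq) (Var rB))))) s d ED dV.
- split=> //; first exact: pairst_set.
  by move=> x; rewrite addn0 ifF //; apply/negP => /andP[H1 H2]; move: (leq_ltn_trans H1 H2); rewrite ltnn.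
- move=> i s' Hi [P' Ec EA HC].
  have iV : i < V by apply: ltn_trans dV.
  have P2 : pairst (setr s' rI i) by apply: pairst_set.
  have [R2 [_ _ _ Esg _] [_ _ _ _ EP]] := P2.
  have cb : carry B zc i <= B ^ 4 by apply: carry_le => // j; apply: zc_le.
  have zb := zc_le i.
  (* Coefficient and carry are at most [B ^ 4] each, so the register assignment reduces nothing. *)
  have q5 : zc i + carry B zc i < V by apply: leq_ltn_trans B5V; rewrite mul2n -addnn leq_add.
  have Eq : ev (Bin RAdd (Bin Shr (Rd aAcc (Var rI)) (Var rsg)) (Var rcar)) (setr s' rI i) = zc i + carry B zc i.
    move: Esg => /= ->; rewrite EA (modn_small iV) HA // mulKn ?expn_gt0 // Ec modn_small //.
    exact: ltn_trans q5 (V_ltW V256 W_V).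
  rewrite !run_seq !cost_seq (run_asg _ Eq q5).
  set s2 := setr (setr s' rI i) rq _.
  have P3 : pairst s2 by apply: pairst_set.
  have [R3 _ [_ _ _ _ EP3]] := P3.
  have Ei : ev (Bin Add (Bin Mul (Var rP) (Var rst)) (Var rI)) s2 = base + i.
    by move: EP3 (c_st (r_c R3)) => /= -> ->.
  have Hist : i < stride by apply: leq_trans Hi dst.
  have Em : ev (Bin Add (Bin Mul (Var rP) (Var rst)) (Var rI)) s2 %% V = base + i.
    by rewrite Ei modn_small // /base idx3V.
  have EB : ev (Bin Mod (Var rq) (Var rB)) s2 = dig B (cnt E u v) i.
    by move: (c_B (r_c R3)) => /= ->; rewrite (carry_dig B0 zc Hi) zc_value.
  set s3 := run (Sto _ _ _) s2.
  have P4 : pairst s3 by apply: pairst_run.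
  have EC3 x : ar s3 aC x = if x == base + i then dig B (cnt E u v) i else ar s' aC x.
    rewrite /s3 [run _ _]/(seta s2 aC (ev _ s2 %% V) (stv V aC (ev (Bin Mod (Var rq) (Var rB)) s2))) Em EB /=.
    by case: eqP => // _; rewrite stv_small //; apply: leq_ltn_trans (dig_le _ _) (ltV BB1 _).
  have EA3 : ar s3 aAcc = ar s aAcc by rewrite /s3 run_ar.
  have Ecar : ev (Bin Div (Var rq) (Var rB)) s3 = carry B zc i.+1.
    have E1 : rg s3 rq = zc i + carry B zc i by rewrite /s3 run_rg.
    have E2 : rg s3 rB = B by apply: c_B; case: P4 => [[]].
    by clearbody s3; rewrite /= E1 E2.
  have cb2 : carry B zc i.+1 <= B ^ 4 by apply: carry_le => // j; apply: zc_le.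
  have cV : carry B zc i.+1 < V by apply: leq_ltn_trans cb2 (ltV (leqnn (B ^ 4)) _).
  split; last by [].
  rewrite (run_asg _ Ecar cV); split.
  + exact: pairst_set.
  + by [].
  + by [].
  + move=> x; transitivity (ar s3 aC x) => //; rewrite EC3 HC.
    by case: eqP => [->|Hx]; [rewrite leq_addr ltn_add2l ltnSn addKn | congr (if _ then _ else _); rewrite addnS; lia].
rewrite -/carryloop in Es HK; rewrite Es; split=> //.
- exact: pairst_set.
- apply: leq_trans HK _; rewrite sum_nat_const card_ord; apply: leq_add => //.
  by apply: leq_mul => //; apply: ltnW.
Qed.

Lemma sum_mids : \sum_(z < n) mids z <= layer E u t.
Proof. by apply: leq_sum => x _; rewrite midsE; case: (dist E u x == t); case: eqP. Qed.

(** The transform determines the result only modulo [W]; both sides are below [W], the right one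
    being a product of two numbers below [V]. *)
Lemma acc_exact s i : pairst s -> i < d -> eqon (2 ^ k) (ar s aAcc) (IV W k lam lam (accsum n)) ->
  ar s aAcc i = 2 ^ (k - 1 + lam) * zc i.
Proof.
move=> [R _ _] Hi HI; have [k0 lo _ _ _ _ SV] := Z.
have Hik : i < 2 ^ k by apply: leq_trans Hi lo.
have [_ _ I3] := c_inv (r_c R).
have iV : i < V by apply: ltn_trans Hi _; apply: ltn_trans dn nV.
have H1 : ar s aAcc i < W by [].
have HV : 2 ^ (k - 1 + lam) < V.
  by apply: leq_ltn_trans SV; rewrite leq_exp2l // leq_add2r leq_subr.
have HzV : zc i < V by apply: leq_ltn_trans (zc_le i) (ltV (leqnn (B ^ 4)) _).
have H2 : 2 ^ (k - 1 + lam) * zc i < W.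
  rewrite W_V; apply: leq_trans (_ : V ^ 2 <= _); first by rewrite -mulnn; apply: ltn_mul.
  by rewrite leq_pexp2l // (leq_trans _ V256).
have := acc_result Hi; rewrite -(HI i Hik).
by rewrite (modn_small H1) (modn_small H2).
Qed.

Lemma pair_tail_spec s : pairst s -> Cdone d s ->
  [/\ pairst (run (Seq sumC (Seq (invC aAcc) carryC)) s),
   forall x, ar (run (Seq sumC (Seq (invC aAcc) carryC)) s) aC x = if (u * n + v) * stride <= x < (u * n + v) * stride + d
      then dig B (cnt E u v) (x - (u * n + v) * stride) else ar s aC x
   & exists c2 c3 c4 c5, cost (Seq sumC (Seq (invC aAcc) carryC)) s = c2 + c3 + (c4 + c5) /\
     [/\ c2 <= 41 * (2 ^ (k + lam)).+1, c3 <= 5 + (n * 65 + layer E u t * MC), c4 <= FC k lam & c5 <= 10 + n * 60]].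
Proof.
move=> PS HC; have [R SR _] := PS; have [_ _ _ _ Egs] := SR.
have V0 : 0 < V by apply: smallV.
have [k0 _ _ kh _ _ SV] := Z.
rewrite /sumC /carryC 4!run_seq 4!cost_seq -/sumloop -/carryloop.
have K2 := cost_pass V256 W_V aAcc (Num 0) (c_inv (r_c R)) (isT : rgs != rX) (isT : rgs != rXB).
rewrite Egs in K2.
have H0 : eqon (2 ^ (k + lam)) (ar (run (Pass aAcc rgs (Num 0)) s) aAcc) (fun=> 0).
  move=> i Hi; rewrite run_pass //; [|exact: V256|exact: c_inv (r_c R)].
  by rewrite Egs Hi /= stv_small // mod0n.
set c1 := Pass _ _ _ in K2 H0 *.
have P1 : pairst (run c1 s) by apply: pairst_run.
have A1 : ar (run c1 s) aC = ar s aC by rewrite run_ar.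
have C1 : Cdone d (run c1 s) by move=> a b i Hi Hd; rewrite A1 HC.
set s1 := run c1 s in H0 P1 A1 C1 *.
have [P2 A2 K3] := sumloop_spec P1 C1 H0.
have A3 : ar (run sumloop s1) aC = ar s1 aC.
  by have [F1 F2 F3 F4] := macC_frame; rewrite run_ar.
set s2 := run sumloop s1 in P2 A2 A3 *.
have [R2 [EK2 EL2 _ _ _] _] := P2.
have [F KF] := inv_spec V256 W_V (c_inv (r_c R2)) (isT : aAcc \in [:: aX; aAcc; aY]) EK2 k0 EL2 SV (GK_le kh (r_G R2)) A2.
have P3 : pairst (run (invC aAcc) s2) by apply: pairst_run.
have A4 : ar (run (invC aAcc) s2) aC = ar s2 aC by rewrite run_ar.
set s3 := run (invC aAcc) s2 in F P3 A4 *.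
have HA i : i < d -> ar s3 aAcc i = 2 ^ (k - 1 + lam) * zc i by move=> Hi; apply: acc_exact.
clearbody s3.
have E0 : ev (Num 0) s3 = 0 by [].
rewrite (run_asg _ E0 V0).
have P4 : pairst (setr s3 rcar 0) by apply: pairst_set.
have [P5 A5 K5] := carryloop_spec P4 (erefl : rg (setr s3 rcar 0) rcar = 0) HA.
split=> //.
- by move=> x; rewrite A5; case: ifP => // _; transitivity (ar s3 aC x) => //; rewrite A4 A3 A1.
- exists (cost c1 s), (cost sumloop s1), (cost (invC aAcc) s2), (cost (Asg rcar (Num 0)) s3 + cost carryloop (setr s3 rcar 0)).
  split=> //; split=> //.
  + apply: leq_trans K3 _; rewrite leq_add2l big_split /= sum_nat_const card_ord leq_add2l.
    by rewrite -big_distrl leq_mul2r sum_mids orbT.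
  + by apply: leq_trans (leq_add (leqnn _) K5) _; rewrite addnA leq_add2r.
Qed.
End Pair.

(** * All pairs, by increasing distance *)

Notation PC := (100 * 1000 * (h.+1 ^ 3 * n.+1)).

Lemma pair_spec s (u v : 'I_n) d k lam : ready s -> sizes d k lam -> size_regs s k lam -> 1 < d -> d < n ->
  rg s rD = d -> rg s rP = u * n + v -> dist E u v = d -> Cdone d s ->
  [/\ ready (run pairC s), size_regs (run pairC s) k lam,
   forall x, ar (run pairC s) aC x = if (u * n + v) * stride <= x < (u * n + v) * stride + d
      then dig B (cnt E u v) (x - (u * n + v) * stride) else ar s aC x
   & cost pairC s <= PC].
Proof.
move=> R Z SR d1 dn ED EP Huv HC.
rewrite /pairC [run _ _]run_seq [cost _ _]cost_seq.
have [R1 EU EV [t [ET td Hmin]] K1] := pick_spec R EP ED d1 dn.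
have A1 : ar (run pickC s) aC = ar s aC by rewrite run_ar.
have SR1 : size_regs (run pickC s) k lam by apply: size_regs_run.
have PS : pairst u v d t k lam (run pickC s).
  by split=> //; split=> //; rewrite run_rg.
have C1 : Cdone d (run pickC s) by move=> a b i Hi Hd; rewrite A1 HC.
set s1 := run pickC s in R1 A1 SR1 PS C1 *.
have [[R2 SR2 _] A2 [c2 [c3 [c4 [c5 [-> [K2 K3 K4 K5]]]]]]] := pair_tail_spec Z dn td Huv PS C1.
split=> //; first by move=> x; rewrite A2 A1.
have [k0 lo hi kh Hl Hl2 SV] := Z.
have d0 : 0 < d by apply: ltnW.
have lk : lam <= k.
  rewrite -(@leq_exp2l 2) //; apply: leq_trans Hl2 _; case: (k) k0 => // j _.
  by rewrite expnS leq_mul2l /=; apply: ltn_expl.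
have lh : lam <= h.+1 by apply: leq_trans lk kh.
have HS : 2 ^ (k + lam) <= 4 * (d * h.+1).
  rewrite expnD; apply: leq_trans (leq_mul hi Hl2) _; rewrite -mulnA [d * (2 * k)]mulnCA mulnA.
  by rewrite leq_mul2l leq_mul2l kh !orbT.
have HF : FC k lam <= 17 * 1000 * (d * h.+1 ^ 3).
  by apply: FC_le => //; rewrite addn1 mul2n -addnn; apply: (@leq_trans h.+2); rewrite // -[h.+2]addn1 leq_add2l.
have HS3 : 2 ^ (k + lam) <= 4 * (d * h.+1 ^ 3).
  by apply: leq_trans HS _; rewrite leq_mul2l leq_mul2l -{1}[h.+1]expn1 leq_pexp2l // !orbT.
(* [small_layer] bounds the layer times [d.-1], and [d <= 2 * d.-1] because [1 < d]. *)
have HL : layer E u t * d <= 2 * n.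
  apply: leq_trans (_ : layer E u t * (2 * d.-1) <= _).
    by rewrite leq_mul2l; apply/orP; right; case: (d) d1 => // -[] // e _; rewrite /= mul2n -addnn -[e.+2]addn1 leq_add2l.
  by rewrite mulnCA leq_mul2l small_layer.
apply: (pair_cost _ _ (ltnW dn) HL HS3 HF (leqnn _) K1 K2 K3 K4 K5); last by rewrite expn_gt0.
exact: leq_ltn_trans dn.
Qed.

(** [m] is the number of pairs already scanned for distance [d]. Entries not yet computed are zero,
    which is the final value for unreachable pairs. *)
Definition Cinv d m s := forall (u v : 'I_n) i, i < stride ->
  ar s aC ((u * n + v) * stride + i) =
    if [|| dist E u v < 2, dist E u v < d | (dist E u v == d) && (u * n + v < m)] then dig B (cnt E u v) i else 0.

Definition dst x := if insub (x %/ n) is Some u then (if insub (x %% n) is Some v then dist E u v else n) else n.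

Lemma dstE (u v : 'I_n) : dst (u * n + v) = dist E u v.
Proof. by rewrite /dst !idxE !valK. Qed.

Lemma Cinv_step s s' (u v : 'I_n) d : 1 < d -> d < n -> dist E u v = d -> Cinv d (u * n + v) s ->
  (forall x, ar s' aC x = if (u * n + v) * stride <= x < (u * n + v) * stride + d
      then dig B (cnt E u v) (x - (u * n + v) * stride) else ar s aC x) ->
  Cinv d (u * n + v).+1 s'.
Proof.
move=> d1 dn Huv HC H a b i Hi; rewrite H.
have dst : d <= stride by apply: leq_trans (ltnW dn) _; apply: leq_pmull.
case: (@eqP _ (a * n + b) (u * n + v)) => [Eab|Nab]; last first.
  rewrite ifF; last first.
    apply/negP => /andP[H1 H2]; apply: Nab.
    have [j Hj Ej] : exists2 j, j < stride & (a * n + b) * stride + i = (u * n + v) * stride + j.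
      exists ((a * n + b) * stride + i - (u * n + v) * stride); last by rewrite subnKC.
      by rewrite ltn_subLR //; apply: leq_trans H2 _; rewrite leq_add2l.
    by have := congr1 (fun y => y %/ stride) Ej; rewrite !divmodE.
  rewrite HC //; congr (if [|| _, _ | _ && _] then _ else _).
  by rewrite [in RHS]ltnS [in RHS]leq_eqVlt; case: eqP.
have Ea : a = u by apply: val_inj; rewrite /= -(idxE a b).1 Eab idxE.
have Eb : b = v by apply: val_inj; rewrite /= -(idxE a b).2 Eab idxE.
rewrite Ea Eb Huv eqxx ltnSn !orbT leq_addr /= ltn_add2l addKn.
case: (ltnP i d) => // Hd; rewrite HC // Huv ltnn ltnn andbF orbF ltnNge d1 /=.
have d0 : 0 < d by apply: ltnW.
by rewrite (dig_small _ (cnt_lt (_ : dist E u v <= d) d0) Hd) ?expn_gt0 // Huv.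
Qed.

Lemma distance_spec s d : ready s -> rg s rD = d -> 1 < d -> d < n -> Cinv d 0 s ->
  [/\ ready (run distanceC s), Cinv d.+1 0 (run distanceC s)
   & cost distanceC s <= 85 + n * 30 + (h + 1) * 30 + \sum_(x < n * n) (30 + (dst x == d) * PC)].
Proof.
move=> R ED d1 dn HC; rewrite /distanceC [run _ _]run_seq [cost _ _]cost_seq.
have [k [lam [Z SR K1]]] := sizes_spec (r_c R) ED d1 dn.
have R1 : ready (run sizesC s) by apply: ready_run.
have ED1 : rg (run sizesC s) rD = d by rewrite run_rg.
have A1 : ar (run sizesC s) aC = ar s aC by rewrite run_ar.
have C1 : Cinv d 0 (run sizesC s) by move=> a b i Hi; rewrite A1 HC.
set s1 := run sizesC s in R1 ED1 C1 SR *.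
have [||[s' [-> [R2 _ _ C2]]] HK] := @for_spec V w (fun x s' => [/\ ready s', size_regs s' k lam, rg s' rD = d & Cinv d x s'])
   (fun x => 25 + (dst x == d) * PC) rP rPB (Var rsz) (If (Bin Eq (Rd aD (Var rP)) (Var rD)) pairC Skip) s1 (n * n)
   (c_sz (r_c R1)) nnV.
- by split=> //; apply: ready_set => //; exact: nnV.
- move=> x s' Hx [R' SR' ED' C'].
  have xV : x < V by apply: ltn_trans nnV.
  have R2 : ready (setr s' rP x) by apply: ready_set.
  have SR2 : size_regs (setr s' rP x) k lam by apply: size_regs_set.
  have [u [v Ex]] := idx_ex Hx; subst x.
  have Ev : ev (Bin Eq (Rd aD (Var rP)) (Var rD)) (setr s' rP (u * n + v)) = (dist E u v == d).
    by move: (r_D R2) => HD; rewrite /= ED' idxm HD.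
  rewrite (run_if _ _ Ev) (cost_if _ _ Ev) dstE.
  case: eqP => Huv; last first.
    split; last by [].
    split=> // a b i Hi; transitivity (ar s' aC ((a * n + b) * stride + i)) => //; rewrite C' //.
    congr (if [|| _, _ | _] then _ else _); case: eqP => //= Hab.
    rewrite [in RHS]ltnS [in RHS]leq_eqVlt; case: eqP => //= Eab; case: Huv.
    by rewrite -Hab -!dstE Eab.
  have HCd : Cdone d (setr s' rP (u * n + v)).
    by move=> a b i Hi Hd; transitivity (ar s' aC ((a * n + b) * stride + i)) => //; rewrite C' // Hd orbT.
  have [R3 SR3 A3 K3] := pair_spec R2 Z SR2 d1 dn ED' erefl Huv HCd.
  split; last by rewrite mul1n; apply: leq_trans (leq_add (leqnn _) (leq_add K3 (leqnn _))) _; rewrite addnA addnAC leq_add2r.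
  split=> //; first by rewrite run_rg.
  exact: (@Cinv_step s').
split.
- exact: ready_set nnV _ _.
- move=> a b i Hi; transitivity (ar s' aC ((a * n + b) * stride + i)) => //; rewrite C2 // idx_lt andbT.
  by rewrite ltn0 andbF orbF (ltnS _ d) (leq_eqVlt (dist E a b) d) [(_ == d) || _]orbC.
- apply: leq_trans (leq_add K1 HK) _.
  set X := \sum_(i < n * n) _; set Y := \sum_(i < n * n) _.
  have -> : X = Y by apply: eq_bigr => x _; rewrite addnAC.
  exact: distance_cost.
Qed.

Lemma Cinv_init d s : d <= 2 -> Cinit s -> Cinv d 0 s.
Proof.
move=> Hd H u v i Hi; rewrite H // ltn0 andbF orbF.
have -> : (dist E u v < 2) || (dist E u v < d) = (dist E u v < 2).
  by case: (ltnP (dist E u v) 2) => //= H2; apply/negbTE; rewrite -leqNgt; apply: leq_trans Hd H2.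
case: ifP => H2; last by rewrite andbF.
have -> : cnt E u v = 1.
  apply: cnt_le1 => //; case: (ltnP 1 n) => Hn; first exact: leq_trans H2 Hn.
  have Euv : u = v.
    have Z x : nat_of_ord (x : 'I_n) = 0 by apply/eqP; rewrite -leqn0 -ltnS; apply: leq_trans (ltn_ord x) Hn.
    by apply: val_inj; rewrite /= !Z.
  by rewrite Euv dist_refl; apply: leq_ltn_trans (ltn_ord v).
rewrite andbT; case: i Hi => [|i] Hi; first by rewrite /dig expn0 divn1 modn_small ?B2.
by rewrite (@dig_small _ _ 1 _ 1) ?expn1 ?B2 // expn_gt0.
Qed.

Lemma Cinv_end s : Cinv n 0 s -> forall (u v : 'I_n) i, i < stride -> ar s aC ((u * n + v) * stride + i) = dig B (cnt E u v) i.
Proof.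
move=> H u v i Hi; rewrite H // ltn0 andbF orbF.
case: ifP => // /negbT; rewrite negb_or -!leqNgt => /andP[_ H2].
by rewrite /cnt ltnNge H2 /dig div0n mod0n.
Qed.

(** All pairs are scanned for every [d], but a pair has only one distance: the expensive step is
    paid at most [n * n] times in total, next to [n * n * n] cheap tests. *)
Lemma count_spec s : ready s -> Cinit s ->
  [/\ ready (run countC s), Cinv n 0 (run countC s) & cost countC s <= 101 * 1000 * MM].
Proof.
move=> R HC; rewrite /countC.
have [||[s' [-> [R2 C2]]] HK] := @for_spec V w (fun d s' => ready s' /\ Cinv d 0 s')
   (fun d => 90 + n * 30 + (h + 1) * 30 + \sum_(x < n * n) (30 + (dst x == d) * PC)) rD rDB (Var rN)
   (If (Bin Lt (Num 1) (Var rD)) distanceC Skip) s n (c_N (r_c R)) nV.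
- by split; [apply: ready_set => //; exact: nV | exact: Cinv_init].
- move=> d s' Hd [R' C'].
  have dV : d < V by apply: ltn_trans nV.
  have R2 : ready (setr s' rD d) by apply: ready_set.
  have C2 : Cinv d 0 (setr s' rD d) by [].
  have Ev : ev (Bin Lt (Num 1) (Var rD)) (setr s' rD d) = (1 < d) by [].
  rewrite (run_if _ _ Ev) (cost_if _ _ Ev); case: (ltnP 1 d) => d1; last first.
    split; last by [].
    split=> // u v i Hi; rewrite [LHS]C2 // !ltn0 !andbF !orbF.
    congr (if _ then _ else _); case: (ltnP (dist E u v) 2) => //= H2.
    have F e : e <= 2 -> dist E u v < e = false.
      by move=> He; apply/negbTE; rewrite -leqNgt; apply: leq_trans He H2.
    by rewrite !F //; apply: leq_trans d1 _.
  have [R3 C3 K3] := distance_spec R2 erefl d1 Hd C2.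
  split=> //.
  exact: count_step_cost K3.
split.
- by apply: ready_set => //; exact: nV.
- exact: C2.
- apply: leq_trans HK _; apply: leq_trans (count_cost n h); rewrite leq_add2l.
  have H (x : 'I_(n * n)) : \sum_(d < n) (dst x == d) <= 1.
    case: (ltnP (dst x) n) => Hx; last first.
      by rewrite big1 // => d _; case: eqP => // Ed; move: (leq_trans (ltn_ord d) Hx); rewrite Ed ltnn.
    rewrite (bigD1 (Ordinal Hx)) //= eqxx big1 // => d Hd; case: eqP => // Ed.
    by case/eqP: Hd; apply: val_inj.
  apply: leq_trans (_ : \sum_(d < n) ((110 + n * 30 + (h + 1) * 30) + (n * n * 30 + (\sum_(x < n * n) (dst x == d)) * PC)) <= _).
    apply: leq_sum => d _; apply: leq_trans (count_term _ _ _) _; rewrite leq_add2l.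
    by rewrite big_split /= sum_nat_const card_ord -big_distrl.
  rewrite big_split /= sum_nat_const card_ord leq_add2l big_split /= sum_nat_const card_ord leq_add2l.
  rewrite -big_distrl leq_mul2r; apply/orP; right.
  rewrite exchange_big /=; apply: leq_trans (_ : \sum_(x < n * n) 1 <= _); first by apply: leq_sum.
  by rewrite sum1_card card_ord.
Qed.

(** * Packing 128 digits into a word *)

Lemma W_B : W = B ^ 128. Proof. by rewrite W_V V_E -expnM. Qed.

Definition packE := Bin RAdd (Bin RMul (Rd aOut (Var rX)) (Var rB))
  (Rd aC (Bin Add (Bin Mul (Num 128) (Var rX)) (Bin Sub (Num 127) (Var rI)))).

(** Horner's rule from the top: after [i] rounds word [q] consists of the highest [i] digits of its
    group of 128. *)
Lemma pack_step s (u v q : 'I_n) i : consts s -> i < 128 -> rg s rI = i -> rg s rN2 = n * n * n ->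
  (forall j, j < stride -> ar s aC ((u * n + v) * stride + j) = dig B (cnt E u v) j) ->
  let x := (u * n + v) * n + q in
  ar s aOut x = (cnt E u v %/ B ^ (128 * q + 128 - i)) %% B ^ i ->
  ar (run (Pass aOut rN2 packE) s) aOut x = (cnt E u v %/ B ^ (128 * q + 128 - i.+1)) %% B ^ i.+1.
Proof.
move=> C Hi EI EN HC x HO; have EB := c_B C.
have xL : x < n * n * n by rewrite [X in _ < X]mulnC; exact: (mixed_lt (idx_lt u v) (ltn_ord q)).
have xV : x < V by apply: ltn_trans nnnV.
rewrite run_pass //; [|exact: V256|exact: c_inv C].
rewrite EN xL /packE /= (modn_small xV) HO EB EI.
have Hj : 128 * q + (127 - i) < stride.
  apply: (@leq_trans (128 * q.+1)); last by rewrite leq_mul2l ltn_ord orbT.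
  by rewrite mulnS addnC -addSn leq_add2r ltnS leq_subr.
have -> : 128 * x + (127 - i) = (u * n + v) * stride + (128 * q + (127 - i)).
  by rewrite /x mulnDr mulnCA addnA.
rewrite idx3m // HC //.
have Ek : 128 * q + 128 - i = (128 * q + (127 - i)).+1 by rewrite -addnBA ?(ltnW Hi) // -addnS -subSn.
have Ek' : 128 * q + 128 - i.+1 = 128 * q + (127 - i) by rewrite -addnBA // subSS.
rewrite Ek Ek' /stv /= modnDml -horner_step ?expn_gt0 // modn_small // horner_step ?expn_gt0 //.
by rewrite W_B; apply: leq_trans (_ : B ^ i.+1 <= _); [rewrite ltn_mod expn_gt0 expn_gt0 | rewrite leq_exp2l // B2].
Qed.

Lemma pack_spec s : ready s -> Cinv n 0 s -> (forall i, ar s aOut i = 0) ->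
  (forall u v q : 'I_n, ar (run packC s) aOut ((u * n + v) * n + q) = dig W (cnt E u v) q) /\
  cost packC s <= 10 * 1000 * MM.
Proof.
move=> R HC H0; have HD := Cinv_end HC.
rewrite /packC [run _ _]run_seq [cost _ _]cost_seq.
have E2 : ev (Bin Mul (Var rsz) (Var rN)) s = n * n * n by rewrite /= (c_sz (r_c R)) (c_N (r_c R)).
rewrite (run_asg _ E2 nnnV).
set s1 := setr s rN2 _.
have R1 : ready s1 by apply: ready_set => //; exact: nnnV.
have V128 : 128 < V by apply: smallV.
have [||[s' [-> [_ _ _ HO]]] HK] := @for_spec V w (fun i s' => [/\ ready s', rg s' rN2 = n * n * n, ar s' aC = ar s aC &
    forall u v q : 'I_n, ar s' aOut ((u * n + v) * n + q) = (cnt E u v %/ B ^ (128 * q + 128 - i)) %% B ^ i])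
  (fun _ => 70 * (n * n * n).+1) rI rIB (Num 128) (Pass aOut rN2 packE) s1 128 erefl V128.
- split=> //; first by apply: ready_set.
  by move=> u v q; rewrite expn0 modn1 /= H0.
- move=> i s' Hi [R' EN' EC' HO'].
  have iV : i < V by apply: ltn_trans V128.
  have R2 : ready (setr s' rI i) by apply: ready_set.
  split.
    split; [exact: ready_run R2 | by rewrite run_rg | by rewrite run_ar // | ].
    move=> u v q; apply: pack_step => //; first by case: R2.
      by move=> j Hj; rewrite -HD // -EC'.
    by rewrite -HO'.
  have K := cost_pass V256 W_V aOut packE (c_inv (r_c R2)) (isT : rN2 != rX) (isT : rN2 != rXB).
  by rewrite [rg _ rN2]EN' in K; apply: leq_trans K _; rewrite leq_mul.
split; last first.
  apply: (pack_cost h erefl); apply: leq_trans HK _; by rewrite sum_nat_const card_ord.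
by move=> u v q; transitivity (ar s' aOut ((u * n + v) * n + q)) => //; rewrite HO addnK W_B /dig (expnM B).
Qed.

Lemma main_spec s : inv s -> rg s rN = n -> rg s rB = B -> rg s rh = h -> edges s ->
  (forall a i, a != aE -> ar s a i = 0) ->
  (forall u v q : 'I_n, ar (run mainC s) aOut ((u * n + v) * n + q) = dig W (cnt E u v) q) /\
  cost mainC s <= 200 * 1000 * MM.
Proof.
move=> Hs EN EB Eh He H0; rewrite /mainC [run _ _]run_seq [cost _ _]cost_seq [run _ _]run_seq [cost _ (run _ _)]cost_seq.
have [R1 C1 K1] := init_spec Hs EN EB Eh He H0.
have [R2 C2 K2] := count_spec R1 C1.
have Z i : ar (run countC (run initC s)) aOut i = 0 by rewrite !run_ar // H0.
have [H3 K3] := pack_spec R2 C2 Z.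
split; first exact: H3.
exact: main_cost K1 K2 K3.
Qed.

End Main.

(** * The machine program *)

(** Doubles register 1 from 2 until it exceeds [n], counting in register 2, which yields [B] and
    [h]; four squarings then put [V = B ^ 16] into register 40. *)
Definition prologue : seq instr :=
  [:: Const 1 2; Const 2 1; Const 41 1;
      Op WLt 42 0 1; JumpZ 42 6; Jump 9; Op WAdd 1 1 1; Op WAdd 2 2 41; Jump 3;
      Op WMul 40 1 1; Op WMul 40 40 40; Op WMul 40 40 40; Op WMul 40 40 40].

(** Copies [n] to register 1, as every count occupies [n] words, and puts [9 * V], the address of
    the output array, into register 0. *)
Definition epilogue : seq instr := [:: Const 1 1; Op WMul 1 0 1; Const 0 9; Op WMul 0 0 40; Halt].

Definition apsp_program : program := prologue ++ (ccode mainC 13 ++ epilogue).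

Definition time_bound n := 300 * 1000 * (n.+1 ^ 3 * (trunc_log 2 n).+2 ^ 5).

(** For [n >= 2] one has [n.+1 <= 2 * n], and the logarithm plus two is at most three times the
    logarithm. *)
Lemma soft_time_bound : soft_O time_bound (fun n => n ^ 3).
Proof.
rewrite /soft_O /time_bound; move: (300 * 1000) => K.
exists (K * (2 ^ 3 * 3 ^ 5)), 5, 2 => n n2; rewrite -[K * _ * _]mulnA leq_mul2l; apply/orP; right.
have L1 : 0 < trunc_log 2 n by rewrite trunc_log_gt0.
rewrite mulnACA -!expnMn; apply: leq_mul; rewrite leq_exp2r //; first by rewrite mul2n -addnn -addn1 leq_add2l ltnW.
by move: L1; set L := trunc_log 2 n; lia.
Qed.

Lemma final_cost n h c : c <= 200 * 1000 * (n.+1 ^ 3 * h.+1 ^ 5) ->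
  3 + (5 * (h - 1) + 3) + 4 + c + 4 <= 300 * 1000 * (n.+1 ^ 3 * h.+1 ^ 5).
Proof.
have H1 : h.+1 <= n.+1 ^ 3 * h.+1 ^ 5.
  by apply: leq_trans (_ : h.+1 ^ 5 <= _); rewrite ?leq_pmull ?expn_gt0 // -{1}[h.+1]expn1 leq_pexp2l.
move: H1; set M := _ * _ ^ 5; clear; lia.
Qed.

Section Run.
Variables (n : nat) (E : rel 'I_n).
Let h := (trunc_log 2 n).+1.
Let w := word_size 128 n.
Notation B := (2 ^ h).
Notation V := (B ^ 16).
Notation W := (2 ^ w).
Notation P := apsp_program.

Lemma n_lt_B : n < B. Proof. exact: trunc_log_ltn. Qed.

Lemma B_le : B <= 2 * n.+1.
Proof.
rewrite expnS leq_mul2l /=; case: (posnP n) => [->|n0]; first by rewrite trunc_log0.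
by apply: leqW; apply: trunc_logP.
Qed.

Lemma W_V : W = V ^ 8. Proof. by rewrite -!expnM; congr (2 ^ _); rewrite /w /word_size -/h; lia. Qed.

Lemma code_P : [/\ code_at P 0 prologue, code_at P 13 (ccode mainC 13) & code_at P (13 + csz mainC) epilogue].
Proof.
have : code_at P 0 P by move=> i Hi.
case/code_cat => H1; case/code_cat => H2 H3.
by split=> //; move: H3; rewrite size_ccode.
Qed.

(** Induction on the number [h - j] of doublings left, at 5 steps each; the exit takes 3. *)
Lemma loop_runs j f m : 0 < j <= h -> f 0 = n -> f 1 = 2 ^ j -> f 2 = j -> f 41 = 1 ->
  exists f', [/\ runs w P (5 * (h - j) + 3) 3 f m 9 f' m, f' 0 = n, f' 1 = B, f' 2 = h
    & forall r, 2 < r < 41 -> f' r = f r].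
Proof.
have [C _ _] := code_P.
have BW : 2 * B <= W by rewrite W_V -expnM -expnS -!expnM leq_exp2l //; rewrite /h; lia.
have I i : i < 13 -> nth Halt P i = nth Halt prologue i by move=> Hi; rewrite -(C i Hi) add0n.
elim: {j}(h - j) {-2}j (erefl (h - j)) f => [|k IH] j Ek f /andP[j0 jh] F0 F1 F2 F41.
  have {}jh : j = h by apply/eqP; rewrite eqn_leq jh -subn_eq0 Ek.
  rewrite jh in F1 F2.
  exists [eta f with 42 |-> eval_op w WLt (f 0) (f 1)]; split=> //.
    rewrite Ek -[5 * 0 + 3]/(1 + (1 + 1)).
    apply: (runs_trans (stp_Op _ f m (I 3 isT))).
    apply: (runs_trans (stp_JumpZ _ _ m (I 4 isT))).
    rewrite /= F0 F1 /eval_op n_lt_B modn_small; last first.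
      by apply: leq_trans BW; rewrite leq_pmulr // expn_gt0.
    exact: stp_Jump (I 5 isT).
  by move=> r Hr /=; case: eqP => // Er; rewrite Er in Hr.
have jh1 : j < h by rewrite -subn_gt0 Ek.
have Hn : 2 ^ j <= n.
  case: (posnP n) => n0; first by move: jh1; rewrite /h n0 trunc_log0 ltnS leqNgt j0.
  by apply: leq_trans (trunc_logP (isT : 1 < 2) n0); rewrite leq_exp2l.
pose f1 : nat -> nat := [eta f with 42 |-> eval_op w WLt (f 0) (f 1)].
pose f2 : nat -> nat := [eta f1 with 1 |-> eval_op w WAdd (f1 1) (f1 1)].
pose f3 : nat -> nat := [eta f2 with 2 |-> eval_op w WAdd (f2 2) (f2 41)].
have G1 : f3 1 = 2 ^ j.+1.
  rewrite /f3 /f2 /f1 /= F1 /eval_op addnn -mul2n -expnS modn_small //.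
  by apply: leq_trans BW; rewrite -expnS ltn_exp2l.
have jW : j.+1 < W.
  by apply: leq_ltn_trans jh1 _; apply: leq_trans BW; apply: ltn_trans (ltn_expl h (isT : 1 < 2)) _; rewrite ltn_Pmull ?expn_gt0.
have G2 : f3 2 = j.+1 by rewrite /f3 /f2 /f1 /= F2 F41 /eval_op addn1 modn_small.
have [f' [R' H0 H1 H2 Hr]] := IH j.+1 (etrans (subnS _ _) (congr1 predn Ek)) f3 jh1 F0 G1 G2 F41.
exists f'; split=> //; last first.
  by move=> r Hlt; rewrite Hr //; case: r Hlt => [|[|[|r]]] // Hlt; rewrite /f3 /f2 /f1 /=; case: eqP => // Er; rewrite Er in Hlt.
have -> : 5 * (h - j) + 3 = 1 + (1 + (1 + (1 + (1 + (5 * (h - j.+1) + 3))))).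
  by rewrite subnS Ek /=; lia.
have J : runs w P 1 4 f1 m 6 f1 m.
  have := stp_JumpZ w f1 m (I 4 isT).
  by have -> : f1 42 = 0 by rewrite /f1 /= F0 F1 /eval_op ltnNge Hn mod0n.
apply: (runs_trans (stp_Op _ f m (I 3 isT))); apply: (runs_trans J).
apply: (runs_trans (stp_Op _ f1 m (I 6 isT))); apply: (runs_trans (stp_Op _ f2 m (I 7 isT))).
exact: (runs_trans (stp_Jump _ f3 m (I 8 isT)) R').
Qed.


Definition adj a := nat_of_bool [exists u : 'I_n, exists v : 'I_n, (a == u * n + v) && E u v].

Lemma adj_edge (u v : 'I_n) : adj (u * n + v) = E u v.
Proof.
rewrite /adj; congr nat_of_bool; apply/existsP/idP => [[x /existsP[y /andP[/eqP H Hxy]]]|H]; last first.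
  by exists u; apply/existsP; exists v; rewrite eqxx.
have Ex : u = x by apply: val_inj; rewrite /= -(idxE u v).1 H idxE.
have Ey : v = y by apply: val_inj; rewrite /= -(idxE u v).2 H idxE.
by rewrite Ex Ey.
Qed.

Lemma adj_out a : n * n <= a -> adj a = 0.
Proof.
move=> H; rewrite /adj; case: existsP => // -[x /existsP[y /andP[/eqP Ea _]]].
by move: H; rewrite Ea leqNgt idx_lt.
Qed.

Definition start : st :=
  St (fun r => if r == 0 then n else if r == 1 then B else if r == 2 then h else 0)
     (fun a i => if a == 0 then adj i else 0).

Lemma h_gt0 : 0 < h. Proof. by []. Qed.

Lemma prologue_runs : exists f, runs w P (3 + (5 * (h - 1) + 3) + 4) 0 (regs (init E)) adj 13 f adj /\ rel_st V f adj start.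
Proof.
have [C _ _] := code_P.
have I i : i < 13 -> nth Halt P i = nth Halt prologue i by move=> Hi; rewrite -(C i Hi) add0n.
have VW : V < W by apply: V_ltW W_V; apply: (@V256 h).
have pW k : k < 5 -> (B ^ (2 ^ k)) %% W = B ^ (2 ^ k).
  move=> Hk; rewrite modn_small //; apply: leq_ltn_trans VW.
  by rewrite (leq_pexp2l _ (_ : _ <= 2 ^ 4)) ?expn_gt0 // leq_exp2l.
have sq k : B ^ (2 ^ k) * B ^ (2 ^ k) = B ^ (2 ^ k.+1) by rewrite -expnD addnn -mul2n -expnS.
have W2 : 2 < W by apply: leq_ltn_trans VW; apply: leq_trans (_ : 256 <= _) => //; apply: (@V256 h).
pose f0 : nat -> nat := [eta (fun=> 0) with 0 |-> n].
pose f1 : nat -> nat := [eta f0 with 1 |-> 2 %% W].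
pose f2 : nat -> nat := [eta f1 with 2 |-> 1 %% W].
pose f3 : nat -> nat := [eta f2 with 41 |-> 1 %% W].
have W1 := ltnW W2.
have [|||f [R F0 F1 F2 Fr]] := @loop_runs 1 f3 adj h_gt0 erefl.
- by rewrite /f3 /f2 /f1 /= modn_small.
- by rewrite /f3 /f2 /f1 /= modn_small.
- by rewrite /f3 /= modn_small.
pose g1 : nat -> nat := [eta f with 40 |-> eval_op w WMul (f 1) (f 1)].
pose g2 : nat -> nat := [eta g1 with 40 |-> eval_op w WMul (g1 40) (g1 40)].
pose g3 : nat -> nat := [eta g2 with 40 |-> eval_op w WMul (g2 40) (g2 40)].
pose g4 : nat -> nat := [eta g3 with 40 |-> eval_op w WMul (g3 40) (g3 40)].
have G1 : g1 40 = B ^ (2 ^ 1) by rewrite /g1 /= F1 /eval_op (sq 0 : B * B = _) pW.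
have G2 : g2 40 = B ^ (2 ^ 2) by rewrite [g2 40]/(eval_op w WMul (g1 40) (g1 40)) G1 /eval_op sq pW.
have G3 : g3 40 = B ^ (2 ^ 3) by rewrite [g3 40]/(eval_op w WMul (g2 40) (g2 40)) G2 /eval_op sq pW.
have G4 : g4 40 = B ^ (2 ^ 4) by rewrite [g4 40]/(eval_op w WMul (g3 40) (g3 40)) G3 /eval_op sq pW.
exists g4; split.
  have -> : 3 + (5 * (h - 1) + 3) + 4 = 1 + (1 + (1 + ((5 * (h - 1) + 3) + (1 + (1 + (1 + 1)))))) by lia.
  apply: (runs_trans (stp_Const w f0 adj (I 0 isT))); apply: (runs_trans (stp_Const w f1 adj (I 1 isT))).
  apply: (runs_trans (stp_Const w f2 adj (I 2 isT))); apply: (runs_trans R).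
  apply: (runs_trans (stp_Op w f adj (I 9 isT))); apply: (runs_trans (stp_Op w g1 adj (I 10 isT))).
  apply: (runs_trans (stp_Op w g2 adj (I 11 isT))); exact: (stp_Op w g3 adj (I 12 isT)).
split=> //.
- move=> r Hr; have -> : g4 r = f r by rewrite /g4 /g3 /g2 /g1 /= (ltn_eqF Hr).
  case: r Hr => [|[|[|r]]] // Hr; rewrite Fr; last by rewrite ltnS (leqW Hr).
  by rewrite /f3 /f2 /f1 /f0 /=; case: eqP => // Er; rewrite Er in Hr.
- move=> [|a] i Ha Hi; first by rewrite mul0n.
  (* The matrix fits in array 0 because [n * n < V]; all other arrays start in zero cells. *)
  rewrite adj_out //; apply: leq_trans (ltnW (nnV h_gt0 n_lt_B erefl)) _.
  by rewrite mulSn -addnA leq_addr.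
Qed.

Lemma start_inv : inv V w start.
Proof.
have V256' : 256 <= V by apply: (@V256 h).
have VW : V < W by apply: V_ltW W_V.
have V1 : 1 < V by apply: leq_trans V256'.
have H a i : ar start a i < V by rewrite /=; case: ifP => _; [apply: leq_ltn_trans V1; apply: leq_b1 | apply: ltnW].
split=> //; last by move=> a i; apply: ltn_trans VW.
move=> r; have BV : B <= V by rewrite -{1}[B]expn1 leq_pexp2l ?expn_gt0.
have nV' := leq_trans n_lt_B BV.
have hV' : h < V by apply: leq_trans BV; apply: ltn_expl.
rewrite /=; case: ifP => // _; case: ifP => [_|_]; last by case: ifP => // _; apply: ltnW.
by rewrite -{1}[B]expn1 ltn_exp2l //; apply: B2.
Qed.

Lemma region_bound : 9 * V + V < W.
Proof.
have V256' : 256 <= V by apply: (@V256 h).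
have V10 : 10 < V by apply: leq_trans V256'.
have V2 : V ^ 2 <= W by rewrite W_V leq_pexp2l // !expn_gt0.
by apply: leq_trans V2; rewrite -mulnn addnC -mulSn ltn_mul2r V10 !expn_gt0.
Qed.

Lemma out_lt (u v q : 'I_n) : (u * n + v) * n + q < n * n * n.
Proof. by rewrite [X in _ < X]mulnC; exact: (mixed_lt (idx_lt u v) (ltn_ord q)). Qed.

Lemma apsp_runs : exists t f m, [/\ t <= time_bound n, runs w P t 0 (regs (init E)) adj (13 + csz mainC + 4) f m,
  f 0 = 9 * V, f 1 = n & forall u v q : 'I_n, m (9 * V + ((u * n + v) * n + q)) = dig W (cnt E u v) q].
Proof.
have V256' : 256 <= V by apply: (@V256 h).
have VW : V < W by apply: V_ltW W_V.
have [C1 C2 C3] := code_P.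
have [f1 [R1 S1]] := prologue_runs.
have [f2 [m2 [R2 S2]]] := exec_ccode V256' W_V C2 wfc_mainC start_inv S1.
have HE : edges E start by move=> u v; apply: adj_edge.
have H0 a i : a != 0 -> ar start a i = 0 by move=> Ha; rewrite /= (negbTE Ha).
have [H K] := main_spec h_gt0 n_lt_B erefl W_V B_le start_inv erefl erefl erefl HE H0.
have N2 : rg (run V w mainC start) 0 = n by rewrite run_rg //; vm_compute.
have [F G M] := S2.
set p := 13 + csz mainC in C3 R2 *.
have I i : i < 5 -> nth Halt P (p + i) = nth Halt epilogue i by move=> Hi; rewrite (C3 i Hi).
pose g1 : nat -> nat := [eta f2 with 1 |-> 1 %% W].
pose g2 : nat -> nat := [eta g1 with 1 |-> eval_op w WMul (g1 0) (g1 1)].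
pose g3 : nat -> nat := [eta g2 with 0 |-> 9 %% W].
pose g4 : nat -> nat := [eta g3 with 0 |-> eval_op w WMul (g3 0) (g3 40)].
have n_lt_V : n < V by apply: nV h_gt0 n_lt_B erefl.
have W1 : 1 < W by apply: leq_ltn_trans VW; apply: leq_trans V256'.
have V9 : 9 * V < W.
  by apply: leq_ltn_trans region_bound; rewrite leq_addr.
have W9 : 9 < W by apply: leq_ltn_trans V9; rewrite leq_pmulr // !expn_gt0.
have F0 : f2 0 = n by rewrite F.
have G1 : g4 1 = n by rewrite /g4 /g3 /g2 /g1 /= F0 (modn_small W1) /eval_op muln1 modn_small // (ltn_trans n_lt_V).
have G0 : g4 0 = 9 * V by rewrite /g4 /g3 /g2 /g1 /= (modn_small W9) G /eval_op modn_small.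
exists (3 + (5 * (h - 1) + 3) + 4 + cost V w mainC start + 4), g4, m2; split; [| |exact: G0|exact: G1|].
- exact: (final_cost K).
- have Q1 := stp_Const w f2 m2 (I 0 isT); have Q2 := stp_Op w g1 m2 (I 1 isT).
  have Q3 := stp_Const w g2 m2 (I 2 isT); have Q4 := stp_Op w g3 m2 (I 3 isT).
  rewrite -addnA /= in Q1 Q2 Q3 Q4; rewrite addn0 in Q1.
  exact: runs_trans (runs_trans R1 R2) (runs_trans (runs_trans (runs_trans Q1 Q2) Q3) Q4).
- move=> u v q; rewrite (M 9 _ isT); first exact: H.
  by apply: ltn_trans (nnnV h_gt0 n_lt_B erefl); apply: out_lt.
Qed.

(** A count is at most [n ^ n], and [n < W], so [n] words hold it. *)
Lemma cnt_words (u v : 'I_n) : cnt E u v < W ^ n.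
Proof.
have n0 : 0 < n := leq_ltn_trans (leq0n u) (ltn_ord u).
have nW : n < W.
  apply: ltn_trans n_lt_B _; rewrite ltn_exp2l // /w /word_size -/h -[X in X < _]mul1n ltn_mul2r.
  by rewrite h_gt0.
apply: leq_ltn_trans (cnt_bound _ _ _) _.
by apply: leq_ltn_trans (_ : n ^ n < _); rewrite ?ltn_exp2r // leq_pexp2l // dist_le.
Qed.

Lemma apsp_program_solves : solves_in w P (time_bound n) E.
Proof.
have [t [f [m [Ht R F0 F1 HM]]]] := apsp_runs.
have [_ _ C3] := code_P.
have Hh : fetch P (State (13 + csz mainC + 4) f m) = Halt by rewrite /fetch [pc _]/= (C3 4 isT).
(* A halted state is a fixed point, so the exact running time may be padded to the bound depending
   only on [n]. *)
have Fix k : iter k (step w P) (State (13 + csz mainC + 4) f m) = State (13 + csz mainC + 4) f m.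
  by elim: k => // k IH; rewrite iterS IH /step Hh.
have Es : iter (time_bound n) (step w P) (init E) = State (13 + csz mainC + 4) f m.
  rewrite -(subnK Ht) iterD; have -> : iter t (step w P) (init E) = State (13 + csz mainC + 4) f m by exact: R.
  exact: Fix.
rewrite /solves_in Es; split.
- by rewrite /halted Hh.
- rewrite [regs _ _]F0 [regs _ _]F1; apply: ltnW; apply: leq_ltn_trans region_bound; rewrite leq_add2l.
  exact: ltnW (nnnV h_gt0 n_lt_B erefl).
- move=> u v; rewrite [regs _ _]F0 [regs _ _]F1 /multiword [ram _]/=.
  have -> : \sum_(i < n) m (9 * V + (u * n + v) * n + i) * 2 ^ (w * i) = cnt E u v.
    rewrite (eq_bigr (fun i : 'I_n => dig W (cnt E u v) i * W ^ i)) => [|i _].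
      by rewrite sum_dig ?expn_gt0 // modn_small // cnt_words.
    by rewrite -addnA HM expnM.
  exact: cnt_correct.
Qed.
End Run.

Theorem theorem6 :
  exists (c : nat) (P : program) (T : nat -> nat),
    [/\ 1 < c,
        soft_O T (fun n => n ^ 3)
      & forall (n : nat) (E : rel 'I_n), solves_in (word_size c n) P (T n) E].
Proof.
(* 128 is 16 times 8: all sizes stay below [V = B ^ 16], and intermediate values below [V ^ 8]. *)
exists 128, apsp_program, time_bound; split; [by [] | exact: soft_time_bound |].
exact: apsp_program_solves.
Qed.
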